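(* Let $M$ be a connected sRC-manifold, complete with respect to its sub-Riemannian distance, let $p\in M$ and $U\in V^1_p$. Let $H_pM=\bigoplus_{i=1}^mE_i$ be the orthogonal decomposition of $H_pM$ into the eigenspaces of the self-adjoint operator $\mathcal{T}^0_U:H_pM\to H_pM$, $\mathcal{T}^0_U(X)=\mathrm{Tor}(U,X)_H$. Choose an orthonormal basis of $H_pM$ respecting this decomposition, let $\breve T$ be the $V^1_p$-valued skew-symmetric matrix of the bilinear map $\mathrm{Tor}:H_pM\times H_pM\to V^1_p$ in this basis, and let $\breve T_{ij}$ be its blocks relative to the decomposition. Then $$\dim\mathscr{K}^\bullet_p\le\dim\{B=\mathrm{diag}(B_1,\dots,B_m):B_i\in\mathfrak{skew}(E_i),\ B_i\breve T_{ij}=\breve T_{ij}B_j\ \text{for all } i,j\}.$$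
   Context: A sub-Riemannian manifold is a smooth manifold $M$ with a smooth bracket-generating subbundle $HM\subseteq TM$ and a smooth inner product $\langle\cdot,\cdot\rangle$ on $HM$. An sRC-manifold is a sub-Riemannian manifold together with a smooth subbundle $VM$ such that $TM=HM\oplus VM$. Subscripts $H$, $V$ denote the projections. A smooth vector field $K$ is an $H$-Killing field if $[K,HM]\subset HM$, $[K,VM]\subset VM$ and $K\langle X,Y\rangle=\langle[K,X],Y\rangle+\langle X,[K,Y]\rangle$ for sections $X,Y$ of $HM$; $\mathscr{K}$ is the Lie algebra of these. Fix a Riemannian metric $g$ extending $\langle\cdot,\cdot\rangle$ with $HM\perp VM$. The canonical connection $\nabla$ is the unique connection that is compatible with $g$, makes $HM$ and $VM$ parallel, and whose torsion $\mathrm{Tor}(A,B)=\nabla_AB-\nabla_BA-[A,B]$ satisfies $\mathrm{Tor}(HM,HM)\subseteq VM$, $\mathrm{Tor}(VM,VM)\subseteq HM$, and $g(\mathrm{Tor}(Z,X),Y)=g(\mathrm{Tor}(Z,Y),X)$ whenever $X,Y$ lie in one of $HM,VM$ and $Z$ lies in the other. For $X,Y$ horizontal and $U$ vertical, $\mathrm{Tor}(X,Y)$ and $\mathrm{Tor}(U,X)_H$ do not depend on $g$. $V^1_p=H^1_p\cap V_pM$, where $H^1_p\subseteq T_pM$ is the span of $H_pM$ and all $[X,Z]_p$ with $X,Z$ smooth sections of $HM$; one has $\mathrm{Tor}(X,Y)\in V^1_p$ for $X,Y\in H_pM$. $\mathscr{K}^\bullet_p$ is the Lie algebra of $\{F\in\mathrm{Iso}(M):F(p)=p,\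 (F_* )|_{V^1_p}=\mathrm{Id}\}$, where $\mathrm{Iso}(M)$ is the group of diffeomorphisms $F$ of $M$ with $F_*HM=HM$, $F^*\langle\cdot,\cdot\rangle=\langle\cdot,\cdot\rangle$, $F_*VM=VM$. Equivalently, it consists of the $K\in\mathscr{K}$ with $K_p=0$ and $[K,T]_p=0$ for every vector field $T$ with $T_p\in V^1_p$. $\mathfrak{skew}(E)$ denotes skew-adjoint endomorphisms of $E$, identified with skew-symmetric matrices in the chosen orthonormal basis; products of real matrices with $V^1_p$-valued matrices use the usual matrix multiplication formula. *)

(* Defs.v *)
From mathcomp Require Import all_boot all_order all_algebra.
From mathcomp Require Import all_classical all_reals all_analysis.
Set Implicit Arguments.
Unset Strict Implicit.
Unset Printing Implicit Defensive.
Import Order.TTheory GRing.Theory Num.Theory numFieldNormedType.Exports.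
Local Open Scope classical_set_scope.
Local Open Scope ring_scope.

Section LinearAlgebra.
Context {R : realType} {W : lmodType R}.

Definition lin_indep k (v : 'I_k -> W) : Prop :=
  forall c : 'I_k -> R, \sum_i c i *: v i = 0 -> forall i, c i = 0.

Definition span (S : set W) : set W :=
  [set w | exists k (c : 'I_k -> R) (v : 'I_k -> W),
    (forall i, S (v i)) /\ w = \sum_i c i *: v i].

Definition is_basis (S : set W) k (v : 'I_k -> W) : Prop :=
  lin_indep v /\ S = [set w | exists c : 'I_k -> R, w = \sum_i c i *: v i].

(* The supremum of the sizes of independent families in S, that is, the
   dimension of S when S is a linear subspace; +oo in infinite dimension. *)
Definition dimension (S : set W) : \bar R :=
  ereal_sup [set (k%:R)%:E | k in
    [set k | exists v : 'I_k -> W, (forall i, S (v i)) /\ lin_indep v]].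

Definition mulmx_sv p q r (B : 'M[R]_(p, q)) (T : 'M[W]_(q, r)) : 'M[W]_(p, r) :=
  \matrix_(a, b) \sum_l B a l *: T l b.

Definition mulmx_vs p q r (T : 'M[W]_(p, q)) (B : 'M[R]_(q, r)) : 'M[W]_(p, r) :=
  \matrix_(a, b) \sum_l B l b *: T a l.

(* The B = diag(B_1, ..., B_m) with skew-symmetric blocks B_i of size p_i such
   that B_i T_ij = T_ij B_j for all i, j. *)
Definition skew_block_commutant m (p_ : 'I_m -> nat)
    (T : 'M[W]_(\sum_i p_ i)) : set 'M[R]_(\sum_i p_ i) :=
  [set B | exists Bd : forall i, 'M[R]_(p_ i),
    [/\ B = \mxdiag_i Bd i,
        forall i, (Bd i)^T = - Bd i &
        forall i j, mulmx_sv (Bd i) (submxblock T i j)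
                  = mulmx_vs (submxblock T i j) (Bd j)]].

End LinearAlgebra.

(* C^oo on an open set D: all iterated directional derivatives are
   differentiable at every point of D. *)
Definition smooth_on {R : realType} (E : normedModType R) (D : set E)
    (f : E -> R) : Prop :=
  forall (s : seq E) (x : E), D x ->
    differentiable (foldr (fun v g => fun y => 'D_v g y) f s) x.

Record chart (R : realType) (M : Type) (n : nat) := Chart {
  cdom : set M;
  coord : M -> 'rV[R]_n;
  coord_inv : 'rV[R]_n -> M }.

Record smooth_manifold (R : realType) (M : topologicalType) n
    (A : set (chart R M n)) : Prop := SmoothManifold {
  manifold_hausdorff : hausdorff_space M;
  manifold_second_countable : @second_countable M;
  chart_open : forall c, A c -> open (cdom c);
  chart_image_open : forall c, A c -> open (coord c @` cdom c);
  chartK : forall c x, A c -> cdom c x -> coord_inv c (coord c x) = x;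
  chart_continuous : forall c x, A c -> cdom c x -> {for x, continuous (coord c)};
  chart_inv_continuous : forall c x, A c -> cdom c x ->
    {for coord c x, continuous (coord_inv c)};
  chart_cover : forall x, exists2 c, A c & cdom c x;
  chart_compatible : forall c c' (i : 'I_n), A c -> A c' ->
    smooth_on (coord c @` (cdom c `&` cdom c'))
      (fun y => coord c' (coord_inv c y) ord0 i) }.

Section Geometry.
Context {R : realType} {M : topologicalType} {n : nat} (A : set (chart R M n)).

Definition smooth (f : M -> R) : Prop :=
  forall c, A c -> smooth_on (coord c @` cdom c) (fun y => f (coord_inv c y)).

(* Tangent vectors at x are derivations at x of the algebra of smooth functions.
   They are represented by functions on all of M -> R, normalised to vanish on
   the functions that are not smooth; this makes the representation unique and
   the tangent space a linear subspace of (M -> R) -> R. *)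
Local Notation tvec := ((M -> R) -> R).
Local Notation vfield := (M -> (M -> R) -> R).
Local Notation distribution := (M -> set ((M -> R) -> R)).
Local Notation form := (M -> ((M -> R) -> R) -> ((M -> R) -> R) -> R).

Definition tangent (x : M) : set tvec :=
  [set v | [/\ forall f, ~ smooth f -> v f = 0,
               forall (a : R) f g, smooth f -> smooth g ->
                 v (fun y => a * f y + g y) = a * v f + v g &
               forall f g, smooth f -> smooth g ->
                 v (fun y => f y * g y) = f x * v g + g x * v f]].

Definition app (X : vfield) (f : M -> R) : M -> R := fun x => X x f.

Definition smooth_vf (X : vfield) : Prop :=
  (forall x, tangent x (X x)) /\ (forall f, smooth f -> smooth (app X f)).

Definition bracket (X Y : vfield) : vfield :=
  fun x f => X x (app Y f) - Y x (app X f).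

Definition scale_vf (f : M -> R) (X : vfield) : vfield := fun x => f x *: X x.

Definition section (D : distribution) (X : vfield) : Prop :=
  smooth_vf X /\ forall x, D x (X x).

(* The local frames are restrictions of global sections, which is no loss of
   generality because local sections can be multiplied by bump functions. *)
Definition subbundle (D : distribution) (r : nat) : Prop :=
  (forall x, D x `<=` tangent x) /\
  (forall x : M, exists X : 'I_r -> vfield,
    (forall i, section D (X i)) /\
    \forall y \near x, is_basis (D y) (fun i => X i y)).

Definition smooth_inner_product (D : distribution) (g : form) : Prop :=
  [/\ forall x (a : R) u v w, D x u -> D x v -> D x w ->
        g x (a *: u + v) w = a * g x u w + g x v w,
      forall x u v, D x u -> D x v -> g x u v = g x v u,
      forall x u, D x u -> u != 0 -> 0 < g x u u &
      forall X Y, section D X -> section D Y ->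
        smooth (fun x => g x (X x) (Y x))].

Inductive lie_generated (D : distribution) : vfield -> Prop :=
| lie_section X : section D X -> lie_generated D X
| lie_bracket X Y : lie_generated D X -> lie_generated D Y ->
    lie_generated D (bracket X Y).

Definition bracket_generating (D : distribution) : Prop :=
  forall x, tangent x `<=` span [set X x | X in lie_generated D].

Record sRC_structure (H V : distribution) (ip : form) : Prop := SRCStructure {
  horizontal_subbundle : exists k, subbundle H k;
  horizontal_generating : bracket_generating H;
  horizontal_metric : smooth_inner_product H ip;
  vertical_subbundle : exists l, subbundle V l;
  complement_sum : forall x v, tangent x v ->
    exists u w, [/\ H x u, V x w & v = u + w];
  complement_cap : forall x v, H x v -> V x v -> v = 0 }.

Definition projH (H V : distribution) (x : M) (v : tvec) : tvec :=
  xget 0 [set u | H x u /\ V x (v - u)].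

Definition velocity (gam : R -> M) (t : R) : tvec :=
  fun f => if `[< smooth f >] then derive1 (fun s => f (gam s)) t else 0.

(* Smooth curves need not be immersed; hence piecewise smooth curves
   reparametrise to smooth ones and give the same distance. *)
Definition horizontal_curve (H : distribution) (gam : R -> M) : Prop :=
  (forall f, smooth f -> smooth_on [set: R] (fun t => f (gam t))) /\
  (forall t, 0 <= t <= 1 -> H (gam t) (velocity gam t)).

Definition curve_length (ip : form) (gam : R -> M) : R :=
  Rintegral lebesgue_measure `[0, 1]
    (fun t => Num.sqrt (ip (gam t) (velocity gam t) (velocity gam t))).

Definition sR_dist (H : distribution) (ip : form) (x y : M) : \bar R :=
  ereal_inf [set (curve_length ip gam)%:E | gam in
    [set gam | [/\ horizontal_curve H gam, gam 0 = x & gam 1 = y]]].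

Definition sR_complete (H : distribution) (ip : form) : Prop :=
  forall u : nat -> M,
    (forall e : R, 0 < e -> exists N, forall i j, (N <= i)%N -> (N <= j)%N ->
       (sR_dist H ip (u i) (u j) < e%:E)%E) ->
    exists x, forall e : R, 0 < e -> exists N, forall i, (N <= i)%N ->
       (sR_dist H ip (u i) x < e%:E)%E.

Definition extending_metric (H V : distribution) (ip g : form) : Prop :=
  [/\ smooth_inner_product tangent g,
      forall x u v, H x u -> H x v -> g x u v = ip x u v &
      forall x u w, H x u -> V x w -> g x u w = 0].

Record is_connection (nab : vfield -> vfield -> vfield) : Prop := IsConnection {
  nab_smooth : forall X Y, smooth_vf X -> smooth_vf Y -> smooth_vf (nab X Y);
  nab_linl : forall f X X' Y, smooth f -> smooth_vf X -> smooth_vf X' ->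
    smooth_vf Y -> nab (scale_vf f X + X') Y = scale_vf f (nab X Y) + nab X' Y;
  nab_addr : forall X Y Y', smooth_vf X -> smooth_vf Y -> smooth_vf Y' ->
    nab X (Y + Y') = nab X Y + nab X Y';
  nab_leibniz : forall f X Y, smooth f -> smooth_vf X -> smooth_vf Y ->
    nab X (scale_vf f Y) = scale_vf (app X f) Y + scale_vf f (nab X Y) }.

Definition torsion (nab : vfield -> vfield -> vfield) (X Y : vfield) : vfield :=
  nab X Y - nab Y X - bracket X Y.

Record canonical_connection (H V : distribution) (g : form)
    (nab : vfield -> vfield -> vfield) : Prop := CanonicalConnection {
  canonical_is_connection : is_connection nab;
  canonical_metric : forall X Y Z, smooth_vf X -> smooth_vf Y -> smooth_vf Z ->
    forall x, X x (fun y => g y (Y y) (Z y))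
            = g x (nab X Y x) (Z x) + g x (Y x) (nab X Z x);
  canonical_parallelH : forall X Y, smooth_vf X -> section H Y -> section H (nab X Y);
  canonical_parallelV : forall X Y, smooth_vf X -> section V Y -> section V (nab X Y);
  torsion_HH : forall X Y, section H X -> section H Y ->
    forall x, V x (torsion nab X Y x);
  torsion_VV : forall X Y, section V X -> section V Y ->
    forall x, H x (torsion nab X Y x);
  torsion_symH : forall X Y Z, section H X -> section H Y -> section V Z ->
    forall x, g x (torsion nab Z X x) (Y x) = g x (torsion nab Z Y x) (X x);
  torsion_symV : forall X Y Z, section V X -> section V Y -> section H Z ->
    forall x, g x (torsion nab Z X x) (Y x) = g x (torsion nab Z Y x) (X x) }.

(* Some smooth vector field with value v at x; one exists for every v tangent
   at x.  Torsion is tensorial, so torsion_at does not depend on the choice. *)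
Definition extend (x : M) (v : tvec) : vfield :=
  xget 0 [set X | smooth_vf X /\ X x = v].

Definition torsion_at (nab : vfield -> vfield -> vfield) (x : M) (u v : tvec) : tvec :=
  torsion nab (extend x u) (extend x v) x.

Definition T0 (H V : distribution) (nab : vfield -> vfield -> vfield) (x : M)
    (U X : tvec) : tvec :=
  projH H V x (torsion_at nab x U X).

Definition H1 (H : distribution) (x : M) : set tvec :=
  span (H x `|` [set v | exists X Z,
    [/\ section H X, section H Z & v = bracket X Z x]]).

Definition V1 (H V : distribution) (x : M) : set tvec := H1 H x `&` V x.

Definition pushforward (F : M -> M) (v : tvec) : tvec := fun f => v (fun y => f (F y)).

Definition smooth_map (F : M -> M) : Prop :=
  forall f, smooth f -> smooth (fun x => f (F x)).

Definition diffeomorphism (F : M -> M) : Prop :=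
  smooth_map F /\ exists G, [/\ smooth_map G, cancel F G & cancel G F].

Definition Iso (H V : distribution) (ip : form) : set (M -> M) :=
  [set F | [/\ diffeomorphism F,
    forall x, pushforward F @` H x = H (F x),
    forall x u v, H x u -> H x v ->
      ip (F x) (pushforward F u) (pushforward F v) = ip x u v &
    forall x, pushforward F @` V x = V (F x)]].

Definition Iso_bullet (H V : distribution) (ip : form) (p : M) : set (M -> M) :=
  [set F | [/\ Iso H V ip F, F p = p &
               forall v, V1 H V p v -> pushforward F v = v]].

(* A smooth action of the additive group R on M by elements of G. *)
Definition one_parameter_subgroup (G : set (M -> M)) (phi : R -> M -> M) : Prop :=
  [/\ forall t, G (phi t),
      forall x, phi 0 x = x,
      forall s t x, phi (s + t) x = phi s (phi t x) &
      forall f c, smooth f -> A c ->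
        smooth_on ([set: R] `*` (coord c @` cdom c))
          (fun z : R * 'rV[R]_n => f (phi z.1 (coord_inv c z.2)))].

(* The Lie algebra of a group of diffeomorphisms of M, realised as usual by the
   infinitesimal generators of its one-parameter subgroups. *)
Definition lie_algebra (G : set (M -> M)) : set vfield :=
  [set K | smooth_vf K /\ exists phi, one_parameter_subgroup G phi /\
           forall x, K x = velocity (fun t => phi t x) 0].

Definition K_bullet (H V : distribution) (ip : form) (p : M) : set vfield :=
  lie_algebra (Iso_bullet H V ip p).

(* The matrix of Tor : H_p x H_p -> V^1_p in the family e. *)
Definition torsion_matrix (nab : vfield -> vfield -> vfield) (p : M) k
    (e : 'I_k -> tvec) : 'M[tvec]_k :=
  \matrix_(a, b) torsion_at nab p (e a) (e b).

(* e is an orthonormal basis of H_p whose i-th block of length p_i lies in the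
   eigenspace of T^0_U for lam_i.  As the lam_i are distinct, all p_i are
   positive and e spans H_p, the span of the i-th block is the full eigenspace
   E_i and the E_i are all the eigenspaces. *)
Definition adapted_basis (H V : distribution) (ip : form)
    (nab : vfield -> vfield -> vfield) (p : M) (U : tvec)
    m (lam : 'I_m -> R) (p_ : 'I_m -> nat) (e : 'I_(\sum_i p_ i) -> tvec) : Prop :=
  [/\ injective lam /\ (forall i, (0 < p_ i)%N),
      is_basis (H p) e,
      forall a b, ip p (e a) (e b) = (a == b)%:R &
      forall i (a : 'I_(p_ i)),
        T0 H V nab p U (e (tagnat.Rank i a)) = lam i *: e (tagnat.Rank i a)].

End Geometry.

(* Main.v *)
Require Import Defs.
From mathcomp Require Import all_boot all_order all_algebra.
From mathcomp Require Import all_classical all_reals all_analysis.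
From mathcomp Require Import ring lra.
Set Implicit Arguments.
Unset Strict Implicit.
Unset Printing Implicit Defensive.
Import Order.TTheory GRing.Theory Num.Theory numFieldNormedType.Exports.
Local Open Scope classical_set_scope.
Local Open Scope ring_scope.

Local Notation coord := Defs.coord.
Local Notation pushforward := Defs.pushforward.

(** The isotropy Lie algebra embeds linearly in the matrix space on the right:
    send a Killing field [K] fixing [p] to the matrix of [X |-> [K, X]_p] on
    [H_p].  This matrix is skew because [K] preserves the metric.  Since [K]
    preserves [H] and [V] and kills [V^1_p] to first order, its flow fixes
    [Tor : H_p x H_p -> V^1_p] and [T^0_U], because [Tor(X, Y) = -[X, Y]_V] and
    [2 <T^0_U X, Y> = U<X, Y> - <[U, X], Y> - <X, [U, Y]>] do not involve the
    connection; so the matrix is block diagonal and commutes with the torsion.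

    Injectivity is a rigidity statement: if [K] and all [[K, X]], [X] horizontal,
    vanish at one point then [K = 0].  Near a point [x0] let [J] be the ideal
    generated by the functions [K f] and [<[K, X], Y>].  The Jacobi identity makes
    [X <[K, Y], Z>] symmetric in [X], [Y] modulo [J], while the Killing equation
    makes it antisymmetric in [Y], [Z]; hence it lies in [J], so [J] is stable under
    horizontal derivations, thus under their brackets, thus under all derivations.
    Gronwall's inequality then shows that the vanishing locus of the 1-jet is open. *)

(** * Calculus of smooth functions *)

(** Vector fields are derivations of the algebra of global smooth functions, so a local identity can
    be differentiated only once it has been made global. This shapes the constructions below:
    Cramer's rule for a local frame is multiplied by a bump function and becomes
    [d X = sum_j c_j Z_j] on all of [M], with [d] nonzero at the chosen point, where it can be
    divided out at the end.

    The rigidity argument uses the extension [g] of the metric because the Jacobi identity brings in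
    brackets of horizontal fields, which have vertical components. As [K] preserves [V], these
    components are invisible to [g([K, .], Y)] with [Y] horizontal.

    Bracket generation yields iterated brackets of uncontrolled length that span the tangent space
    at one point. Stability of an ideal passes to commutators with no bookkeeping on this length,
    which is why the prolongation of the Killing equation is phrased through an ideal.

    A sum of generators of one-parameter groups is not evidently such a generator; linear
    combinations are therefore handled through the infinitesimal conditions [isotropy]. *)

Section SmoothCalculus.
Context {R : realType}.
Implicit Types (E F : normedModType R).

Lemma near_eq_differentiable E F (f g : E -> F) (x : E) :
  (\near x, f x = g x) -> differentiable f x -> differentiable g x.
Proof.
move=> fg df.
have [dfc dfe] := (diff_locallyP x f).1 df.
have fgx : f x = g x by exact: (nbhs_singleton fg).
have gE : g \o shift x = cst (g x) + 'd f x +o_ 0 id.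
  apply/eqaddoP => e e0; move/eqaddoP: dfe => /(_ e e0) dfe.
  have fg0 : \forall h \near (0 : E), f (h + x) = g (h + x).
    by move: fg; rewrite (near_shift 0) /=; apply: filterS => h /=; rewrite subr0.
  near=> h; rewrite /= -fgx !fctE /= -(near fg0 h)//.
  by near: h; exact: dfe.
apply/diff_locallyP; have -> := diff_unique dfc gE.
by split.
Unshelve. all: by end_near. Qed.

Lemma smooth_on_differentiable E (D : set E) (f : E -> R) x :
  smooth_on D f -> D x -> differentiable f x.
Proof. by move=> fs Dx; exact: (fs [::] x Dx). Qed.

Lemma smooth_on_derive E (D : set E) (f : E -> R) v :
  smooth_on D f -> smooth_on D ('D_v f).
Proof.
move=> fs s x Dx; have := fs (rcons s v) x Dx.
by rewrite -cats1 foldr_cat.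
Qed.

Lemma smooth_on_sub E (D D' : set E) (f : E -> R) :
  D' `<=` D -> smooth_on D f -> smooth_on D' f.
Proof. by move=> sub fs s x /sub; exact: fs. Qed.

(** Coinduction for smoothness: iterated derivatives never leave [P], up to equality on [D].
    Equality on [D] is enough because [D] is open, so that the derivatives of two functions equal on
    [D] agree at each of its points. *)
Lemma smooth_on_coind E (D : set E) (P : (E -> R) -> Prop) : open D ->
  (forall f, P f -> forall x, D x -> differentiable f x) ->
  (forall f v, P f -> exists2 g, P g & forall x, D x -> 'D_v f x = g x) ->
  forall f, P f -> smooth_on D f.
Proof.
move=> oD Pd PD f Pf s.
suff [g Pg fg] : exists2 g, P g & forall x, D x ->
    foldr (fun v g y => 'D_v g y) f s x = g x.
  move=> x Dx; apply: (@near_eq_differentiable _ _ g); last exact: Pd.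
  by have := oD; rewrite openE => /(_ x Dx); apply: filterS => y /fg.
elim: s => [|v s [g Pg fg]]; first by exists f.
have [h Ph gh] := PD g v Pg; exists h => // x Dx.
rewrite -gh//=; apply: near_eq_derive.
by have := oD; rewrite openE => /(_ x Dx); apply: filterS => y /fg.
Qed.

Lemma smooth_on_eq E (D : set E) (f g : E -> R) : open D ->
  (forall x, D x -> f x = g x) -> smooth_on D f -> smooth_on D g.
Proof.
move=> oD fg fs.
pose P (h : E -> R) := exists2 k, smooth_on D k & forall x, D x -> k x = h x.
apply: (@smooth_on_coind _ D P) => //; last by exists f.
- move=> h [k ks kh] x Dx.
  apply: (@near_eq_differentiable _ _ k); last exact: smooth_on_differentiable ks Dx.
  by have := oD; rewrite openE => /(_ x Dx); apply: filterS => y /kh.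
- move=> h v [k ks kh]; exists ('D_v k); first by exists ('D_v k) => //; exact: smooth_on_derive.
  move=> x Dx; apply: near_eq_derive.
  by have := oD; rewrite openE => /(_ x Dx); apply: filterS => y /kh.
Qed.

Lemma smooth_on_local E (D : set E) (f : E -> R) :
  (forall x, D x -> exists D' g, [/\ open D', D' x, smooth_on D' g &
    forall y, D' y -> g y = f y]) -> smooth_on D f.
Proof.
move=> loc s x Dx; have [D' [g [oD' D'x gs gf]]] := loc x Dx.
by have /(_ s x D'x) := smooth_on_eq oD' gf gs.
Qed.

Inductive alg_closure E (P : (E -> R) -> Prop) : (E -> R) -> Prop :=
| alg_base f : P f -> alg_closure P f
| alg_cst a : alg_closure P (fun=> a)
| alg_add f g : alg_closure P f -> alg_closure P g -> alg_closure P (fun x => f x + g x)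
| alg_mul f g : alg_closure P f -> alg_closure P g -> alg_closure P (fun x => f x * g x).

(** By the Leibniz rule, once the derivatives of the generators lie in the generated algebra, so do
    all others. For a concrete function it remains to name a class whose derivatives are polynomial
    in the class. *)
Lemma smooth_on_alg E (D : set E) (P : (E -> R) -> Prop) : open D ->
  (forall f, P f -> forall x, D x -> differentiable f x) ->
  (forall f v, P f -> exists2 g, alg_closure P g & forall x, D x -> 'D_v f x = g x) ->
  forall f, alg_closure P f -> smooth_on D f.
Proof.
move=> oD Pd PD.
have Qd f : alg_closure P f -> forall x, D x -> differentiable f x.
  elim=> {f} [f /Pd//|a x _|f g _ df _ dg x Dx|f g _ df _ dg x Dx].
  - exact: differentiable_cst.
  - by apply: differentiableD; [exact: df|exact: dg].
  - by apply: differentiableM; [exact: df|exact: dg].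
apply: smooth_on_coind => // f v.
elim=> {f} [f Pf|a|f g Qf [f' Qf' ff'] Qg [g' Qg' gg']|f g Qf [f' Qf' ff'] Qg [g' Qg' gg']].
- exact: PD.
- by exists (fun=> 0) => [|x _]; [exact: alg_cst|exact: derive_cst].
- exists (fun x => f' x + g' x); first exact: alg_add.
  move=> x Dx; rewrite [LHS]deriveD ?ff' ?gg'//; exact/diff_derivable/Qd.
- exists (fun x => f x * g' x + g x * f' x).
    by apply: alg_add; exact: alg_mul.
  move=> x Dx; rewrite [LHS]deriveM ?ff' ?gg'//; exact/diff_derivable/Qd.
Qed.

Lemma smooth_on_alg_smooth E (D : set E) (f : E -> R) : open D ->
  alg_closure (smooth_on D) f -> smooth_on D f.
Proof.
move=> oD; apply: smooth_on_alg => // [g gs x|g v gs].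
  exact: smooth_on_differentiable.
by exists ('D_v g) => //; apply: alg_base; exact: smooth_on_derive.
Qed.

Lemma smooth_on_cst E (D : set E) (a : R) : open D -> smooth_on D (fun=> a).
Proof. by move=> /smooth_on_alg_smooth; apply; exact: alg_cst. Qed.

Lemma smooth_on_add E (D : set E) (f g : E -> R) : open D ->
  smooth_on D f -> smooth_on D g -> smooth_on D (fun x => f x + g x).
Proof.
by move=> /smooth_on_alg_smooth oD fs gs; apply: oD; apply: alg_add; exact: alg_base.
Qed.

Lemma smooth_on_mul E (D : set E) (f g : E -> R) : open D ->
  smooth_on D f -> smooth_on D g -> smooth_on D (fun x => f x * g x).
Proof.
by move=> /smooth_on_alg_smooth oD fs gs; apply: oD; apply: alg_mul; exact: alg_base.
Qed.

Lemma alg_closure_sum E (P : (E -> R) -> Prop) I (r : seq I) (Q : pred I) (f : I -> E -> R) :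
  (forall i, Q i -> alg_closure P (f i)) ->
  alg_closure P (fun x => \sum_(i <- r | Q i) f i x).
Proof.
move=> fs; have -> : (fun x => \sum_(i <- r | Q i) f i x) =
    \big[(fun f g : E -> R => fun x => f x + g x)/(fun=> 0)]_(i <- r | Q i) f i.
  by apply/funext => x; elim/big_rec2: _ => // i y g _ ->.
elim/big_ind: _ => //; first exact: alg_cst.
by move=> ? ? ? ?; exact: alg_add.
Qed.

Lemma smooth_on_sum E (D : set E) I (r : seq I) (P : pred I) (f : I -> E -> R) : open D ->
  (forall i, P i -> smooth_on D (f i)) -> smooth_on D (fun x => \sum_(i <- r | P i) f i x).
Proof.
move=> /smooth_on_alg_smooth oD fs; apply: oD; apply: alg_closure_sum => i Pi.
exact/alg_base/fs.
Qed.

(** [smooth_on] speaks of scalar functions only, so a map into [F] is given by its coefficients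
    [phi i] along vectors [b i]. The generators are the smooth functions on [D] and the pullbacks of
    smooth functions on [D']; the chain rule expresses derivatives of the latter by products of both
    kinds. *)
Lemma smooth_on_comp E F (D : set E) (D' : set F) N (b : 'I_N -> F)
    (phi : 'I_N -> E -> R) (f : F -> R) : open D ->
  (forall i, smooth_on D (phi i)) -> smooth_on D' f ->
  (forall x, D x -> D' (\sum_i phi i x *: b i)) ->
  smooth_on D (fun x => f (\sum_i phi i x *: b i)).
Proof.
move=> oD phis fs DD'.
pose P (h : E -> R) := smooth_on D h \/ exists2 k, smooth_on D' k &
  h = fun x => k (\sum_i phi i x *: b i).
have dphi x : D x -> differentiable (fun x => \sum_i phi i x *: b i) x.
  move=> Dx; rewrite (_ : (fun _ => _) = \sum_i (fun x => phi i x *: b i)); last first.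
    by apply/funext => y; rewrite fct_sumE.
  apply: differentiable_sum => i; apply: differentiableZl.
  exact: smooth_on_differentiable Dx.
apply: (@smooth_on_alg _ D P) => //; last by apply: alg_base; right; exists f.
- move=> h [hs|[k ks ->]] x Dx; first exact: smooth_on_differentiable hs Dx.
  apply: differentiable_comp; first exact: dphi.
  exact: (smooth_on_differentiable ks (DD' _ Dx)).
- move=> h v [hs|[k ks ->]].
    by exists ('D_v h) => //; apply/alg_base; left; exact: smooth_on_derive.
  exists (fun x => \sum_j 'D_v (phi j) x * 'D_(b j) k (\sum_i phi i x *: b i)).
    apply: alg_closure_sum => j _; apply: alg_mul; apply: alg_base.
      by left; exact: smooth_on_derive.
    by right; exists ('D_(b j) k) => //; exact: smooth_on_derive.
  move=> x Dx; have dk := smooth_on_differentiable ks (DD' _ Dx).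
  rewrite deriveE; last exact: (differentiable_comp (dphi _ Dx) dk).
  rewrite (diff_comp (dphi _ Dx) dk) /=.
  have -> : 'd (fun x => \sum_i phi i x *: b i) x v = \sum_i 'D_v (phi i) x *: b i.
    rewrite -deriveE; last exact: dphi.
    rewrite (_ : (fun _ => _) = \sum_i (fun x => phi i x *: b i)); last first.
      by apply/funext => y; rewrite fct_sumE.
    rewrite derive_sum; last first.
      move=> i; apply/diff_derivable/differentiableZl.
      exact: smooth_on_differentiable Dx.
    apply: eq_bigr => i _; have dp := smooth_on_differentiable (phis i) Dx.
    rewrite deriveE; last exact: differentiableZl.
    by rewrite diffZl//= deriveE.
  rewrite linear_sum; apply: eq_bigr => i _; rewrite linearZ/= (deriveE _ dk).
  by [].
Qed.

End SmoothCalculus.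

(** * Symmetry of second derivatives *)

Section Schwarz.
Context {R : realType} {E : normedModType R}.

Lemma is_derive_line (f : E -> R) (a v : E) (t : R) :
  differentiable f (a + t *: v) ->
  is_derive t (1 : R) (fun s : R => f (a + s *: v)) ('D_v f (a + t *: v)).
Proof.
move=> df.
have eqf : (fun h : R => h^-1 *: (f (a + (h *: (1 : R) + t) *: v) - f (a + t *: v))) =
  (fun h : R => h^-1 *: (f (h *: v + (a + t *: v)) - f (a + t *: v))).
  by apply/funext => h; rewrite scalerDl [h%:A]mulr1 addrCA.
apply: DeriveDef; last by rewrite /derive /= eqf.
by rewrite /derivable /= eqf; exact: (diff_derivable (v := v) df).
Qed.

Lemma MVT_closed (f df : R -> R) (a b : R) : a < b ->
  (forall t, a <= t <= b -> is_derive t (1 : R) f (df t)) ->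
  exists2 c, a < c < b & f b - f a = df c * (b - a).
Proof.
move=> ab fd.
have [| |c] := @MVT R f df a b ab.
- by move=> x; rewrite in_itv => /andP[ax xb]; apply: fd; rewrite !ltW.
- apply: derivable_within_continuous => x; rewrite in_itv => xab.
  by have [] := fd x xab.
by rewrite in_itv /= => cab ->; exists c.
Qed.

(** Two mean value steps, along [u] and then along [v]. The second difference is symmetric in [u]
    and [v], so exchanging them equates values of the two mixed derivatives at nearby points. *)
Lemma second_difference (D : set E) (f : E -> R) (x u v : E) (h : R) : 0 < h ->
  smooth_on D f ->
  (forall s t, 0 <= s <= h -> 0 <= t <= h -> D (x + s *: u + t *: v)) ->
  exists s t, [/\ 0 <= s <= h, 0 <= t <= h &
    f (x + h *: u + h *: v) - f (x + h *: u) - f (x + h *: v) + f x =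
    'D_v ('D_u f) (x + s *: u + t *: v) * h * h].
Proof.
move=> h0 fs xD.
have h0h : 0 <= h <= h by rewrite lexx ltW.
have h00 : (0 : R) <= 0 <= h by rewrite lexx ltW.
have fd := smooth_on_differentiable fs.
have [t tP|s /andP[s0 sh]] := @MVT_closed (fun s => f ((x + h *: v) + s *: u) - f (x + s *: u))
  (fun s => 'D_u f ((x + h *: v) + s *: u) - 'D_u f (x + s *: u)) 0 h h0.
  apply: is_deriveB; apply: is_derive_line; apply: fd.
    by rewrite addrAC; exact: xD.
  by have := xD t 0 tP h00; rewrite scale0r addr0.
rewrite subr0 !scale0r !addr0 => eq1.
have sP : 0 <= s <= h by rewrite !ltW.
have [t tP|t /andP[t0 th]] := @MVT_closed (fun t => 'D_u f ((x + s *: u) + t *: v))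
  (fun t => 'D_v ('D_u f) ((x + s *: u) + t *: v)) 0 h h0.
  apply: is_derive_line; apply: (smooth_on_differentiable (smooth_on_derive u fs)).
  exact: xD.
rewrite subr0 !scale0r !addr0 => eq2.
exists s, t; rewrite -eq2; split => //; first by rewrite !ltW.
rewrite [x + s *: u + _]addrAC -eq1 [x + h *: v + _]addrAC; ring.
Qed.

Lemma dist_mid (e p q r : R) : `|p - r| < e / 2 -> `|q - r| < e / 2 -> `|p - q| <= e.
Proof.
by rewrite !ltr_norml ler_norml => /andP[? ?] /andP[? ?]; apply/andP; split; lra.
Qed.

Lemma continuous2_ball (D : set E) (f g : E -> R) (x : E) (e : R) :
  open D -> D x -> {for x, continuous f} -> {for x, continuous g} -> 0 < e ->
  exists2 d : R, 0 < d & forall y, ball x d y ->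
    [/\ D y, `|f x - f y| < e & `|g x - g y| < e].
Proof.
move=> oD Dx cf cg e0.
have nD : nbhs x D by move: oD; rewrite openE; apply.
have nf : \forall y \near x, `|f x - f y| < e by move/cvgrPdist_lt: cf; apply.
have ng : \forall y \near x, `|g x - g y| < e by move/cvgrPdist_lt: cg; apply.
have /nbhs_ballP[d /= d0 dB] : \forall y \near x,
    [/\ D y, `|f x - f y| < e & `|g x - g y| < e].
  by apply: filterS (filterI nD (filterI nf ng)) => y [? []].
by exists d => // y yB; exact: dB.
Qed.

Lemma derive_sym (D : set E) (f : E -> R) (x u v : E) : open D -> D x ->
  smooth_on D f -> 'D_u ('D_v f) x = 'D_v ('D_u f) x.
Proof.
move=> oD Dx fs.
have cuv : {for x, continuous ('D_u ('D_v f))}.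
  apply: differentiable_continuous; apply: smooth_on_differentiable Dx.
  by do 2!apply: smooth_on_derive.
have cvu : {for x, continuous ('D_v ('D_u f))}.
  apply: differentiable_continuous; apply: smooth_on_differentiable Dx.
  by do 2!apply: smooth_on_derive.
apply/eqP; rewrite -subr_eq0 -normr_le0; apply/ler_addgt0Pl => e e0; rewrite addr0.
have e2 : 0 < e / 2 by rewrite divr_gt0.
have [d d0 dB] := continuous2_ball oD Dx cuv cvu e2.
(* The parallelogram with sides [h u], [h v] at [x] stays within [d / 2] of [x]; the [+ 1] guards
   against [u = v = 0]. *)
pose h := d / 2 / (`|u| + `|v| + 1).
have uv0 : 0 < `|u| + `|v| + 1 by rewrite ltr_wpDl// addr_ge0.
have h0 : 0 < h by rewrite !divr_gt0.
have inB s t : 0 <= s <= h -> 0 <= t <= h -> ball x d (x + s *: u + t *: v).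
  move=> /andP[s0 sh] /andP[t0 th]; rewrite -ball_normE /ball_ /=.
  rewrite -addrA opprD addNKr normrN.
  rewrite (le_lt_trans (ler_normD _ _))// !normrZ !ger0_norm//.
  rewrite (@le_lt_trans _ _ (h * `|u| + h * `|v|))//.
    by apply: lerD; apply: ler_wpM2r.
  rewrite (@le_lt_trans _ _ (h * (`|u| + `|v| + 1)))//.
    by rewrite -mulrDr ler_wpM2l ?(ltW h0)// lerDl.
  by rewrite /h divfK ?gt_eqF//; lra.
have [|s [t [sP tP eq1]]] := @second_difference D f x u v h h0 fs.
  by move=> s t sP tP; have [] := dB _ (inB s t sP tP).
have [|s' [t' [sP' tP' eq2]]] := @second_difference D f x v u h h0 fs.
  move=> s' t' sP' tP'; rewrite addrAC.
  by have [] := dB _ (inB t' s' tP' sP').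
have eq3 : 'D_v ('D_u f) (x + s *: u + t *: v) = 'D_u ('D_v f) (x + s' *: v + t' *: u).
  apply: (mulIf (lt0r_neq0 h0)); apply: (mulIf (lt0r_neq0 h0)).
  apply: etrans (esym eq1) (etrans _ eq2).
  congr (_ + _).
  rewrite [x + h *: v + _]addrAC.
  exact: addrAC.
have [_ _ le1] := dB _ (inB s t sP tP).
have [_ le2 _] := dB _ (inB t' s' tP' sP').
rewrite [x + t' *: u + _]addrAC -eq3 in le2.
exact: dist_mid le2 le1.
Qed.

End Schwarz.

(** * Bump functions *)

Section Flat.
Context {R : realType}.

(** [t^-k exp(-1/t)], extended by zero. Only [k = 0] is wanted for bumps; the other exponents appear
    because differentiation raises them, and the whole family is closed under derivation up to
    linear combinations. *)
Definition flat (k : nat) (t : R) : R :=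
  if 0 < t then t^-1 ^+ k * expR (- t^-1) else 0.

(** With [u = 1/t], [exp u] is the power [k+1] of [exp (u/(k+1))], which is at least [u/(k+1)].
    Applied to [k+1], this controls the difference quotient of [flat k] at zero. *)
Lemma flat_le k (t : R) : 0 < t -> 0 <= flat k t <= k.+1%:R ^+ k.+1 * t.
Proof.
move=> t0; rewrite /flat t0.
have u0 : 0 < t^-1 by rewrite invr_gt0.
apply/andP; split; first by rewrite mulr_ge0 ?expR_ge0// exprn_ge0// ltW.
rewrite expRN ler_pdivrMr ?expR_gt0//.
have kS0 : (0 : R) < k.+1%:R by rewrite ltr0n.
have -> : expR t^-1 = expR (t^-1 / k.+1%:R) ^+ k.+1.
  by rewrite -expRM_natr// divfK// gt_eqF.
have le1 : (t^-1 / k.+1%:R) ^+ k.+1 <= expR (t^-1 / k.+1%:R) ^+ k.+1.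
  apply: lerXn2r; rewrite ?nnegrE ?expR_ge0//; first by rewrite divr_ge0 ?ltW.
  by rewrite (le_trans _ (expR_ge1Dx _))// lerDr.
have ck0 : 0 <= k.+1%:R ^+ k.+1 * t by rewrite mulr_ge0 ?exprn_ge0// ltW.
apply: le_trans (ler_wpM2l ck0 le1).
rewrite expr_div_n mulrAC mulrCA mulfV ?mulr1 ?expf_neq0 ?gt_eqF//.
by rewrite exprS mulrAC mulVf ?mul1r ?gt_eqF.
Qed.

Lemma is_derive_invX k (t : R) : 0 < t ->
  is_derive t (1 : R) (fun s : R => s^-1 ^+ k) (- (k%:R * t^-1 ^+ k.+1)).
Proof.
move=> t0; have tN0 : t != 0 by rewrite gt_eqF.
have dV : is_derive t (1 : R) (fun s : R => s^-1) (- t ^- 2).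
  have := is_deriveV (f := id) tN0 (is_derive_id t (1 : R)).
  by rewrite [_%:A]mulr1.
elim: k => [|k IH].
  by rewrite mul0r oppr0; exact: is_derive_cst.
have := is_deriveM dV IH; rewrite /GRing.scale /=.
have -> : t^-1 * - (k%:R * t^-1 ^+ k.+1) + t^-1 ^+ k * - t ^- 2 =
    - (k.+1%:R * t^-1 ^+ k.+2).
  by rewrite -exprVn !exprS expr0 -natr1; ring.
by congr is_derive; apply/funext => s; rewrite /= exprS.
Qed.

Lemma is_derive_expRNV (t : R) : 0 < t ->
  is_derive t (1 : R) (fun s : R => expR (- s^-1)) (t^-1 ^+ 2 * expR (- t^-1)).
Proof.
move=> t0.
have := is_derive_invX 1 t0; under [X in is_derive _ _ X _]eq_fun do rewrite expr1.
move=> dV.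
have := @is_derive1_comp _ expR (fun s : R => - s^-1) t _ _
  (is_derive_expR (- t^-1)) (is_deriveN dV).
by rewrite opprK mul1r mulrC.
Qed.

Lemma is_derive_flat k (t : R) :
  is_derive t (1 : R) (flat k) (flat k.+2 t - k%:R * flat k.+1 t).
Proof.
have [t0|t0|->] := ltgtP t 0.
- rewrite /flat !ltNge (ltW t0)/= mulr0 subr0.
  apply: (@near_eq_is_derive _ _ _ (fun=> 0)).
  near=> s; suff s0 : s < 0 by rewrite ltNge (ltW s0).
  by near: s; exact: lt_nbhsl.
- have eqn : \near t, t^-1 ^+ k * expR (- t^-1) = flat k t.
    near=> s; suff s0 : 0 < s by rewrite /flat s0.
    by near: s; exact: lt_nbhsr.
  apply: near_eq_is_derive eqn _.
  have := is_deriveM (is_derive_invX k t0) (is_derive_expRNV t0).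
  rewrite /GRing.scale /flat t0 /=.
  have -> : t^-1 ^+ k * (t^-1 ^+ 2 * expR (- t^-1)) + expR (- t^-1) * - (k%:R * t^-1 ^+ k.+1) =
    t^-1 ^+ k.+2 * expR (- t^-1) - k%:R * (t^-1 ^+ k.+1 * expR (- t^-1)).
    by rewrite !exprS expr0; ring.
  by [].
- have fl0 : flat k.+2 0 - k%:R * flat k.+1 0 = 0 :> R by rewrite /flat ltxx mulr0 subr0.
  rewrite fl0.
  (* For [h > 0] the difference quotient is [flat k.+1 h], which [flat_le] bounds by a multiple of
     [h]; for [h <= 0] it vanishes. *)
  have cv : (fun h : R => h^-1 *: (flat k (h *: (1 : R) + 0) - flat k 0)) @ 0^' --> (0 : R).
    apply/cvgrPdist_le => e e0.
    have ck0 : (0 : R) < k.+2%:R ^+ k.+2 by rewrite exprn_gt0// ltr0n.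
    near=> h.
    rewrite sub0r normrN addr0 [h%:A]mulr1 /(flat k 0) ltxx subr0 normrZ.
    have [h0|h0] := ltP 0 h; last by rewrite /flat ltNge h0/= normr0 mulr0 ltW.
    have /andP[f0 fl] := flat_le k.+1 h0.
    have -> : `|h^-1| * `|flat k h| = flat k.+1 h.
      rewrite -normrM /flat h0 mulrA -exprS ger0_norm//.
      by move: f0; rewrite /flat h0.
    rewrite (le_trans fl)// -ler_pdivlMl// mulrC ltW//.
    rewrite -(gtr0_norm h0).
    by near: h; apply: dnbhs0_lt; exact: divr_gt0.
  apply: DeriveDef; first by apply/cvg_ex; exists 0.
  by apply/cvg_lim.
Unshelve. all: by end_near. Qed.

Lemma smooth_on_flat k : smooth_on [set: R] (flat k).
Proof.
pose P (h : R -> R) := exists k, h = flat k.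
have dfl l t : differentiable (flat l) t.
  by apply/derivable1_diffP; have [] := is_derive_flat l t.
apply: (@smooth_on_alg _ _ _ P openT); last by apply: alg_base; exists k.
- by move=> _ [l ->] x _; exact: dfl.
- move=> _ v [l ->].
  exists (fun x => v * (flat l.+2 x + - l%:R * flat l.+1 x)).
    apply: alg_mul; first exact: alg_cst.
    apply: alg_add; first by apply: alg_base; exists l.+2.
    by apply: alg_mul; [exact: alg_cst|apply: alg_base; exists l.+1].
  move=> x _; rewrite deriveE// -[v in LHS]mulr1 [LHS]linearZ/= -deriveE//.
  by have [_ ->] := is_derive_flat l x; rewrite mulNr.
Qed.

Lemma derive_rV_coord n (x v : 'rV[R]_n) i :
  'D_v (fun y : 'rV[R]_n => y ord0 i) x = v ord0 i.
Proof.
have := @derive_mx R 'rV[R]_n 1 n id x v (@derivable_id _ _ x v).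
by rewrite derive_id => /matrixP/(_ ord0 i); rewrite mxE.
Qed.

Lemma smooth_on_coord n (D : set 'rV[R]_n) i : open D ->
  smooth_on D (fun y : 'rV[R]_n => y ord0 i).
Proof.
move=> oD.
pose P (h : 'rV[R]_n -> R) := h = fun y : 'rV[R]_n => y ord0 i.
apply: (@smooth_on_alg _ _ _ P oD); last exact: alg_base.
- by move=> _ -> x _; exact: differentiable_coord.
- move=> _ v ->; exists (fun=> v ord0 i); first exact: alg_cst.
  by move=> x _; exact: derive_rV_coord.
Qed.

(** [flat 0] applied to [e^2 - |y - a|^2] for the Euclidean norm, whose square is smooth. The ball
    in the conclusion is that of the sup norm, and it contains the Euclidean one. *)
Lemma bump_rV n (a : 'rV[R]_n) (e : R) : 0 < e ->
  exists b : 'rV[R]_n -> R, [/\ smooth_on setT b, 0 < b a &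
    forall y, b y != 0 -> ball a e y].
Proof.
move=> e0.
pose q (y : 'rV[R]_n) : R := e ^+ 2 + \sum_i (-1) * ((y ord0 i - a ord0 i) * (y ord0 i - a ord0 i)).
have qs : smooth_on setT q.
  have oT := @openT 'rV[R]_n.
  apply: smooth_on_add => //; first exact: smooth_on_cst.
  apply: smooth_on_sum => // i _; apply: smooth_on_mul => //; first exact: smooth_on_cst.
  have ys : smooth_on setT (fun y : 'rV[R]_n => y ord0 i - a ord0 i).
    by apply: smooth_on_add => //; [exact: smooth_on_coord|exact: smooth_on_cst].
  exact: smooth_on_mul.
exists (fun y => flat 0 (q y)); split.
- have := @smooth_on_comp _ _ _ setT setT 1 (fun=> 1 : R) (fun=> q) (flat 0) openT
    (fun=> qs) (@smooth_on_flat 0) (fun _ _ => I).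
  by congr smooth_on; apply/funext => y; rewrite big_ord1 [_%:A]mulr1.
- have -> : q a = e ^+ 2.
    by rewrite /q big1 ?addr0// => i _; rewrite subrr mul0r mulr0.
  by rewrite /flat exprn_gt0// expr0 mul1r expR_gt0.
- move=> y; rewrite /flat; case: ifPn => [qy _|]; last by rewrite eqxx.
  split=> // i j; rewrite ord1 -ball_normE /ball_ /= distrC.
  have : (y ord0 j - a ord0 j) ^+ 2 < e ^+ 2.
    have : \sum_i (-1) * ((y ord0 i - a ord0 i) * (y ord0 i - a ord0 i))
        <= - (y ord0 j - a ord0 j) ^+ 2.
      rewrite (bigD1 j)//= mulN1r -expr2 gerDl; apply: sumr_le0 => k _.
      by rewrite mulN1r oppr_le0 -expr2 sqr_ge0.
    by move: qy; rewrite /q; lra.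
  by rewrite -(real_normK (num_real (y ord0 j - a ord0 j))) ltr_sqr ?nnegrE ?(ltW e0).
Qed.

End Flat.

(** * Hadamard's lemma *)

Section Integral01.
Context {R : realType}.
Implicit Types f g : R -> R.

(** Continuity is two-sided also at the end points: the integrands below are continuous on a
    neighbourhood of the interval. *)
Definition cont01 f := forall t, 0 <= t <= 1 -> {for t, continuous f}.
Definition int01 f : R := Rintegral lebesgue_measure `[0, 1] f.

Let m01 : measurable (`[0, 1]%classic : set (measurableTypeR R)).
Proof. exact: measurable_itv. Qed.

Lemma cont01_within f : cont01 f -> {within `[0, 1], continuous f}.
Proof.
move=> cf; apply: continuous_in_subspaceT => t /set_mem /=.
by rewrite in_itv /=; exact: cf.
Qed.

Lemma cont01_integrable f : cont01 f ->
  (lebesgue_measure (R := R)).-integrable `[0, 1] (EFin \o f).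
Proof.
move=> cf; apply: continuous_compact_integrable; first exact: segment_compact.
exact: cont01_within.
Qed.

Lemma eq_int01 f g : (forall t, 0 <= t <= 1 -> f t = g t) -> int01 f = int01 g.
Proof.
move=> fg; apply: eq_Rintegral => t /set_mem /=.
by rewrite in_itv /=; exact: fg.
Qed.

Lemma int01D f g : cont01 f -> cont01 g -> int01 (fun t => f t + g t) = int01 f + int01 g.
Proof. by move=> cf cg; apply: RintegralD => //; exact: cont01_integrable. Qed.

Lemma int01Z a f : cont01 f -> int01 (fun t => a * f t) = a * int01 f.
Proof. by move=> cf; apply: RintegralZl => //; exact: cont01_integrable. Qed.

Lemma int01_cst a : int01 (fun=> a) = a.
Proof.
rewrite /int01 Rintegral_cst// [X in fine X]lebesgue_measure_itv /= lte_fin ltr01.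
by rewrite oppr0 addr0 mulr1.
Qed.

Lemma cont01_cst a : cont01 (fun=> a).
Proof. by move=> t _; exact: cst_continuous. Qed.

Lemma cont01D f g : cont01 f -> cont01 g -> cont01 (fun t => f t + g t).
Proof. by move=> cf cg t tP; apply: continuousD; [exact: cf|exact: cg]. Qed.

Lemma cont01M f g : cont01 f -> cont01 g -> cont01 (fun t => f t * g t).
Proof. by move=> cf cg t tP; apply: continuousM; [exact: cf|exact: cg]. Qed.

Lemma cont01_sum I (r : seq I) (F : I -> R -> R) : (forall i, cont01 (F i)) ->
  cont01 (fun t => \sum_(i <- r) F i t).
Proof.
move=> cF; elim: r => [|i r IH].
  by under eq_fun do rewrite big_nil; exact: cont01_cst.
by under eq_fun do rewrite big_cons; exact: cont01D.
Qed.

Lemma int01_sum I (r : seq I) (F : I -> R -> R) : (forall i, cont01 (F i)) ->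
  int01 (fun t => \sum_(i <- r) F i t) = \sum_(i <- r) int01 (F i).
Proof.
move=> cF; elim: r => [|i r IH].
  by rewrite big_nil; under [LHS]eq_int01 do rewrite big_nil; rewrite int01_cst.
rewrite big_cons -IH -int01D//; last exact: cont01_sum.
by apply: eq_int01 => t _; rewrite big_cons.
Qed.

Lemma cont01X k : cont01 (fun t => t ^+ k).
Proof. by move=> t _; exact: exprn_continuous. Qed.

Lemma int01_le f b : cont01 f -> (forall t, 0 <= t <= 1 -> `|f t| <= b) ->
  `|int01 f| <= b.
Proof.
move=> cf fb.
have le1 : `|int01 f| <= int01 (fun t => `|f t|).
  by apply: le_normr_Rintegral => //; exact: cont01_integrable.
have le2 : int01 (fun t => `|f t|) <= int01 (fun=> b).
  apply: le_Rintegral => //.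
  - apply: cont01_integrable => t tP; apply: continuous_comp; first exact: cf.
    exact: norm_continuous.
  - by apply: cont01_integrable; exact: cont01_cst.
by apply: le_trans le1 _; rewrite -[leRHS]int01_cst.
Qed.

Lemma int01B f g : cont01 f -> cont01 g -> int01 (fun t => f t - g t) = int01 f - int01 g.
Proof. by move=> cf cg; apply: RintegralB => //; exact: cont01_integrable. Qed.

Lemma cont01B f g : cont01 f -> cont01 g -> cont01 (fun t => f t - g t).
Proof. by move=> cf cg t tP; apply: continuousB; [exact: cf|exact: cg]. Qed.

Lemma int01_FTC f (df : R -> R) : (forall t : R, 0 <= t <= 1 -> is_derive t (1 : R) f (df t)) ->
  cont01 df -> int01 df = f 1 - f 0.
Proof.
move=> fd cdf.
have fc t : 0 <= t <= 1 -> {for t, continuous f}.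
  move=> tP; apply: differentiable_continuous; apply/derivable1_diffP.
  by have [] := fd t tP.
have o01 : (0 : R) <= (0 : R) <= 1 by rewrite lexx ler01.
have o11 : (0 : R) <= (1 : R) <= 1 by rewrite lexx ler01.
rewrite /int01 /Rintegral (@continuous_FTC2 _ df f 0 1)//.
- exact: cont01_within.
- split.
  + move=> t; rewrite in_itv /= => /andP[t0 t1].
    have tP : 0 <= t <= 1 by rewrite !ltW.
    by have [] := fd t tP.
  + exact/cvg_at_right_filter/fc.
  + exact/cvg_at_left_filter/fc.
- move=> t; rewrite in_itv /= => /andP[t0 t1]; rewrite derive1E.
  have tP : 0 <= t <= 1 by rewrite !ltW.
  by have [_ ->] := fd t tP.
Qed.

End Integral01.

Section Hadamard.
Context {R : realType}.

(** Serves to differentiate an integral: once a candidate linear part is subtracted, what remains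
    varies quadratically around [x]. *)
Lemma quadratic_differentiable (E : normedModType R) (F : E -> R) (x : E) (C d : R) : 0 < d ->
  (forall w, `|w| < d -> `|F (x + w) - F x| <= C * `|w| ^+ 2) ->
  differentiable F x /\ forall v, 'D_v F x = 0.
Proof.
move=> d0 qF.
have c0 : continuous (0 : E -> R) by move=> ?; exact: cst_continuous.
have FE : F \o shift x = cst (F x) + (0 : E -> R) +o_ 0 id.
  apply/eqaddoP => e e0.
  have C0 : 0 < `|C| + 1 by rewrite ltr_wpDl.
  near=> w; rewrite !fctE /= addr0 [w + x]addrC.
  have wd : `|w| < d by near: w; exact: nbhs0_lt.
  have we : `|w| < e / (`|C| + 1) by near: w; apply: nbhs0_lt; exact: divr_gt0.
  rewrite (le_trans (qF w wd))// expr2 mulrA ler_wpM2r//.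
  rewrite (@le_trans _ _ ((`|C| + 1) * `|w|))//.
    by rewrite ler_wpM2r// (le_trans (ler_norm C))// lerDl.
  by rewrite -ler_pdivlMl// mulrC ltW.
have dF := diff_unique (df := \0) c0 FE.
have dfF : differentiable F x.
  by apply/diff_locallyP; rewrite dF; split.
split => // v.
by rewrite deriveE// dF.
Unshelve. all: by end_near. Qed.

Lemma derive_coord n (f : 'rV[R]_n -> R) x v : differentiable f x ->
  'D_v f x = \sum_i v ord0 i * 'D_(delta_mx ord0 i) f x.
Proof.
move=> df; rewrite deriveE// [v in LHS]row_sum_delta linear_sum.
by apply: eq_bigr => i _; rewrite linearZ/= deriveE.
Qed.

End Hadamard.

Section Hadamard2.
Context {R : realType} {n : nat}.
Implicit Types (a y w z : 'rV[R]_n) (h : 'rV[R]_n -> R).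

Lemma rV_coord_le w i : `|w ord0 i| <= `|w|.
Proof.
rewrite [leRHS]/Num.Def.normr/= mx_normrE.
exact: (le_bigmax _ (fun ij => `|w ij.1 ij.2|) (ord0, i)).
Qed.

Lemma continuous_at_sum (T : topologicalType) I (r : seq I) (F : I -> T -> R) (x : T) :
  (forall i, {for x, continuous (F i)}) ->
  {for x, continuous (fun u => \sum_(i <- r) F i u)}.
Proof.
move=> Fc; elim: r => [|i r IH].
  rewrite (_ : (fun u => _) = fun=> 0); first exact: cst_continuous.
  by apply/funext => u; rewrite big_nil.
rewrite (_ : (fun u => _) = fun u => F i u + \sum_(j <- r) F j u).
  by apply: continuousD; [exact: Fc|exact: IH].
by apply/funext => u; rewrite big_cons.
Qed.

(** The constant is the maximum, over the closed ball of radius [r], of the sum of the absolute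
    values of all second partial derivatives; [r < e] makes this ball a compact subset of the
    domain. *)
Lemma second_derivative_bound a (e r : R) h : 0 < r < e -> smooth_on (ball a e) h ->
  exists2 C : R, 0 <= C & forall z w, `|a - z| <= r ->
    `|'D_w ('D_w h) z| <= C * `|w| ^+ 2.
Proof.
move=> /andP[r0 re] hs.
pose F z := \sum_i \sum_j `|'D_(delta_mx ord0 j) ('D_(delta_mx ord0 i) h) z|.
pose K : set 'rV[R]_n := [set z | `|a - z| <= r].
have KE : K = closed_ball a r by rewrite closed_ballE.
have Kc : compact K.
  apply: bounded_closed_compact; last by rewrite KE; exact: closed_ball_closed.
  exists (`|a| + r); split; first exact: num_real.
  move=> x /ltW ax y /= ay; rewrite (le_trans _ ax)//.
  rewrite -[y](subKr a) (le_trans (ler_normB _ _))// lerD2l//.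
have Kb z : K z -> ball a e z.
  by move=> Kz; rewrite -ball_normE /ball_ /=; exact: le_lt_trans Kz re.
have Fc : {within K, continuous F}.
  apply: continuous_in_subspaceT => z /set_mem Kz.
  apply: continuous_at_sum => i; apply: continuous_at_sum => j; apply: continuous_comp; last exact: norm_continuous.
  apply: differentiable_continuous; apply: smooth_on_differentiable (Kb z Kz).
  by do 2 apply: smooth_on_derive.
have K0 : K !=set0 by exists a; rewrite /K /= subrr normr0 ltW.
have [c /set_mem Kc' Fmax] := EVT_max_rV K0 Kc Fc.
exists (F c); first by apply: sumr_ge0 => i _; apply: sumr_ge0.
move=> z w Kz; have bz := Kb z Kz.
have dh i : differentiable ('D_(delta_mx ord0 i) h) z.
  by apply: smooth_on_differentiable bz; exact: smooth_on_derive.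
have -> : 'D_w ('D_w h) z =
  \sum_i \sum_j w ord0 i * (w ord0 j * 'D_(delta_mx ord0 j) ('D_(delta_mx ord0 i) h) z).
  have nb : nbhs z (ball a e) by apply: open_nbhs_nbhs; split => //; exact: ball_open.
  rewrite (@near_eq_derive _ _ _ _ (\sum_i (w ord0 i *: 'D_(delta_mx ord0 i) h))); last first.
    apply: filterS nb => y yb; rewrite (derive_coord w (smooth_on_differentiable hs yb)).
    by rewrite fct_sumE.
  rewrite derive_sum; last by move=> i; apply/derivableZ/diff_derivable.
  apply: eq_bigr => i _; rewrite deriveZ; last exact/diff_derivable.
  by rewrite (derive_coord w (dh i)) scaler_sumr.
apply: (@le_trans _ _ (F z * `|w| ^+ 2)); last first.
  by rewrite ler_wpM2r ?exprn_ge0//; apply: Fmax; exact/mem_set.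
rewrite /F mulr_suml (le_trans (ler_norm_sum _ _ _))//; apply: ler_sum => i _.
rewrite mulr_suml (le_trans (ler_norm_sum _ _ _))//; apply: ler_sum => j _.
rewrite !normrM mulrA mulrC ler_wpM2l// expr2.
by apply: ler_pM => //; exact: rV_coord_le.
Qed.

(** Two mean value steps along the segment from [z] to [z + w]; the second takes place on a shorter
    segment, whose length at most 1 is absorbed in the bound. *)
Lemma taylor_bound a (e r C : R) h : 0 < r < e -> smooth_on (ball a e) h -> 0 <= C ->
  (forall z w, `|a - z| <= r -> `|'D_w ('D_w h) z| <= C * `|w| ^+ 2) ->
  forall z w, (forall s, 0 <= s <= 1 -> `|a - (z + s *: w)| <= r) ->
    `|h (z + w) - h z - 'D_w h z| <= C * `|w| ^+ 2.
Proof.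
move=> /andP[r0 re] hs C0 hC z w zw.
have zb s : 0 <= s <= 1 -> ball a e (z + s *: w).
  by move=> /zw ?; rewrite -ball_normE /ball_ /=; exact: le_lt_trans re.
have zb0 : ball a e z by have := zb 0; rewrite lexx ler01 scale0r addr0; apply.
have [|s /andP[s0 s1]] := @MVT_closed _ (fun s => h (z + s *: w)) (fun s => 'D_w h (z + s *: w)) 0 1 ltr01.
  by move=> t /zb tb; apply: is_derive_line; exact: (smooth_on_differentiable hs tb).
rewrite scale0r addr0 scale1r subr0 mulr1 => ->.
have [|t /andP[t0 ts]] := @MVT_closed _ (fun s => 'D_w h (z + s *: w))
    (fun s => 'D_w ('D_w h) (z + s *: w)) 0 s s0.
  move=> t /andP[t0 ts]; apply: is_derive_line.
  apply: (smooth_on_differentiable (smooth_on_derive w hs)); apply: zb.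
  by rewrite t0 (le_trans ts)// ltW.
rewrite scale0r addr0 subr0 => ->.
rewrite normrM (ger0_norm (ltW s0)).
apply: le_trans (hC (z + t *: w) w _).
  by rewrite ler_piMr// ltW.
by apply: zw; rewrite ltW//= ltW// (lt_trans ts).
Qed.

(** The weight [t ^+ k] makes the family stable under derivation: differentiating
    [h (a + t (y - a))] in [y] brings out a factor [t]. *)
Definition ray_integral a k h y := int01 (fun t => t ^+ k * h (a + t *: (y - a))).

Lemma ray_norm a y t : 0 <= t <= 1 -> `|a - (a + t *: (y - a))| <= `|a - y|.
Proof.
move=> /andP[t0 t1]; rewrite opprD addNKr normrN normrZ ger0_norm// distrC.
by rewrite ler_piMl.
Qed.

Lemma ray_ball a e y t : ball a e y -> 0 <= t <= 1 -> ball a e (a + t *: (y - a)).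
Proof.
rewrite -!ball_normE /ball_ /= => ye tP.
exact: le_lt_trans (ray_norm a y tP) ye.
Qed.

Lemma cont01_ray a e k h y : smooth_on (ball a e) h -> ball a e y ->
  cont01 (fun t => t ^+ k * h (a + t *: (y - a))).
Proof.
move=> hs yb; apply: cont01M; first exact: cont01X.
move=> t tP; apply: differentiable_continuous; apply/derivable1_diffP.
by have [] := is_derive_line (smooth_on_differentiable hs (ray_ball yb tP)).
Qed.

(** Differentiation under the integral sign. The candidate differential is the linear form [L]; by
    the Taylor bound, integrated over the unit interval, subtracting [L] leaves a function of
    quadratic variation at [y]. *)
Lemma ray_integral_diff a e k h y : smooth_on (ball a e) h -> ball a e y ->
  differentiable (ray_integral a k h) y /\
  forall v, 'D_v (ray_integral a k h) y = ray_integral a k.+1 ('D_v h) y.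
Proof.
move=> hs yb.
have ye : `|a - y| < e by move: yb; rewrite -ball_normE.
(* Halfway between [|a - y|] and [e]: increments shorter than [r - |a - y|] keep every segment in
   the closed ball where the second derivative is bounded. *)
pose r := (`|a - y| + e) / 2.
have yr : `|a - y| < r by rewrite /r; lra.
have re : r < e by rewrite /r; lra.
have r0 : 0 < r by rewrite (le_lt_trans _ yr).
have rP : 0 < r < e by rewrite r0.
have [C C0 hC] := second_derivative_bound rP hs.
have tb := taylor_bound rP hs C0 hC.
pose c i := ray_integral a k.+1 ('D_(delta_mx ord0 i) h) y.
have lE w : ray_integral a k.+1 ('D_w h) y = \sum_i w ord0 i * c i.
  have cr i := @cont01_ray a e k.+1 _ y (smooth_on_derive (delta_mx ord0 i) hs) yb.
  rewrite /c /ray_integral.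
  rewrite -(eq_bigr _ (fun i _ => int01Z (w ord0 i) (cr i))) -int01_sum; last first.
    by move=> i; apply: cont01M => //; exact: cont01_cst.
  apply: eq_int01 => t tP.
  rewrite (derive_coord w (smooth_on_differentiable hs (ray_ball yb tP))) mulr_sumr.
  by apply: eq_bigr => i _; rewrite mulrCA.
pose L (x : 'rV[R]_n) : R := \sum_i c i * x ord0 i.
have Ls : smooth_on setT L.
  apply: smooth_on_sum => [|i _]; first exact: openT.
  by apply: smooth_on_mul; [exact: openT|exact: (smooth_on_cst _ openT)|exact: (smooth_on_coord _ openT)].
have dL x : differentiable L x by exact: (smooth_on_differentiable Ls).
have LD w x : L (x + w) - L x = ray_integral a k.+1 ('D_w h) y.
  rewrite lE /L -sumrB; apply: eq_bigr => i _.
  by rewrite mxE mulrDr addrAC subrr add0r mulrC.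
have [dG DG] : differentiable (fun x => ray_integral a k h x - L x) y /\
    forall v, 'D_v (fun x => ray_integral a k h x - L x) y = 0.
  apply: (@quadratic_differentiable _ _ _ _ C (r - `|a - y|)); first by rewrite subr_gt0.
  move=> w wr.
  have ywb : ball a e (y + w).
    rewrite -ball_normE /ball_ /= opprD addrA (le_lt_trans (ler_normB _ _))//.
    by rewrite (lt_trans _ re)// -ltrBrDl.
  have -> : ray_integral a k h (y + w) - L (y + w) - (ray_integral a k h y - L y) =
      ray_integral a k h (y + w) - ray_integral a k h y - ray_integral a k.+1 ('D_w h) y.
    by rewrite -(LD w y); ring.
  have c1 := @cont01_ray a e k _ _ hs ywb.
  have c2 := @cont01_ray a e k _ _ hs yb.
  have c3 := @cont01_ray a e k.+1 _ y (smooth_on_derive w hs) yb.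
  rewrite /ray_integral -(int01B c1 c2) -(int01B (cont01B c1 c2) c3).
  apply: int01_le; first exact: (cont01B (cont01B c1 c2) c3).
  move=> t tP; have /andP[t0 t1] := tP.
  set z := a + t *: (y - a).
  have -> : a + t *: (y + w - a) = z + t *: w.
    by rewrite /z -[RHS]addrA -scalerDr [y - a + w]addrAC.
  have zb : ball a e z by exact: ray_ball.
  have -> : t ^+ k.+1 * 'D_w h z = t ^+ k * 'D_(t *: w) h z.
    have dz := smooth_on_differentiable hs zb.
    by rewrite !deriveE// linearZ/= exprS mulrA [t * t ^+ k]mulrC.
  have -> : t ^+ k * h (z + t *: w) - t ^+ k * h z - t ^+ k * 'D_(t *: w) h z
      = t ^+ k * (h (z + t *: w) - h z - 'D_(t *: w) h z).
    by rewrite !mulrBr.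
  rewrite normrM ger0_norm ?exprn_ge0//.
  apply: (@le_trans _ _ `|h (z + t *: w) - h z - 'D_(t *: w) h z|).
    by rewrite ler_piMl// exprn_ile1.
  apply: (@le_trans _ _ (C * `|t *: w| ^+ 2)).
    apply: tb => s /andP[s0 s1].
    rewrite opprD addrA (le_trans (ler_normB _ _))//.
    have h1 : `|a - z| <= `|a - y| by exact: ray_norm.
    have h2 : `|s *: (t *: w)| <= `|w|.
      rewrite !normrZ !ger0_norm// mulrA ler_piMl// mulr_ile1//.
    by move: h1 h2 wr; clear; lra.
  rewrite ler_wpM2l// normrZ exprMn ler_piMl ?exprn_ge0// exprn_ile1//.
  by rewrite ger0_norm.
have -> : ray_integral a k h = (fun x => ray_integral a k h x - L x) + L.
  by apply/funext => x; rewrite !fctE subrK.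
split; first exact: differentiableD.
move=> v; rewrite deriveD; last 2 first.
- exact/diff_derivable.
- exact/diff_derivable.
rewrite DG add0r lE (_ : L = \sum_i (c i *: (fun x : 'rV[R]_n => x ord0 i))); last first.
  by apply/funext => x; rewrite fct_sumE.
rewrite derive_sum; last first.
  by move=> i; apply/derivableZ/diff_derivable/differentiable_coord.
apply: eq_bigr => i _; rewrite deriveZ; last exact/diff_derivable/differentiable_coord.
by rewrite derive_rV_coord; exact: mulrC.
Qed.

Lemma smooth_on_ray_integral a e k h : smooth_on (ball a e) h ->
  smooth_on (ball a e) (ray_integral a k h).
Proof.
move=> hs.
pose P (f : 'rV[R]_n -> R) := exists k h, smooth_on (ball a e) h /\ f = ray_integral a k h.
apply: (@smooth_on_alg _ _ _ P (ball_open _ _)); last by apply: alg_base; exists k, h.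
- by move=> _ [k' [h' [h's ->]]] x xb; have [] := @ray_integral_diff a e k' h' x h's xb.
- move=> _ v [k' [h' [h's ->]]]; exists (ray_integral a k'.+1 ('D_v h')).
    by apply: alg_base; exists k'.+1, ('D_v h'); split => //; exact: smooth_on_derive.
  by move=> x xb; have [_ ->] := @ray_integral_diff a e k' h' x h's xb.
Qed.

(* [f y = f a + \int_0^1 (d/dt) f (a + t (y - a)) dt] *)
Lemma hadamard a e h : 0 < e -> smooth_on (ball a e) h ->
  exists g : 'I_n -> 'rV[R]_n -> R, [/\ forall i, smooth_on (ball a e) (g i),
    forall i, g i a = 'D_(delta_mx ord0 i) h a &
    forall y, ball a e y ->
      h y = h a + \sum_i (y ord0 i - a ord0 i) * g i y].
Proof.
move=> e0 hs.
have ab : ball a e a by exact: ballxx.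
exists (fun i => ray_integral a 0 ('D_(delta_mx ord0 i) h)); split.
- by move=> i; apply: smooth_on_ray_integral; exact: smooth_on_derive.
- move=> i; rewrite /ray_integral -[RHS]int01_cst; apply: eq_int01 => t _.
  by rewrite expr0 mul1r subrr scaler0 addr0.
- move=> y yb.
  have cr i := @cont01_ray a e 0 _ y (smooth_on_derive (delta_mx ord0 i) hs) yb.
  rewrite /ray_integral.
  rewrite -(eq_bigr _ (fun i _ => int01Z (y ord0 i - a ord0 i) (cr i))) -int01_sum; last first.
    by move=> i; apply: cont01M => //; exact: cont01_cst.
  have dl t (tP : 0 <= t <= 1) :=
    is_derive_line (smooth_on_differentiable hs (ray_ball yb tP)).
  have cl := @cont01_ray a e 0 _ y (smooth_on_derive (y - a) hs) yb.
  have cl' : cont01 (fun t => 'D_(y - a) h (a + t *: (y - a))).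
    by congr cont01 : cl; apply/funext => t; rewrite expr0 mul1r.
  have -> : h y = h a + (h (a + 1 *: (y - a)) - h (a + 0 *: (y - a))).
    by rewrite scale1r scale0r addr0 [a + (y - a)]addrC subrK [RHS]addrC subrK.
  rewrite -(int01_FTC dl cl'); congr (_ + _); apply: eq_int01 => t tP.
  rewrite (derive_coord _ (smooth_on_differentiable hs (ray_ball yb tP))).
  by apply: eq_bigr => i _; rewrite !mxE expr0 mul1r.
Qed.

End Hadamard2.

(** * Manifolds, tangent vectors and flows *)

Lemma compact_rV_ball (R : realType) n (a : 'rV[R]_n) (r : R) : 0 < r ->
  compact [set z : 'rV[R]_n | `|a - z| <= r].
Proof.
move=> r0.
apply: bounded_closed_compact; last first.
  rewrite (_ : mkset _ = closed_ball a r); first exact: closed_ball_closed.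
  by rewrite closed_ballE.
exists (`|a| + r); split; first exact: num_real.
move=> x /ltW ax y /= ay; rewrite (le_trans _ ax)//.
by rewrite -[y](subKr a) (le_trans (ler_normB _ _))// lerD2l.
Qed.

Section Manifold.
Context {R : realType} {M : topologicalType} {n : nat} (A : set (chart R M n)).
Hypothesis hM : smooth_manifold A.

Lemma smooth_cst (a : R) : smooth A (fun=> a).
Proof. by move=> c Ac; apply: smooth_on_cst; exact: chart_image_open hM _ Ac. Qed.

Lemma smooth_add f g : smooth A f -> smooth A g -> smooth A (fun x => f x + g x).
Proof.
move=> fs gs c Ac; apply: smooth_on_add; [exact: chart_image_open hM _ Ac|exact: fs|exact: gs].
Qed.

Lemma smooth_mul f g : smooth A f -> smooth A g -> smooth A (fun x => f x * g x).
Proof.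
move=> fs gs c Ac; apply: smooth_on_mul; [exact: chart_image_open hM _ Ac|exact: fs|exact: gs].
Qed.

Lemma smooth_opp f : smooth A f -> smooth A (fun x => - f x).
Proof.
move=> fs; rewrite (_ : (fun x => _) = fun x => (-1) * f x); last first.
  by apply/funext => x; rewrite mulN1r.
by apply: smooth_mul => //; exact: smooth_cst.
Qed.

Lemma smooth_sub f g : smooth A f -> smooth A g -> smooth A (fun x => f x - g x).
Proof. by move=> fs gs; apply: smooth_add => //; exact: smooth_opp. Qed.

Lemma smooth_sum I (r : seq I) (P : pred I) (f : I -> M -> R) :
  (forall i, P i -> smooth A (f i)) -> smooth A (fun x => \sum_(i <- r | P i) f i x).
Proof.
move=> fs c Ac; apply: smooth_on_sum; first exact: chart_image_open hM _ Ac.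
by move=> i Pi; exact: fs.
Qed.

Lemma smooth_prod I (r : seq I) (P : pred I) (f : I -> M -> R) :
  (forall i, P i -> smooth A (f i)) -> smooth A (fun x => \prod_(i <- r | P i) f i x).
Proof.
move=> fs; elim: r => [|i r IH].
  rewrite (_ : (fun x => _) = fun=> 1); first exact: smooth_cst.
  by apply/funext => x; rewrite big_nil.
case Pi : (P i); last first.
  by congr smooth : IH; apply/funext => x; rewrite big_cons Pi.
rewrite (_ : (fun x => _) = fun x => f i x * \prod_(j <- r | P j) f j x).
  by apply: smooth_mul => //; exact: fs.
by apply/funext => x; rewrite big_cons Pi.
Qed.

Lemma chart_open_image c W : A c -> open W -> open (coord c @` (cdom c `&` W)).
Proof.
move=> Ac oW; rewrite openE => _ [x [cx Wx] <-].
have n1 : nbhs (coord c x) (coord c @` cdom c).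
  by apply: open_nbhs_nbhs; split; [exact: chart_image_open hM _ Ac|exists x].
have n2 : nbhs (coord c x) (coord_inv c @^-1` W).
  apply: (chart_inv_continuous hM Ac cx).
  by rewrite (chartK hM)//; apply: open_nbhs_nbhs.
apply: filterS (filterI n1 n2) => _ [[y cy <-]].
by rewrite /= (chartK hM)// => Wy; exists y.
Qed.

Lemma chart_nbhs c x W : A c -> cdom c x -> nbhs (coord c x) W ->
  nbhs x (cdom c `&` coord c @^-1` W).
Proof.
move=> Ac cx nW; apply: filterI.
  by apply: open_nbhs_nbhs; split => //; exact: chart_open hM _ Ac.
exact: (chart_continuous hM Ac cx).
Qed.

Lemma smooth_continuous f : smooth A f -> continuous f.
Proof.
move=> fs x; have [c Ac cx] := chart_cover hM x.
have dx : {for coord c x, continuous (fun y => f (coord_inv c y))}.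
  apply: differentiable_continuous; apply: (smooth_on_differentiable (fs c Ac)).
  by exists x.
move=> W; rewrite /= -(chartK hM Ac cx) => /dx nW.
have := chart_nbhs Ac cx nW; rewrite /= (chartK hM Ac cx).
by apply: filterS => y [cy] /=; rewrite (chartK hM).
Qed.

Definition chart_ext c (h : 'rV[R]_n -> R) : M -> R :=
  fun x => if `[< cdom c x >] then h (coord c x) else 0.

(** Near a point coming from [B] the extension is [h] composed with a change of charts. Any other
    point lies off the image of the compact [K], which is closed because [M] is Hausdorff, so the
    extension vanishes around it. *)
Lemma smooth_chart_ext c (B K : set 'rV[R]_n) h : A c -> open B ->
  B `<=` coord c @` cdom c -> compact K -> K `<=` B ->
  (forall y, h y != 0 -> K y) -> smooth_on B h -> smooth A (chart_ext c h).
Proof.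
move=> Ac oB Bc cK KB hK hs c' Ac'; apply: smooth_on_local => _ [x cx' <-].
have Bx y : B y -> exists2 x, cdom c x & coord c x = y by exact: Bc.
have [[cx Bcx]|nx] := pselect (cdom c x /\ B (coord c x)).
- pose W := coord_inv c @` B.
  have WE z : W z -> cdom c z /\ B (coord c z).
    by move=> [y By <-]; have [w cw wy] := Bx y By; rewrite -wy (chartK hM)// wy.
  have oW : open W.
    rewrite openE => z Wz; have [cz Bz] := WE z Wz.
    have nB : nbhs (coord c z) B by apply: open_nbhs_nbhs.
    apply: filterS (chart_nbhs Ac cz nB) => w [cw Bw].
    by exists (coord c w) => //; rewrite (chartK hM).
  have Wx : W x by exists (coord c x) => //; rewrite (chartK hM).
  exists (coord c' @` (cdom c' `&` W)),
    (fun y => h (\sum_i (coord c (coord_inv c' y) ord0 i) *: delta_mx ord0 i)); split.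
  + exact: chart_open_image.
  + by exists x.
  + apply: smooth_on_comp hs _; first exact: chart_open_image.
      move=> i; apply: smooth_on_sub (chart_compatible hM i Ac' Ac).
      by move=> _ [z [cz Wz] <-]; exists z => //; split => //; have [] := WE z Wz.
    move=> _ [z [cz Wz] <-]; rewrite -row_sum_delta (chartK hM)//.
    by have [] := WE z Wz.
  + move=> _ [z [cz Wz] <-]; rewrite -row_sum_delta (chartK hM)// /chart_ext.
    by case: asboolP => // /(_ (proj1 (WE z Wz))).
- pose K' := coord_inv c @` K.
  have cK' : closed K'.
    apply: compact_closed; first exact: manifold_hausdorff hM.
    apply: continuous_compact => //; apply: continuous_in_subspaceT => y /set_mem /KB /Bx[z cz <-].
    exact: chart_inv_continuous hM _ _ Ac cz.
  exists (coord c' @` (cdom c' `&` ~` K')), (fun=> 0); split.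
  + by apply: chart_open_image => //; exact: closed_openC.
  + exists x => //; split => // -[y Ky yx]; apply: nx.
    have [z cz zy] := Bx y (KB y Ky).
    by rewrite -yx -zy (chartK hM)// zy; split => //; exact: KB.
  + by apply: smooth_on_cst; apply: chart_open_image => //; exact: closed_openC.
  + move=> _ [z [cz Kz] <-]; rewrite (chartK hM)// /chart_ext.
    case: asboolP => // cz'; apply/esym/eqP; apply: contra_notT Kz => /hK Kz.
    by exists (coord c z) => //; rewrite (chartK hM).
Qed.

Lemma smooth_bump x N : nbhs x N ->
  exists phi, [/\ smooth A phi, phi x != 0 & forall y, phi y != 0 -> N y].
Proof.
move=> nN; have [c Ac cx] := chart_cover hM x.
have : nbhs (coord c x) (coord c @` (cdom c `&` N°)).
  apply: open_nbhs_nbhs; split; first by apply: chart_open_image => //; exact: open_interior.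
  by exists x.
move=> /nbhs_ballP[e /= e0 eB].
have e20 : 0 < e / 2 by rewrite divr_gt0.
have [b [bs ba bB]] := bump_rV (coord c x) e20.
exists (chart_ext c b); split.
- apply: (@smooth_chart_ext c (ball (coord c x) e) [set z | `|coord c x - z| <= e / 2]) => //.
  + exact: ball_open.
  + by move=> y /eB[z [cz _] <-]; exists z.
  + exact: compact_rV_ball.
  + move=> y /= ye; rewrite -ball_normE /ball_ /=; apply: le_lt_trans ye _.
    by rewrite ltr_pdivrMr// ltr_pMr// ltr1n.
  + by move=> y /bB; rewrite -ball_normE /ball_ /= => /ltW.
  + exact: smooth_on_sub bs.
- by rewrite /chart_ext; case: asboolP => // _; rewrite gt_eqF.
- move=> y; rewrite /chart_ext; case: asboolP => [cy|_]; last by rewrite eqxx.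
  move=> /bB/(le_ball _) => /(_ e); rewrite ler_pdivrMr// ler_pMr// ler1n => /(_ isT)/eB.
  move=> [z [cz Nz] zy]; suff -> : y = z by exact: interior_subset.
  by rewrite -(chartK hM Ac cy) -zy (chartK hM).
Qed.

End Manifold.

(** * Tangent vectors as directional derivatives in a chart *)

Section Tangent.
Context {R : realType} {M : topologicalType} {n : nat} (A : set (chart R M n)).
Hypothesis hM : smooth_manifold A.
Local Notation tvec := ((M -> R) -> R).
Implicit Types (x : M) (u v : tvec) (f : M -> R).

Lemma tangent_ext x u v : tangent A x u -> tangent A x v ->
  (forall f, smooth A f -> u f = v f) -> u = v.
Proof.
move=> [u0 _ _] [v0 _ _] uv; apply/funext => f.
by have [/uv//|nf] := pselect (smooth A f); rewrite u0 ?v0.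
Qed.

Lemma tangent_comb x (a : R) u v : tangent A x u -> tangent A x v ->
  tangent A x (a *: u + v).
Proof.
move=> [u0 ul um] [v0 vl vm]; split.
- by move=> f nf; rewrite !fctE u0// v0// scaler0 addr0.
- move=> b f g fs gs; rewrite !fctE ul// vl// /GRing.scale /=; ring.
- move=> f g fs gs; rewrite !fctE um// vm// /GRing.scale /=; ring.
Qed.

Lemma tangent0 x : tangent A x 0.
Proof.
have E f : (0 : tvec) f = 0 by [].
by split => // *; rewrite !E ?mulr0 addr0.
Qed.

Lemma tangentZ x (a : R) u : tangent A x u -> tangent A x (a *: u).
Proof. by move=> tu; rewrite -[_ *: _]addr0; apply: tangent_comb => //; exact: tangent0. Qed.

Lemma tangentD x u v : tangent A x u -> tangent A x v -> tangent A x (u + v).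
Proof. by move=> tu tv; rewrite -[u]scale1r; exact: tangent_comb. Qed.

Lemma tangentB x u v : tangent A x u -> tangent A x v -> tangent A x (u - v).
Proof. by move=> tu tv; rewrite addrC -scaleN1r; exact: tangent_comb. Qed.

Lemma tangent_sum x I (r : seq I) (P : pred I) (w : I -> tvec) :
  (forall i, P i -> tangent A x (w i)) -> tangent A x (\sum_(i <- r | P i) w i).
Proof. by move=> tw; elim/big_ind: _ => //; [exact: tangent0|move=> ? ?; exact: tangentD]. Qed.

Lemma tan_add x v f g : tangent A x v -> smooth A f -> smooth A g ->
  v (fun y => f y + g y) = v f + v g.
Proof.
move=> [_ vl _] fs gs; rewrite -[v f]mul1r -vl//.
by congr v; apply/funext => y; rewrite mul1r.
Qed.

Lemma tan_cst x v (a : R) : tangent A x v -> v (fun=> a) = 0.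
Proof.
move=> tv; have [_ vl vm] := tv; have s1 := smooth_cst hM 1.
have v1 : v (fun=> 1) = 0.
  have := vm _ _ s1 s1; rewrite !mul1r.
  by move=> /eqP; rewrite -subr_eq0 opprD addNKr oppr_eq0 => /eqP.
have s0 := smooth_cst hM 0.
have v0 : v (fun=> 0) = 0.
  have := tan_add tv s0 s0; rewrite addr0.
  by move=> /eqP; rewrite -subr_eq0 opprD addNKr oppr_eq0 => /eqP.
have := vl a _ _ s1 s0; by rewrite v1 v0 mulr0 !addr0 mulr1.
Qed.

Lemma tan_mul x v f g : tangent A x v -> smooth A f -> smooth A g ->
  v (fun y => f y * g y) = f x * v g + g x * v f.
Proof. by move=> [_ _ vm]; exact: vm. Qed.

Lemma tan_opp x v f : tangent A x v -> smooth A f -> v (fun y => - f y) = - v f.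
Proof.
move=> tv fs; rewrite (_ : (fun y => _) = fun y => (-1) * f y); last first.
  by apply/funext => y; rewrite mulN1r.
rewrite (tan_mul tv _ fs); last exact: smooth_cst.
by rewrite (tan_cst _ tv) mulr0 addr0 mulN1r.
Qed.

Lemma tan_sub x v f g : tangent A x v -> smooth A f -> smooth A g ->
  v (fun y => f y - g y) = v f - v g.
Proof.
by move=> tv fs gs; rewrite (tan_add tv)// ?(tan_opp tv)//; exact: smooth_opp.
Qed.

Lemma tan_sum x v I (r : seq I) (P : pred I) (f : I -> M -> R) : tangent A x v ->
  (forall i, P i -> smooth A (f i)) ->
  v (fun y => \sum_(i <- r | P i) f i y) = \sum_(i <- r | P i) v (f i).
Proof.
move=> tv fs; elim: r => [|i r IH].
  rewrite big_nil -[RHS](tan_cst 0 tv); apply: congr1.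
  by apply/funext => y; rewrite big_nil.
rewrite big_cons; case: ifP => Pi; last first.
  by rewrite -IH; apply: congr1; apply/funext => y; rewrite big_cons Pi.
rewrite -IH -(tan_add tv); [|exact: fs|exact: smooth_sum].
by apply: congr1; apply/funext => y; rewrite big_cons Pi.
Qed.

(** Zero on non-smooth functions, to match the normalisation in [tangent]. *)
Definition chart_dir c x (w : 'rV[R]_n) : tvec := fun f =>
  if `[< smooth A f >] then 'D_w (fun y => f (coord_inv c y)) (coord c x) else 0.

Lemma chart_dirE c x w f : smooth A f ->
  chart_dir c x w f = 'D_w (fun y => f (coord_inv c y)) (coord c x).
Proof. by move=> fs; rewrite /chart_dir; case: asboolP. Qed.

Lemma smooth_chart_differentiable c x f : A c -> cdom c x -> smooth A f ->
  differentiable (fun y => f (coord_inv c y)) (coord c x).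
Proof.
by move=> Ac cx fs; apply: (smooth_on_differentiable (fs c Ac)); exists x.
Qed.

Lemma tangent_chart_dir c x w : A c -> cdom c x -> tangent A x (chart_dir c x w).
Proof.
move=> Ac cx; have df f (fs : smooth A f) := smooth_chart_differentiable Ac cx fs.
split.
- by move=> f nf; rewrite /chart_dir; case: asboolP.
- move=> a f g fs gs; rewrite !chart_dirE//; last first.
    by apply: smooth_add => //; apply: smooth_mul => //; exact: smooth_cst.
  rewrite (_ : (fun y => _) = a *: (fun y => f (coord_inv c y)) + (fun y => g (coord_inv c y)))//.
  have df' := diff_derivable (v := w) (df f fs).
  have dg' := diff_derivable (v := w) (df g gs).
  by rewrite (deriveD (derivableZ df') dg') (deriveZ a df').
- move=> f g fs gs; rewrite !chart_dirE//; last exact: smooth_mul.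
  rewrite (_ : (fun y => _) = (fun y => f (coord_inv c y)) * (fun y => g (coord_inv c y)))//.
  have df' := diff_derivable (v := w) (df f fs).
  have dg' := diff_derivable (v := w) (df g gs).
  by rewrite (deriveM df' dg') (chartK hM).
Qed.

(** Hadamard's lemma writes [f - f x] near [x] as a sum of products of coordinate functions
    vanishing at [x] with smooth functions. Bump factors make the identity global, and a derivation
    at [x] then sees only its own values on the localised coordinates. *)
Lemma tangent_coord c x v : A c -> cdom c x -> tangent A x v ->
  exists w, v = chart_dir c x w.
Proof.
move=> Ac cx tv; set a := coord c x.
have [e e0 eB] : exists2 e : R, 0 < e & ball a e `<=` coord c @` cdom c.
  have : nbhs a (coord c @` cdom c).
    by apply: open_nbhs_nbhs; split; [exact: chart_image_open hM _ Ac|exists x].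
  by move=> /nbhs_ballP[e /= e0 eB]; exists e.
have e20 : 0 < e / 2 by rewrite divr_gt0.
have [b [bs ba bB]] := bump_rV a e20.
have be y : b y != 0 -> ball a e y.
  move=> /bB; apply: le_ball.
  by rewrite ler_pdivrMr// ler_pMr// ler1n.
have ext h : smooth_on (ball a e) h -> smooth A (chart_ext c (fun y => b y * h y)).
  move=> hs.
  apply: (@smooth_chart_ext _ _ _ _ hM c (ball a e) [set z | `|a - z| <= e / 2]) => //.
  - exact: ball_open.
  - exact: compact_rV_ball.
  - move=> y /= ye; rewrite -ball_normE /ball_ /=; apply: le_lt_trans ye _.
    by rewrite ltr_pdivrMr// ltr_pMr// ltr1n.
  - move=> y; rewrite mulf_eq0 negb_or => /andP[/bB + _].
    by rewrite -ball_normE /ball_ /= => /ltW.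
  - apply: smooth_on_mul => //; first exact: ball_open.
    exact: smooth_on_sub bs.
pose B := chart_ext c (fun y => b y * 1).
have Bs : smooth A B by apply: ext; apply: smooth_on_cst; exact: ball_open.
pose X i := chart_ext c (fun y => b y * (y ord0 i - a ord0 i)).
have Xs i : smooth A (X i).
  apply: ext; apply: smooth_on_add; first exact: ball_open.
    exact/smooth_on_coord/ball_open.
  exact/smooth_on_cst/ball_open.
(* [X i] is a coordinate multiplied by the bump, which contributes a factor [b a] to its derivative
   at [x]; this factor is divided out. *)
exists (\row_i (v (X i) / b a)); apply: (tangent_ext tv).
  exact: tangent_chart_dir.
move=> f fs; rewrite chart_dirE//.
have Fs : smooth_on (ball a e) (fun y => f (coord_inv c y)) by apply: smooth_on_sub (fs c Ac).
have [g [gs ga fg]] := hadamard e0 Fs.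
pose G i := chart_ext c (fun y => b y * g i y).
have Gs i : smooth A (G i) by exact: ext.
have Bx : B x = b a by rewrite /B /chart_ext; case: asboolP => // _; rewrite mulr1.
have Xx i : X i x = 0.
  by rewrite /X /chart_ext; case: asboolP => // _; rewrite subrr mulr0.
have Gx i : G i x = b a * g i a by rewrite /G /chart_ext; case: asboolP.
(* Two bump factors, one absorbed by [X i] and one by [G i], so that each of them is smooth on all
   of [M]. *)
have eqf : (fun y => B y * B y * f y) = fun y => f x * (B y * B y) + \sum_i X i y * G i y.
  apply/funext => y; rewrite /B /X /G /chart_ext; case: asboolP => cy; last first.
    by rewrite !mul0r mulr0 add0r big1// => i _; rewrite mul0r.
  have [by0|/be yB] := eqVneq (b (coord c y)) 0.
    by rewrite by0 !mul0r mulr0 add0r big1// => i _; rewrite !mul0r.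
  have := fg _ yB; rewrite (chartK hM)// (chartK hM)// => ->.
  rewrite !mulr1 mulrDr mulrC; congr (_ + _).
  by rewrite mulr_sumr; apply: eq_bigr => i _; ring.
have BBs : smooth A (fun y => B y * B y) by exact: smooth_mul.
have XGs i : smooth A (fun y => X i y * G i y) by exact: smooth_mul.
have := congr1 v eqf.
rewrite (tan_mul tv BBs fs) (tan_add tv); last 2 first.
- by apply: smooth_mul => //; exact: smooth_cst.
- by apply: smooth_sum => // i _; exact: XGs.
rewrite (tan_mul tv (smooth_cst hM _) BBs) (tan_cst _ tv) mulr0 addr0 addrC.
move=> /addrI; rewrite (@tan_sum x v _ _ _ _ tv (fun i _ => XGs i)).
rewrite Bx => eq1.
have ba0 : b a != 0 by rewrite gt_eqF.
apply: (mulfI (mulf_neq0 ba0 ba0)); rewrite eq1.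
rewrite derive_coord; last exact: smooth_chart_differentiable.
rewrite mulr_sumr; apply: eq_bigr => i _.
rewrite (tan_mul tv (Xs i) (Gs i)) Xx mul0r add0r Gx ga !mxE.
by field.
Qed.

End Tangent.

(** * Differentiating along a flow *)

Section Flow.
Context {R : realType} {M : topologicalType} {n : nat} (A : set (chart R M n)).
Hypothesis hM : smooth_manifold A.
Local Notation tvec := ((M -> R) -> R).
Implicit Types (x : M) (u v : tvec) (f : M -> R).

Lemma derive_slice (E : normedModType R) (F : R * E -> R) (t : R) (a w : E) :
  'D_w (fun y => F (t, y)) a = 'D_((0 : R), w) F (t, a).
Proof.
have eqf : (fun h : R => h^-1 *: (F (t, h *: w + a) - F (t, a))) =
    (fun h : R => h^-1 *: (F (h *: ((0 : R), w) + (t, a)) - F (t, a))).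
  apply/funext => h; congr (_ *: (F _ - _)).
  by congr pair; rewrite /= scaler0 add0r.
by rewrite /derive /= eqf.
Qed.

Lemma line_pair (E : normedModType R) (a : E) (t : R) :
  ((0 : R), a) + t *: ((1 : R), (0 : E)) = (t, a).
Proof. by congr pair; rewrite /= ?scaler0 ?addr0// add0r [_%:A]mulr1. Qed.

(** The derivative in [t] commutes with the derivation [v]: in a chart [v] is a directional
    derivative, and the mixed derivatives of the smooth function [f (phi t y)] of [t] and [y] are
    symmetric. This is how brackets with [K] arise from pushforwards by its flow. *)
Lemma flow_derive (G : set (M -> M)) (phi : R -> M -> M) (K : M -> tvec) x v f :
  one_parameter_subgroup A G phi -> (forall t, smooth_map A (phi t)) ->
  (forall x, K x = velocity A (fun t => phi t x) 0) ->
  smooth A (app K f) -> tangent A x v -> smooth A f ->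
  is_derive (0 : R) (1 : R) (fun t => v (fun y => f (phi t y))) (v (app K f)).
Proof.
move=> [_ phi0 _ phis] phim KE Kf tv fs.
have [c Ac cx] := chart_cover hM x.
have [w ->] := tangent_coord hM Ac cx tv.
set a := coord c x.
pose Psi (z : R * 'rV[R]_n) := f (phi z.1 (coord_inv c z.2)).
pose U : set 'rV[R]_n := coord c @` cdom c.
have oU : open U by exact: chart_image_open hM _ Ac.
have Ua : U a by exists x.
have oD : open ([set: R] `*` U).
  rewrite openE => -[t y] [_ Uy]; exists ([set: R], U) => //=.
  by split; [exact: filterT|exact: open_nbhs_nbhs].
have Ps : smooth_on ([set: R] `*` U) Psi by exact: phis.
have D0 y : U y -> ([set: R] `*` U) ((0 : R), y) by move=> Uy; split.
have Kd y : U y -> app K f (coord_inv c y) = 'D_((1 : R), (0 : 'rV[R]_n)) Psi ((0 : R), y).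
  move=> Uy; rewrite /app KE /velocity; case: asboolP => // _; rewrite derive1E.
  have := @is_derive_line _ _ Psi ((0 : R), y) ((1 : R), (0 : 'rV[R]_n)) 0.
  rewrite scale0r addr0 => /(_ (smooth_on_differentiable Ps (D0 y Uy)))[_].
  have -> : (fun s : R => Psi (((0 : R), y) + s *: ((1 : R), (0 : 'rV[R]_n)))) =
      (fun t => f (phi t (coord_inv c y))).
    by apply/funext => t; rewrite line_pair.
  by move=> ->.
rewrite chart_dirE//.
have -> : 'D_w (fun y => app K f (coord_inv c y)) a =
    'D_((1 : R), (0 : 'rV[R]_n)) ('D_((0 : R), w) Psi) ((0 : R), a).
  rewrite (derive_sym _ _ oD (D0 a Ua) Ps) -derive_slice.
  apply: near_eq_derive; have := open_nbhs_nbhs (conj oU Ua).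
  by apply: filterS => y /Kd.
have dP := smooth_on_differentiable (smooth_on_derive ((0 : R), w) Ps) (D0 a Ua).
have := @is_derive_line _ _ ('D_((0 : R), w) Psi) ((0 : R), a) ((1 : R), (0 : 'rV[R]_n)) 0.
rewrite scale0r addr0 => /(_ dP); congr is_derive; apply/funext => t.
rewrite line_pair -derive_slice chart_dirE//.
exact: phim.
Qed.

End Flow.

(** * Vector fields and frames *)

Section VectorFields.
Context {R : realType} {M : topologicalType} {n : nat} (A : set (chart R M n)).
Hypothesis hM : smooth_manifold A.
Local Notation tvec := ((M -> R) -> R).
Local Notation vfield := (M -> (M -> R) -> R).
Implicit Types (x : M) (u v : tvec) (f : M -> R) (X Y Z K : vfield).

Lemma vf_tangent X x : smooth_vf A X -> tangent A x (X x).
Proof. by move=> [tX _]; exact: tX. Qed.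

Lemma vf_smooth X f : smooth_vf A X -> smooth A f -> smooth A (fun y => X y f).
Proof. by move=> [_ sX]; exact: sX. Qed.

Lemma smooth_vf_lincomb I (r : seq I) (c : I -> M -> R) (X : I -> vfield) :
  (forall i, smooth A (c i)) -> (forall i, smooth_vf A (X i)) ->
  smooth_vf A (fun y => \sum_(i <- r) c i y *: X i y).
Proof.
move=> cs Xs; split.
  by move=> x; apply: tangent_sum => i _; apply: tangentZ; exact: vf_tangent.
move=> f fs; rewrite (_ : app _ _ = fun y => \sum_(i <- r) c i y * X i y f).
  by apply: smooth_sum => // i _; apply: smooth_mul => //; exact: vf_smooth.
by apply/funext => y; rewrite /app fct_sumE.
Qed.

Lemma smooth_vf_add X Y : smooth_vf A X -> smooth_vf A Y -> smooth_vf A (X + Y).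
Proof.
move=> Xs Ys; split; first by move=> x; apply: tangentD; exact: vf_tangent.
by move=> f fs; apply: (smooth_add hM); exact: vf_smooth.
Qed.

Lemma smooth_vf_sub X Y : smooth_vf A X -> smooth_vf A Y -> smooth_vf A (X - Y).
Proof.
move=> Xs Ys; split; first by move=> x; apply: tangentB; exact: vf_tangent.
by move=> f fs; apply: (smooth_sub hM); exact: vf_smooth.
Qed.

Lemma smooth_vf_scale f X : smooth A f -> smooth_vf A X -> smooth_vf A (scale_vf f X).
Proof.
move=> fs Xs; split; first by move=> x; apply: tangentZ; exact: vf_tangent.
by move=> h hs; apply: (smooth_mul hM) => //; exact: vf_smooth.
Qed.

Lemma smooth_vf0 : smooth_vf A (0 : vfield).
Proof.
split; first by move=> x; exact: tangent0.
by move=> f fs; exact: (smooth_cst hM 0).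
Qed.

Lemma smooth_vf_bracket X Y : smooth_vf A X -> smooth_vf A Y -> smooth_vf A (bracket X Y).
Proof.
move=> Xs Ys; split; last first.
  by move=> f fs; apply: (smooth_sub hM); apply: vf_smooth => //; exact: vf_smooth.
move=> x; have tX := vf_tangent x Xs; have tY := vf_tangent x Ys.
(* On a non-smooth [f] every [W y] is zero by normalisation, so [app W f] is the zero function and
   the bracket inherits the normalisation. *)
have nsm Z W f : smooth_vf A Z -> smooth_vf A W -> ~ smooth A f -> Z x (app W f) = 0.
  move=> Zs Ws nf; rewrite (_ : app W f = fun=> 0).
    by rewrite (tan_cst hM _ (vf_tangent x Zs)).
  by apply/funext => y; have [W0 _ _] := vf_tangent y Ws; exact: W0.
have sX f (fs : smooth A f) := vf_smooth Xs fs.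
have sY f (fs : smooth A f) := vf_smooth Ys fs.
split.
- by move=> f nf; rewrite /bracket !nsm// subrr.
- move=> a f g fs gs.
  have lin Z W (Zs : smooth_vf A Z) (Ws : smooth_vf A W) :
      Z x (app W (fun y => a * f y + g y)) = a * Z x (app W f) + Z x (app W g).
    have [_ Zl _] := vf_tangent x Zs.
    rewrite -Zl; [|exact: (vf_smooth Ws)|exact: (vf_smooth Ws)].
    congr (Z x); apply/funext => y; rewrite /app.
    by have [_ Wl _] := vf_tangent y Ws; rewrite Wl.
  by rewrite /bracket !lin//; ring.
- move=> f g fs gs.
  have lei Z W (Zs : smooth_vf A Z) (Ws : smooth_vf A W) :
      Z x (app W (fun y => f y * g y)) =
      f x * Z x (app W g) + W x g * Z x f + g x * Z x (app W f) + W x f * Z x g.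
    have tZ := vf_tangent x Zs.
    have -> : app W (fun y => f y * g y) =
        fun y => f y * app W g y + g y * app W f y.
      by apply/funext => y; rewrite /app (tan_mul (vf_tangent y Ws) fs gs).
    have sWf : smooth A (app W f) by exact: (vf_smooth Ws).
    have sWg : smooth A (app W g) by exact: (vf_smooth Ws).
    rewrite (tan_add tZ); [|exact: (smooth_mul hM)|exact: (smooth_mul hM)].
    by rewrite (tan_mul tZ fs sWg) (tan_mul tZ gs sWf) /app; ring.
  by rewrite /bracket !lei//; ring.
Qed.

Lemma bracketC X Y : bracket X Y = - bracket Y X.
Proof. by apply/funext => x; apply/funext => f; rewrite /bracket !fctE opprB. Qed.

Lemma bracket_addr K X Y : smooth_vf A K -> smooth_vf A X -> smooth_vf A Y ->
  bracket K (X + Y) = bracket K X + bracket K Y.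
Proof.
move=> Ks Xs Ys; apply/funext => x.
apply: (@tangent_ext _ _ _ A x).
- by apply: vf_tangent; apply: smooth_vf_bracket => //; exact: smooth_vf_add.
- by apply: tangentD; apply: vf_tangent; exact: smooth_vf_bracket.
- move=> f fs; rewrite /bracket !fctE.
  have -> : app (X + Y) f = fun y => app X f y + app Y f y by [].
  rewrite (tan_add (vf_tangent x Ks)); [|exact: (vf_smooth Xs)|exact: (vf_smooth Ys)].
  ring.
Qed.

Lemma jacobi K X Y : smooth_vf A K -> smooth_vf A X -> smooth_vf A Y ->
  bracket K (bracket X Y) = bracket (bracket K X) Y + bracket X (bracket K Y).
Proof.
move=> Ks Xs Ys; apply/funext => x.
apply: (@tangent_ext _ _ _ A x).
- by apply: vf_tangent; do 2 (apply: smooth_vf_bracket => //).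
- by apply: tangentD; apply: vf_tangent; do 2 (apply: smooth_vf_bracket => //).
- move=> f fs.
  have B2 Z W W' (Zs : smooth_vf A Z) (Ws : smooth_vf A W) (Ws' : smooth_vf A W') :
      Z x (app (bracket W W') f) = Z x (app W (app W' f)) - Z x (app W' (app W f)).
    have -> : app (bracket W W') f = fun y => app W (app W' f) y - app W' (app W f) y by [].
    rewrite (tan_sub hM (vf_tangent x Zs))//.
      by apply: (vf_smooth Ws); exact: (vf_smooth Ws').
    by apply: (vf_smooth Ws'); exact: (vf_smooth Ws).
  have E W W' h : bracket W W' x h = W x (app W' h) - W' x (app W h) by [].
  by rewrite !fctE !E !B2//; ring.
Qed.

(* Differentiating [d X = sum_j c_j Z_j] along [K]. *)
Lemma bracket_lincomb I (r : seq I) K X d (c : I -> M -> R) (Z : I -> vfield) :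
  smooth_vf A K -> smooth_vf A X -> smooth A d ->
  (forall i, smooth A (c i)) -> (forall i, smooth_vf A (Z i)) ->
  (forall y, d y *: X y = \sum_(i <- r) c i y *: Z i y) -> forall x,
  K x d *: X x + d x *: bracket K X x =
  \sum_(i <- r) (K x (c i) *: Z i x + c i x *: bracket K (Z i) x).
Proof.
move=> Ks Xs ds cs Zs dX x; have tK := vf_tangent x Ks.
apply: (@tangent_ext _ _ _ A x).
- by apply: tangentD; apply: tangentZ; apply: vf_tangent => //; exact: smooth_vf_bracket.
- apply: tangent_sum => i _; apply: tangentD; apply: tangentZ; apply: vf_tangent => //.
  exact: smooth_vf_bracket.
- move=> f fs.
  have dXf y h : d y * X y h = \sum_(i <- r) c i y * Z i y h.
    by have := congr1 (fun v : tvec => v h) (dX y); rewrite fct_sumE.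
  have Kf := vf_smooth Ks fs.
  have Xf := vf_smooth Xs fs.
  have Zf i := vf_smooth (Zs i) fs.
  have e1 : K x (fun y => d y * X y f) = \sum_(i <- r) K x (fun y => c i y * Z i y f).
    rewrite -(tan_sum _ _ tK) => [|//|i _]; last exact: (smooth_mul hM).
    by congr (K x); apply/funext => y.
  have e2 := dXf x (app K f).
  rewrite fct_sumE; under eq_bigr do rewrite !fctE /bracket.
  rewrite !fctE /bracket /GRing.scale /=.
  rewrite (tan_mul tK ds Xf) in e1.
  transitivity (d x * K x (fun y => X y f) + X x f * K x d - d x * X x (app K f)).
    by rewrite /app; ring.
  rewrite e1 e2 -sumrB; apply: eq_bigr => i _.
  by rewrite (tan_mul tK (cs i) (Zf i)) /app; ring.
Qed.

End VectorFields.

(* Expanding along the last column, whose cofactor at the corner is nonzero by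
   induction, an entry can be chosen so that the determinant does not vanish. *)
Lemma lin_indep_det (R : realType) (T : Type) r (v : 'I_r -> T -> R) : lin_indep v ->
  exists f : 'I_r -> T, \det (\matrix_(i, j) v i (f j)) != 0.
Proof.
elim: r v => [|r IH] v vfree.
  have f : 'I_0 -> T by case.
  by exists f; rewrite det_mx00 oner_eq0.
have wfree : lin_indep (fun i : 'I_r => v (lift ord_max i)).
  move=> c c0 i.
  pose c' j : R := if unlift ord_max j is Some i then c i else 0.
  have := vfree c' _ (lift ord_max i); rewrite /c' liftK; apply.
  rewrite (bigD1 ord_max)//= unlift_none scale0r add0r.
  rewrite (reindex_omap (op := +%R) (lift ord_max) (unlift ord_max)); last first.
    by move=> j; case: unliftP => [k -> _|->]; [rewrite ?liftK|rewrite eqxx].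
  rewrite -[RHS]c0; apply: eq_big => [j|j _]; last by rewrite liftK.
  by rewrite eq_sym neq_lift liftK eqxx.
have [f fdet] := IH _ wfree.
pose F (g : T) (j : 'I_r.+1) := if unlift ord_max j is Some i then f i else g.
pose cf (i : 'I_r.+1) : R := (-1) ^+ (i + r)%N * \det (\matrix_(k, l) v (lift i k) (f l)).
suff [g gN0] : exists g, \sum_i cf i * v i g != 0.
  exists (F g); rewrite (expand_det_col _ ord_max).
  congr (_ != 0) : gN0; apply: eq_bigr => i _.
  rewrite mulrC mxE /F unlift_none; congr (_ * _).
  rewrite /cf /cofactor; congr (_ * \det _).
  by apply/matrixP => k l; rewrite !mxE /F liftK.
apply: contrapT => /forallNP nall.
have /vfree/(_ ord_max)/eqP : \sum_i cf i *: v i = 0.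
  apply/funext => g; rewrite fct_sumE.
  by have /negP := nall g; rewrite negbK => /eqP.
by rewrite mulf_eq0 signr_eq0 (negPf fdet).
Qed.

Section Frames.
Context {R : realType} {M : topologicalType} {n : nat} (A : set (chart R M n)).
Hypothesis hM : smooth_manifold A.
Local Notation tvec := ((M -> R) -> R).
Local Notation vfield := (M -> (M -> R) -> R).
Local Notation distribution := (M -> set ((M -> R) -> R)).
Implicit Types (x y : M) (u v : tvec) (f : M -> R) (X Y Z K : vfield) (D : distribution).

Lemma smooth_det k (F : M -> 'M[R]_k) : (forall i j, smooth A (fun y => F y i j)) ->
  smooth A (fun y => \det (F y)).
Proof.
move=> Fs; apply: smooth_sum => // s _; apply: smooth_mul => //; first exact: smooth_cst.
exact: smooth_prod.
Qed.

Lemma smooth_adj k (F : M -> 'M[R]_k) i j : (forall i j, smooth A (fun y => F y i j)) ->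
  smooth A (fun y => (\adj (F y)) i j).
Proof.
move=> Fs; rewrite (_ : (fun y => _) =
    fun y => (-1) ^+ (j + i)%N * \det (row' j (col' i (F y)))).
  apply: smooth_mul => //; first exact: smooth_cst.
  by apply: smooth_det => k' l'; congr smooth : (Fs (lift j k') (lift i l'));
     apply/funext => y; rewrite !mxE.
by apply/funext => y; rewrite mxE.
Qed.

Lemma subbundle_basis D r x : subbundle A D r ->
  exists X : 'I_r -> vfield, [/\ forall i, section A D (X i),
    \forall y \near x, is_basis (D y) (X ^~ y) & is_basis (D x) (X ^~ x)].
Proof. by move=> [_ /(_ x)[X [Xs Xb]]]; exists X; split=> //; exact: nbhs_singleton Xb. Qed.

Lemma subbundle_comb D r x (a : R) u v : subbundle A D r -> D x u -> D x v -> D x (a *: u + v).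
Proof.
move=> /(subbundle_basis x)[X [_ _ [_ ->]]] [c ->] [c' ->].
exists (fun i => a * c i + c' i); rewrite scaler_sumr -big_split /=.
by apply: eq_bigr => i _; rewrite scalerDl scalerA.
Qed.

Lemma subbundle0 D r x : subbundle A D r -> D x 0.
Proof.
move=> /(subbundle_basis x)[X [_ _ [_ ->]]]; exists (fun=> 0).
by rewrite big1// => i _; rewrite scale0r.
Qed.

Lemma subbundleZ D r x (a : R) u : subbundle A D r -> D x u -> D x (a *: u).
Proof.
move=> Ds Du; rewrite -[_ *: _]addr0.
by apply: (subbundle_comb _ Ds) => //; exact: subbundle0 Ds.
Qed.

Lemma subbundleB D r x u v : subbundle A D r -> D x u -> D x v -> D x (u - v).
Proof.
by move=> Ds Du Dv; rewrite addrC -scaleN1r; exact: (subbundle_comb _ Ds).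
Qed.

Lemma subbundleD D r x u v : subbundle A D r -> D x u -> D x v -> D x (u + v).
Proof.
by move=> Ds Du Dv; rewrite -[u]scale1r; exact: (subbundle_comb _ Ds).
Qed.

Lemma subbundle_sum D r x I (s : seq I) (w : I -> tvec) : subbundle A D r ->
  (forall i, D x (w i)) -> D x (\sum_(i <- s) w i).
Proof.
move=> Ds Dw; elim/big_ind: _ => //; first exact: subbundle0 Ds.
by move=> u v Du Dv; rewrite -[u]scale1r; exact: subbundle_comb Ds _ _.
Qed.

Lemma lin_indep_inj k (v : 'I_k -> tvec) (c c' : 'I_k -> R) : lin_indep v ->
  \sum_i c i *: v i = \sum_i c' i *: v i -> forall i, c i = c' i.
Proof.
move=> vf /eqP; rewrite -subr_eq0 -sumrB => /eqP cc i; apply/eqP; rewrite -subr_eq0.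
apply/eqP; apply: (vf (fun i => c i - c' i)); rewrite -[RHS]cc.
by apply: eq_bigr => j _; rewrite scalerBl.
Qed.

(* Cramer's rule, localised by a bump function so that it holds everywhere. *)
Lemma frame_dual D r x (X : 'I_r -> vfield) : (forall i, smooth_vf A (X i)) ->
  (\forall y \near x, is_basis (D y) (X ^~ y)) ->
  exists (d : M -> R) (f : 'I_r -> M -> R) (b : 'I_r -> 'I_r -> M -> R),
  [/\ smooth A d /\ (forall i, smooth A (f i)), forall i j, smooth A (b i j), d x != 0 &
    forall y u, D y u -> d y *: u = \sum_j (\sum_i b i j y * u (f i)) *: X j y].
Proof.
move=> Xs Xb.
have [Xx _] := nbhs_singleton Xb.
have [f fdet] := lin_indep_det Xx.
have fs i : smooth A (f i).
  apply: contrapT => nf; move/eqP: fdet; apply.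
  rewrite (expand_det_col _ i) big1// => j _; rewrite mxE.
  by have [-> //] := vf_tangent x (Xs j); rewrite mul0r.
pose W y : 'M[R]_r := \matrix_(i, j) X i y (f j).
have Ws i j : smooth A (fun y => W y i j).
  by congr smooth : (vf_smooth (Xs i) (fs j)); apply/funext => y; rewrite mxE.
have [phi [phis phix phiN]] := smooth_bump hM Xb.
exists (fun y => phi y * \det (W y)), f, (fun i j y => phi y * (\adj (W y)) i j); split.
- by split => //; apply: (smooth_mul hM) => //; exact: smooth_det.
- by move=> i j; apply: (smooth_mul hM) => //; exact: smooth_adj.
- by rewrite mulf_neq0.
move=> y u Du; have [->|/phiN[_ DE]] := eqVneq (phi y) 0.
  rewrite mul0r scale0r big1// => j _; rewrite big1 ?scale0r// => i _.
  by rewrite !mul0r.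
move: Du; rewrite DE => -[a ->].
have -> : \sum_i a i *: X i y = \sum_j a j *: X j y by [].
rewrite scaler_sumr; apply: eq_bigr => j _; rewrite scalerA; congr (_ *: _).
pose av := \row_i a i.
have uf i : (\sum_j a j *: X j y) (f i) = (av *m W y) ord0 i.
  by rewrite fct_sumE mxE; apply: eq_bigr => k _; rewrite !mxE.
transitivity (phi y * (av *m W y *m \adj (W y)) ord0 j).
  by rewrite -mulmxA mul_mx_adj mul_mx_scalar !mxE mulrA.
rewrite mxE mulr_sumr; apply: eq_bigr => i _; rewrite uf; ring.
Qed.

End Frames.

(** * Killing fields *)

Section Killing.
Context {R : realType} {M : topologicalType} {n : nat} (A : set (chart R M n)).
Hypothesis hM : smooth_manifold A.
Local Notation tvec := ((M -> R) -> R).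
Local Notation vfield := (M -> (M -> R) -> R).
Local Notation distribution := (M -> set ((M -> R) -> R)).
Local Notation form := (M -> ((M -> R) -> R) -> ((M -> R) -> R) -> R).
Implicit Types (x y : M) (u v : tvec) (f : M -> R) (X Y Z K : vfield) (D H V : distribution).
Implicit Types (ip g : form).

Lemma ip_suml D r ip x I (s : seq I) (c : I -> R) (w : I -> tvec) u :
  subbundle A D r -> smooth_inner_product A D ip -> D x u -> (forall i, D x (w i)) ->
  ip x (\sum_(i <- s) c i *: w i) u = \sum_(i <- s) c i * ip x (w i) u.
Proof.
move=> Ds [lin _ _ _] Du Dw; have D0 := subbundle0 x Ds.
elim: s => [|i s IH].
  rewrite !big_nil; have := lin x (-1) 0 0 u D0 D0 Du.
  by rewrite scaler0 addr0 mulN1r addNr.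
rewrite !big_cons lin ?IH//.
by apply: (subbundle_sum _ Ds) => j; exact: (subbundleZ _ Ds).
Qed.

Lemma ip_sumr D r ip x I (s : seq I) (c : I -> R) (w : I -> tvec) u :
  subbundle A D r -> smooth_inner_product A D ip -> D x u -> (forall i, D x (w i)) ->
  ip x u (\sum_(i <- s) c i *: w i) = \sum_(i <- s) c i * ip x u (w i).
Proof.
move=> Ds Dip Du Dw; have [_ sym _ _] := Dip.
have Dsum : D x (\sum_(i <- s) c i *: w i).
  by apply: (subbundle_sum _ Ds) => j; exact: (subbundleZ _ Ds).
rewrite sym// (ip_suml _ _ Ds Dip)//.
by apply: eq_bigr => i _; rewrite sym.
Qed.

Lemma ip_combl D r ip x (a : R) u v w : subbundle A D r -> smooth_inner_product A D ip ->
  D x u -> D x v -> D x w -> ip x (a *: u + v) w = a * ip x u w + ip x v w.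
Proof. by move=> _ [lin _ _ _]; exact: lin. Qed.

Lemma ip_Zl D r ip x (a : R) u w : subbundle A D r -> smooth_inner_product A D ip ->
  D x u -> D x w -> ip x (a *: u) w = a * ip x u w.
Proof.
move=> Ds Dip Du Dw.
have := @ip_suml D r ip x unit [:: tt] (fun=> a) (fun=> u) w Ds Dip Dw (fun=> Du).
by rewrite !big_seq1.
Qed.

Lemma ip_Zr D r ip x (a : R) u w : subbundle A D r -> smooth_inner_product A D ip ->
  D x u -> D x w -> ip x u (a *: w) = a * ip x u w.
Proof.
move=> Ds Dip Du Dw.
have := @ip_sumr D r ip x unit [:: tt] (fun=> a) (fun=> w) u Ds Dip Du (fun=> Dw).
by rewrite !big_seq1.
Qed.

Definition killing H V ip K : Prop :=
  [/\ smooth_vf A K,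
      forall X, section A H X -> section A H (bracket K X),
      forall X, section A V X -> section A V (bracket K X) &
      forall X Y, section A H X -> section A H Y -> forall x,
        K x (fun y => ip y (X y) (Y y)) =
        ip x (bracket K X x) (Y x) + ip x (X x) (bracket K Y x)].

(** * Infinitesimal consequences of invariance under a flow *)

Section FromFlow.
Variables (G : set (M -> M)) (phi : R -> M -> M) (K : vfield).
Hypothesis Gphi : one_parameter_subgroup A G phi.
Hypothesis phim : forall t, smooth_map A (phi t).
Hypothesis KE : forall x, K x = velocity A (fun t => phi t x) 0.
Hypothesis Ks : smooth_vf A K.

Let phi0 x : phi 0 x = x. Proof. by have [_ ->] := Gphi. Qed.

Lemma flow_point_derive x f : smooth A f ->
  is_derive (0 : R) (1 : R) (fun t => f (phi t x)) (K x f).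
Proof.
move=> fs; rewrite KE /velocity; case: asboolP => // _; rewrite derive1E.
apply/derivableP; have [c Ac cx] := chart_cover hM x.
have [_ _ _ /(_ f c fs Ac) Ps] := Gphi.
pose Psi (z : R * 'rV[R]_n) := f (phi z.1 (coord_inv c z.2)).
have dP : differentiable Psi ((0 : R), coord c x).
  by apply: (smooth_on_differentiable Ps); split => //; exists x.
have := @is_derive_line _ _ Psi ((0 : R), coord c x) ((1 : R), (0 : 'rV[R]_n)) 0.
rewrite scale0r addr0 => /(_ dP)[dl _].
have eqf : (fun s : R => Psi (((0 : R), coord c x) + s *: ((1 : R), (0 : 'rV[R]_n)))) =
    (fun t => f (phi t x)).
  by apply/funext => t; rewrite line_pair /Psi /= (chartK hM).
by rewrite -eqf.
Qed.

(** The coefficient functions [b i], carried along the orbit, contribute [K (b i)]; the pushforward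
    contributes [X (K f i) = K (X f i) - [K, X] f i]. *)
Lemma flow_coef_derive x X k (b f : 'I_k -> M -> R) : smooth_vf A X ->
  (forall i, smooth A (b i)) -> (forall i, smooth A (f i)) ->
  is_derive (0 : R) (1 : R)
    (fun t => \sum_i b i (phi t x) * pushforward (phi t) (X x) (f i))
    (K x (fun y => \sum_i b i y * X y (f i)) - \sum_i b i x * bracket K X x (f i)).
Proof.
move=> Xs bs fs; have tK := vf_tangent x Ks.
have sX i := vf_smooth Xs (fs i).
rewrite (tan_sum _ _ tK) => [|//|i _]; last exact: (smooth_mul hM).
rewrite -sumrB.
rewrite (_ : (fun t => _) =
  \sum_i (fun t => b i (phi t x) * pushforward (phi t) (X x) (f i))); last first.
  by apply/funext => t; rewrite fct_sumE.
apply: is_derive_sum => i.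
have d1 := flow_point_derive x (bs i).
have d2 := flow_derive hM Gphi phim KE (vf_smooth Ks (fs i)) (vf_tangent x Xs) (fs i).
have := is_deriveM d1 d2; rewrite phi0.
have -> : X x (fun y => f i (phi 0 y)) = X x (f i).
  by congr (X x); apply/funext => y; rewrite phi0.
congr is_derive.
by rewrite (tan_mul tK (bs i) (sX i)) /bracket /app /GRing.scale /=; ring.
Qed.

Lemma is_derive_const (h : R -> R) (a l : R) : (forall t, h t = a) ->
  is_derive (0 : R) (1 : R) h l -> l = 0.
Proof.
move=> ha [_ <-]; rewrite (_ : h = fun=> a); last exact/funext.
exact: derive_cst.
Qed.

Lemma addBDB_eq0 (a b c d : R) : a + b - ((c + b) - d) = 0 -> c - a = d.
Proof. lra. Qed.

Lemma addBB_eq0 (a b c : R) : a + b - c - b = 0 -> a = c.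
Proof. lra. Qed.

(** The expansion [d X = sum_j C_j Z_j] is differentiated in two ways: along [K] as an identity
    between fields ([stat']), and at time zero for the transported vector ([F0]), where the
    invariance of [D] keeps it true along the orbit. The difference of the two is an expansion of [d
    [K, X]] in the frame of [D]. *)
Lemma flow_preserves D r X : subbundle A D r ->
  (forall t y u, D y u -> D (phi t y) (pushforward (phi t) u)) ->
  section A D X -> section A D (bracket K X).
Proof.
move=> Ds Dphi [Xs DX]; have KXs := smooth_vf_bracket hM Ks Xs.
split=> // x; have [Z [Zs Zb Zx]] := subbundle_basis x Ds.
have Zv i : smooth_vf A (Z i) by have [] := Zs i.
have [d [f [b [[ds fs] bs dx dE]]]] := frame_dual hM Zv Zb.
have tK := vf_tangent x Ks.
suff E : d x *: bracket K X x = \sum_j (\sum_i b i j x * bracket K X x (f i)) *: Z j x.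
  rewrite -[bracket _ _ _](scalerK dx) E; apply: (subbundleZ _ Ds).
  by apply: (subbundle_sum _ Ds) => j; apply: (subbundleZ _ Ds); have [_] := Zs j.
apply: (@tangent_ext _ _ _ A x).
- by apply: tangentZ; exact: vf_tangent.
- by apply: tangent_sum => j _; apply: tangentZ; exact: vf_tangent.
move=> h hs; rewrite fct_sumE; under eq_bigr do rewrite !fctE.
rewrite !fctE.
pose C j y := \sum_i b i j y * X y (f i).
have Cs j : smooth A (C j).
  by apply: smooth_sum => // i _; apply: (smooth_mul hM) => //; exact: vf_smooth.
have Xh := vf_smooth Xs hs.
have Zh j := vf_smooth (Zv j) hs.
have stat y : d y * X y h = \sum_j C j y * Z j y h.
  by have := congr1 (fun v : tvec => v h) (dE y _ (DX y)); rewrite fct_sumE.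
have stat' : d x * K x (fun y => X y h) + X x h * K x d =
    \sum_j (C j x * K x (fun y => Z j y h) + Z j x h * K x (C j)).
  rewrite -(tan_mul tK ds Xh) (_ : (fun y => _) = fun y => \sum_j C j y * Z j y h); last exact/funext.
  rewrite (tan_sum _ _ tK) => [|//|j _]; last exact: (smooth_mul hM).
  by apply: eq_bigr => j _; exact: (tan_mul tK (Cs j) (Zh j)).
pose Ct j t := \sum_i b i j (phi t x) * pushforward (phi t) (X x) (f i).
pose F t := d (phi t x) * pushforward (phi t) (X x) h - \sum_j Ct j t * Z j (phi t x) h.
have F0 t : F t = 0.
  have := congr1 (fun v : tvec => v h) (dE (phi t x) _ (Dphi t x _ (DX x))).
  by rewrite /F fct_sumE /Ct => <-; rewrite subrr.
pose c j := \sum_i b i j x * bracket K X x (f i).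
have dC j : is_derive (0 : R) (1 : R) (Ct j) (K x (C j) - c j).
  exact: (flow_coef_derive x Xs (fun i => bs i j) fs).
have dZ j := flow_point_derive x (Zh j).
have dd := flow_point_derive x ds.
have dX := flow_derive hM Gphi phim KE (vf_smooth Ks hs) (vf_tangent x Xs) hs.
have dF := is_deriveB (is_deriveM dd dX) (is_derive_sum (fun j => is_deriveM (dC j) (dZ j))).
have X0 (k : M -> R) : pushforward (phi 0) (X x) k = X x k.
  by congr (X x); apply/funext => y; rewrite phi0.
have FE : F = (fun t => d (phi t x)) * (fun t => X x (fun y => h (phi t y))) -
    \sum_j ((Ct j) * (fun t => Z j (phi t x) h)).
  by apply/funext => t; rewrite !fctE fct_sumE.
rewrite -FE in dF; have := is_derive_const F0 dF.
rewrite phi0.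
have -> : X x (fun y => h (phi 0 y)) = X x h by rewrite -[RHS]X0.
have Ct0 j : Ct j 0 = C j x by apply: eq_bigr => i _; rewrite phi0 X0.
rewrite /GRing.scale /=.
rewrite [X in _ - X](_ : _ =
    \sum_j (C j x * K x (fun y => Z j y h) + Z j x h * K x (C j)) - \sum_j c j * Z j x h); last first.
  by rewrite -sumrB; apply: eq_bigr => j _; rewrite Ct0; ring.
rewrite -stat' => dyn.
have EK : bracket K X x h = K x (fun y => X y h) - X x (app K h) by [].
by rewrite EK mulrBr; exact: addBDB_eq0 dyn.
Qed.

(** The same comparison of a static and a transported identity, for [<X, Y>] expanded in the Gram
    coefficients of a frame; [d] is squared because both arguments are expanded. The expansion is
    what makes the pairing of transported vectors visibly differentiable in [t]. *)
Lemma flow_metric D r ip X Y : subbundle A D r -> smooth_inner_product A D ip ->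
  (forall t y u, D y u -> D (phi t y) (pushforward (phi t) u)) ->
  (forall t y u v, D y u -> D y v ->
     ip (phi t y) (pushforward (phi t) u) (pushforward (phi t) v) = ip y u v) ->
  section A D X -> section A D Y -> forall x,
  K x (fun y => ip y (X y) (Y y)) =
    ip x (bracket K X x) (Y x) + ip x (X x) (bracket K Y x).
Proof.
move=> Ds Dip Dphi isom DX DY x.
have [KXs DKX] := flow_preserves Ds Dphi DX.
have [KYs DKY] := flow_preserves Ds Dphi DY.
have [_ _ _ ips] := Dip.
have XYs := ips _ _ DX DY.
move: DX DY => [Xs DX] [Ys DY].
have [Z [Zs Zb Zx]] := subbundle_basis x Ds.
have Zv i : smooth_vf A (Z i) by have [] := Zs i.
have ZD i y : D y (Z i y) by have [_] := Zs i.
have [d [f [b [[ds fs] bs dx dE]]]] := frame_dual hM Zv Zb.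
have tK := vf_tangent x Ks.
pose cf y (u : tvec) j := \sum_i b i j y * u (f i).
pose Gm j l y := ip y (Z j y) (Z l y).
have Gs j l : smooth A (Gm j l) by exact: ips.
have expand y u v : D y u -> D y v ->
    d y * d y * ip y u v = \sum_j \sum_l cf y u j * (cf y v l * Gm j l y).
  move=> Du Dv; rewrite -mulrA -(ip_Zr _ Ds Dip Du Dv) -(ip_Zl _ Ds Dip Du); last first.
    exact: (subbundleZ _ Ds).
  rewrite (dE _ _ Du) (dE _ _ Dv) (ip_suml _ _ Ds Dip) => [|| j]; last exact: ZD.
    apply: eq_bigr => j _; rewrite (ip_sumr _ _ Ds Dip) => [||l]; [|exact: ZD|exact: ZD].
    by rewrite mulr_sumr; apply: eq_bigr.
  by rewrite -(dE _ _ Dv); exact: (subbundleZ _ Ds).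
pose CX j y := cf y (X y) j.
pose CY j y := cf y (Y y) j.
have Cs W (Ws : smooth_vf A W) j : smooth A (fun y => cf y (W y) j).
  by apply: smooth_sum => // i _; apply: (smooth_mul hM) => //; exact: vf_smooth.
have CXs j : smooth A (CX j) := Cs X Xs j.
have CYs j : smooth A (CY j) := Cs Y Ys j.
have dds := smooth_mul hM ds ds.
have stat : d x * d x * K x (fun y => ip y (X y) (Y y)) +
    ip x (X x) (Y x) * (d x * K x d + d x * K x d) =
    \sum_j \sum_l (CX j x * (CY l x * K x (Gm j l) + Gm j l x * K x (CY l))
       + CY l x * Gm j l x * K x (CX j)).
  rewrite -(tan_mul tK ds ds) -(tan_mul tK dds XYs).
  rewrite (_ : (fun y => _) = fun y => \sum_j \sum_l CX j y * (CY l y * Gm j l y)); last first.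
    by apply/funext => y; rewrite expand.
  rewrite (tan_sum _ _ tK) => [|//|j _]; last first.
    by apply: smooth_sum => // l _; do 2 (apply: (smooth_mul hM) => //).
  apply: eq_bigr => j _; rewrite (tan_sum _ _ tK) => [|//|l _]; last first.
    by do 2 (apply: (smooth_mul hM) => //).
  apply: eq_bigr => l _.
  have CGs := smooth_mul hM (CYs l) (Gs j l).
  by rewrite (tan_mul tK (CXs j) CGs) (tan_mul tK (CYs l) (Gs j l)).
pose CXt j t := cf (phi t x) (pushforward (phi t) (X x)) j.
pose CYt j t := cf (phi t x) (pushforward (phi t) (Y x)) j.
pose cX j := cf x (bracket K X x) j.
pose cY j := cf x (bracket K Y x) j.
have dCX j : is_derive (0 : R) (1 : R) (CXt j) (K x (CX j) - cX j).
  exact: (flow_coef_derive x Xs (fun i => bs i j) fs).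
have dCY j : is_derive (0 : R) (1 : R) (CYt j) (K x (CY j) - cY j).
  exact: (flow_coef_derive x Ys (fun i => bs i j) fs).
have dG j l := flow_point_derive x (Gs j l).
have dd := flow_point_derive x dds.
have d1 := is_deriveB (is_derive_sum (fun j => is_derive_sum (fun l =>
   is_deriveM (dCX j) (is_deriveM (dCY l) (dG j l)))))
   (is_deriveM (is_derive_cst (ip x (X x) (Y x)) (0 : R) (1 : R)) dd).
pose F t := \sum_j \sum_l CXt j t * (CYt l t * Gm j l (phi t x)) -
  ip x (X x) (Y x) * (d (phi t x) * d (phi t x)).
have F0 t : F t = 0.
  rewrite /F -(expand (phi t x)) => [||]; [|exact: Dphi|exact: Dphi].
  by rewrite isom// mulrC subrr.
have FE : F = \sum_j \sum_l (CXt j) * (CYt l * (fun t => Gm j l (phi t x))) -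
    cst (ip x (X x) (Y x)) * (fun t => d (phi t x) * d (phi t x)).
  apply/funext => t; rewrite !fctE fct_sumE; congr (_ - _).
  by apply: eq_bigr => j _; rewrite fct_sumE.
rewrite -FE in d1; have := is_derive_const F0 d1.
rewrite phi0.
have W0 (W : vfield) k : pushforward (phi 0) (W x) k = W x k.
  by congr (W x); apply/funext => y; rewrite phi0.
have CX0 j : CXt j 0 = CX j x by rewrite /CXt /cf phi0; apply: eq_bigr => i _; rewrite W0.
have CY0 j : CYt j 0 = CY j x by rewrite /CYt /cf phi0; apply: eq_bigr => i _; rewrite W0.
rewrite [X in X - _](_ : _ = \sum_j \sum_l (CX j x * (CY l x * K x (Gm j l) + Gm j l x * K x (CY l))
       + CY l x * Gm j l x * K x (CX j)) -
    (\sum_j \sum_l cX j * (CY l x * Gm j l x) + \sum_j \sum_l CX j x * (cY l * Gm j l x))); last first.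
  rewrite -big_split -sumrB; apply: eq_bigr => j _ /=.
  rewrite -big_split -sumrB; apply: eq_bigr => l _ /=.
  rewrite !fctE CX0 CY0 phi0 /GRing.scale /=; ring.
rewrite -stat.
rewrite -(expand _ _ _ (DKX x) (DY x)) -(expand _ _ _ (DX x) (DKY x)).
rewrite (tan_mul tK ds ds) scaler0 addr0 /cst /GRing.scale /= => dyn.
apply: (mulfI (mulf_neq0 dx dx)); rewrite mulrDr.
exact: addBB_eq0 dyn.
Qed.

End FromFlow.
End Killing.

(** * Rigidity of Killing fields *)

Section Rigidity.
Context {R : realType} {M : topologicalType} {n : nat} (A : set (chart R M n)).
Hypothesis hM : smooth_manifold A.
Local Notation tvec := ((M -> R) -> R).
Local Notation vfield := (M -> (M -> R) -> R).
Local Notation distribution := (M -> set ((M -> R) -> R)).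
Local Notation form := (M -> ((M -> R) -> R) -> ((M -> R) -> R) -> R).
Implicit Types (x y : M) (u v : tvec) (f h : M -> R) (X Y Z W K : vfield).

(* The factor [d], nonzero at [x0], localises the ideal generated by [s] at [x0]. *)
Section LocalIdeal.
Variables (I : finType) (s : I -> M -> R) (x0 : M).
Hypothesis ss : forall i, smooth A (s i).

Definition local_ideal h : Prop := smooth A h /\
  exists d (c : I -> M -> R), [/\ smooth A d, forall i, smooth A (c i), d x0 != 0 &
    forall y, d y * h y = \sum_i c i y * s i y].

Lemma local_ideal_smooth h : local_ideal h -> smooth A h. Proof. by case. Qed.

Lemma local_ideal_gen i : local_ideal (s i).
Proof.
split=> //; exists (fun=> 1), (fun j => fun=> (i == j)%:R); split.
- exact: smooth_cst.
- by move=> j; exact: smooth_cst.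
- exact: oner_neq0.
- move=> y; rewrite mul1r (bigD1 i)//= eqxx mul1r big1 ?addr0// => j /negPf.
  by rewrite eq_sym => ->; rewrite mul0r.
Qed.

Lemma local_ideal_add h h' : local_ideal h -> local_ideal h' ->
  local_ideal (fun y => h y + h' y).
Proof.
move=> [hs [d [c [ds cs dx E]]]] [hs' [d' [c' [ds' cs' dx' E']]]].
split; first exact: smooth_add.
exists (fun y => d y * d' y), (fun i y => d' y * c i y + d y * c' i y); split.
- exact: smooth_mul.
- by move=> i; apply: smooth_add => //; exact: smooth_mul.
- exact: mulf_neq0.
- move=> y; transitivity (d' y * (d y * h y) + d y * (d' y * h' y)); first by ring.
  rewrite E E' !mulr_sumr -big_split; apply: eq_bigr => i _ /=; ring.
Qed.

Lemma local_ideal_mul h h' : smooth A h -> local_ideal h' -> local_ideal (fun y => h y * h' y).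
Proof.
move=> hs [hs' [d [c [ds cs dx E]]]]; split; first exact: smooth_mul.
exists d, (fun i y => h y * c i y); split => //; first by move=> i; exact: smooth_mul.
move=> y; rewrite mulrCA E mulr_sumr; apply: eq_bigr => i _; ring.
Qed.

Lemma local_ideal_mulr h h' : smooth A h -> local_ideal h' -> local_ideal (fun y => h' y * h y).
Proof.
move=> hs Jh'; have := local_ideal_mul hs Jh'; congr local_ideal.
by apply/funext => y; rewrite mulrC.
Qed.

Lemma local_ideal_opp h : local_ideal h -> local_ideal (fun y => - h y).
Proof.
move=> Jh; have := local_ideal_mul (smooth_cst hM (-1)) Jh; congr local_ideal.
by apply/funext => y; rewrite mulN1r.
Qed.

Lemma local_ideal_sub h h' : local_ideal h -> local_ideal h' ->
  local_ideal (fun y => h y - h' y).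
Proof. by move=> Jh Jh'; apply: local_ideal_add => //; exact: local_ideal_opp. Qed.

Lemma local_ideal0 : local_ideal (fun=> 0).
Proof.
split; first exact: smooth_cst.
exists (fun=> 1), (fun _ => fun=> 0); split.
- exact: smooth_cst.
- by move=> j; exact: smooth_cst.
- exact: oner_neq0.
- by move=> y; rewrite mulr0 big1// => i _; rewrite mul0r.
Qed.

Lemma local_ideal_sum J (r : seq J) (F : J -> M -> R) : (forall j, local_ideal (F j)) ->
  local_ideal (fun y => \sum_(j <- r) F j y).
Proof.
move=> JF; elim: r => [|j r IH].
  by congr local_ideal : local_ideal0; apply/funext => y; rewrite big_nil.
by congr local_ideal : (local_ideal_add (JF j) IH); apply/funext => y; rewrite big_cons.
Qed.

(** Functions that do not vanish at [x0] act as units of the ring of germs there. *)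
Lemma local_ideal_div d h : smooth A d -> d x0 != 0 -> smooth A h ->
  local_ideal (fun y => d y * h y) -> local_ideal h.
Proof.
move=> ds dx hs [_ [d' [c [ds' cs dx' E]]]]; split=> //.
exists (fun y => d' y * d y), c; split => //; first exact: smooth_mul.
  exact: mulf_neq0.
by move=> y; rewrite -mulrA.
Qed.

(** Leibniz rule on [d h = sum_i c_i s_i]; the term [h (Z d)] is in the ideal because [h] is.
    Stability under [Z] thus need only be checked on the generators. *)
Lemma local_ideal_derive Z h : smooth_vf A Z ->
  (forall i, local_ideal (fun y => Z y (s i))) -> local_ideal h ->
  local_ideal (fun y => Z y h).
Proof.
move=> Zs JZ Jh; have [hs [d [c [ds cs dx E]]]] := Jh.
apply: (local_ideal_div ds dx); first exact: vf_smooth.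
rewrite (_ : (fun y => _) = fun y =>
  \sum_i (c i y * Z y (s i) + s i y * Z y (c i)) - h y * Z y d).
  apply: local_ideal_sub; last first.
    by apply: local_ideal_mulr => //; exact: vf_smooth.
  apply: local_ideal_sum => i; apply: local_ideal_add; first exact: local_ideal_mul.
  apply: local_ideal_mulr; [exact: vf_smooth|exact: local_ideal_gen].
apply/funext => y; have tZ := vf_tangent y Zs.
have := tan_mul tZ ds hs.
rewrite (_ : (fun z => _) = fun z => \sum_i c i z * s i z); last exact/funext.
rewrite (tan_sum _ _ tZ) => [|//|i _]; last exact: smooth_mul.
move=> E2; rewrite (_ : \sum_i _ = d y * Z y h + h y * Z y d); first by rewrite addrK.
by rewrite -E2; apply: eq_bigr => i _; rewrite (tan_mul tZ (cs i) (ss i)).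
Qed.

(** Dividing by [d], nonzero near [x0], turns membership into a pointwise estimate; in this form the
    ideal enters Gronwall's inequality. *)
Lemma local_ideal_bound h : local_ideal h ->
  exists B : R, \forall y \near x0, `|h y| <= B * \sum_i `|s i y|.
Proof.
move=> [hs [d [c [ds cs dx E]]]].
have cont i : {for x0, continuous (fun y => c i y / d y)}.
  apply: continuousM; first exact: (smooth_continuous hM (cs i)).
  apply: continuousV => //; exact: (smooth_continuous hM ds).
have nd : \forall y \near x0, d y != 0.
  have cd : {for x0, continuous d} by exact: (smooth_continuous hM ds).
  by apply: (cd [set t : R | t != 0]); apply: open_nbhs_nbhs; split => //; exact: open_neq.
have nb i : \forall y \near x0, `|c i y / d y| <= \sum_j (`|c j x0 / d x0| + 1).
  have /cvgrPdist_lt/(_ 1 ltr01) := cont i.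
  apply: filterS => y cy.
  rewrite (@le_trans _ _ (`|c i x0 / d x0| + 1))//.
    by rewrite addrC -lerBlDr (le_trans (lerB_dist _ _))// distrC ltW.
  by rewrite (bigD1 i)//= lerDl sumr_ge0// => j _; rewrite addr_ge0.
exists (\sum_j (`|c j x0 / d x0| + 1)).
have nball : \forall y \near x0, forall i, `|c i y / d y| <= \sum_j (`|c j x0 / d x0| + 1).
  exact: filter_forall.
apply: filterS (filterI nd nball) => y [dy by_].
have -> : h y = \sum_i c i y / d y * s i y.
  apply: (mulfI dy); rewrite E mulr_sumr; apply: eq_bigr => i _.
  by rewrite mulrA mulrCA mulfV// mulr1.
rewrite (le_trans (ler_norm_sum _ _ _))// mulr_sumr; apply: ler_sum => i _.
by rewrite normrM ler_wpM2r.
Qed.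

End LocalIdeal.

(** Along the ray from [a] to [z], the product of [F] with [exp(-b t)], [b = B |z - a|], starts at
    zero and has nonpositive derivative, so a single mean value step gives [F z <= 0]. *)
Lemma gronwall_rV (a : 'rV[R]_n) (e B : R) (F : 'rV[R]_n -> R) :
  smooth_on (ball a e) F -> (forall z : 'rV[R]_n, ball a e z -> 0 <= F z) -> F a = 0 ->
  (forall z w : 'rV[R]_n, ball a e z -> 'D_w F z <= B * `|w| * F z) ->
  forall z : 'rV[R]_n, ball a e z -> F z = 0.
Proof.
move=> Fs F0 Fa FB z zb.
pose b := B * `|z - a|.
pose k (t : R) : R := F (a + t *: (z - a)) * expR (- b * t).
have kd (t : R) : 0 <= t <= 1 -> is_derive t (1 : R) k
    (expR (- b * t) * ('D_(z - a) F (a + t *: (z - a)) - b * F (a + t *: (z - a)))).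
  move=> tP.
  have d1 := is_derive_line (smooth_on_differentiable Fs (ray_ball zb tP)).
  have d2 : is_derive t (1 : R) (fun t => expR (- b * t)) (expR (- b * t) * - b).
    have d3 : is_derive t (1 : R) (fun t => - b * t) (- b).
      by have := is_deriveZ (- b) (is_derive_id t (1 : R)); rewrite [_%:A]mulr1.
    exact: (@is_derive1_comp _ expR (fun t => - b * t) t _ _ (is_derive_expR _) d3).
  have := is_deriveM d1 d2; congr is_derive.
  by rewrite /GRing.scale /=; ring.
have [c /andP[c0 c1]] := MVT_closed ltr01 kd.
have cP : 0 <= c <= 1 by rewrite !ltW.
have k1 : k 1 = F z * expR (- b) by rewrite /k scale1r mulr1 [a + _]addrC subrK.
have k0 : k 0 = 0 by rewrite /k scale0r addr0 Fa mul0r.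
rewrite k1 k0 !subr0 mulr1 => eq1.
have le0 : F z * expR (- b) <= 0.
  rewrite eq1 pmulr_rle0 ?expR_gt0// subr_le0; apply: FB; exact: ray_ball.
apply: le_anti; rewrite F0// andbT.
by move: le0; rewrite pmulr_lle0// expR_gt0.
Qed.

End Rigidity.

(** The factor [1] gives the bound the shape expected by [fin_near_bound], with [G] constant. *)
Lemma near_bound_continuous (R : realType) (T : topologicalType) (h : T -> R) (x : T) :
  {for x, continuous h} -> exists B : R, \forall y \near x, `|h y| <= B * 1.
Proof.
move=> /cvgrPdist_lt/(_ 1 ltr01) hc; exists (`|h x| + 1); apply: filterS hc => y hy.
by rewrite mulr1 addrC -lerBlDr (le_trans (lerB_dist _ _))// distrC ltW.
Qed.

Lemma fin_near_bound (R : realType) (T : topologicalType) (I : finType) (h : I -> T -> R)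
    (G : T -> R) (x : T) : (forall y, 0 <= G y) ->
  (forall i, exists B : R, \forall y \near x, `|h i y| <= B * G y) ->
  exists2 B : R, 0 <= B & \forall y \near x, forall i, `|h i y| <= B * G y.
Proof.
move=> G0 /choice[B hB]; exists (\sum_i `|B i|); first exact: sumr_ge0.
have nB : \forall y \near x, forall i, `|h i y| <= B i * G y by exact: filter_forall.
apply: filterS nB => y yB i; apply: le_trans (yB i) _.
rewrite ler_wpM2r// (le_trans (ler_norm _))// (bigD1 i)//= lerDl.
exact: sumr_ge0.
Qed.

(** * The 1-jet of a Killing field vanishes on an open and closed set *)

Section KillingRigidity.
Context {R : realType} {M : topologicalType} {n : nat} (A : set (chart R M n)).
Hypothesis hM : smooth_manifold A.
Local Notation tvec := ((M -> R) -> R).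
Local Notation vfield := (M -> (M -> R) -> R).
Local Notation distribution := (M -> set ((M -> R) -> R)).
Local Notation form := (M -> ((M -> R) -> R) -> ((M -> R) -> R) -> R).
Implicit Types (x y : M) (u v : tvec) (f h : M -> R) (X Y Z W : vfield).

Variables (H V : distribution) (ip g : form) (k l : nat).
Hypothesis Hs : subbundle A H k.
Hypothesis Vs : subbundle A V l.
Hypothesis sumHV : forall x v, tangent A x v -> exists u w, [/\ H x u, V x w & v = u + w].
Hypothesis capHV : forall x v, H x v -> V x v -> v = 0.
Hypothesis gext : extending_metric A H V ip g.
Hypothesis Hgen : bracket_generating A H.

Let Ht x u : H x u -> tangent A x u. Proof. by have [sub _] := Hs; exact: sub. Qed.
Let Vt x u : V x u -> tangent A x u. Proof. by have [sub _] := Vs; exact: sub. Qed.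

Definition join_frame (X : 'I_k -> vfield) (Y : 'I_l -> vfield) : 'I_(k + l) -> vfield :=
  fun i => match fintype.split i with inl a => X a | inr b => Y b end.

Lemma join_frameP (X : 'I_k -> vfield) (Y : 'I_l -> vfield) (P : vfield -> Prop) : (forall a, P (X a)) -> (forall b, P (Y b)) ->
  forall i, P (join_frame X Y i).
Proof. by move=> PX PY i; rewrite /join_frame; case: fintype.split. Qed.

Lemma join_frame_sum (X : 'I_k -> vfield) (Y : 'I_l -> vfield) y (c : 'I_(k + l) -> R) :
  \sum_i c i *: join_frame X Y i y =
  \sum_a c (lshift l a) *: X a y + \sum_b c (rshift k b) *: Y b y.
Proof.
rewrite big_split_ord; congr (_ + _); apply: eq_bigr => i _; rewrite /join_frame.
  by rewrite (unsplitK (inl _ i)).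
by rewrite (unsplitK (inr _ i)).
Qed.

Lemma tangent_basis (X : 'I_k -> vfield) (Y : 'I_l -> vfield) y : is_basis (H y) (X ^~ y) -> is_basis (V y) (Y ^~ y) ->
  is_basis (tangent A y) ((join_frame X Y) ^~ y).
Proof.
move=> [Xf HE] [Yf VE]; split.
- move=> c; rewrite join_frame_sum; set u := \sum_a _; set w := \sum_b _ => uw.
  have Hu : H y u by rewrite HE; exists (fun a => c (lshift l a)).
  have Vw : V y w by rewrite VE; exists (fun b => c (rshift k b)).
  have uE : u = (-1) *: w by rewrite scaleN1r; apply/eqP; rewrite -addr_eq0 uw.
  have u0 : u = 0 by apply: (capHV Hu); rewrite uE; exact: (subbundleZ _ Vs).
  have w0 : w = 0 by move: uw; rewrite u0 add0r.
  move=> i; case: (split_ordP i) => j ->.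
    exact: (Xf (fun a => c (lshift l a)) u0).
  exact: (Yf (fun b => c (rshift k b)) w0).
- apply/seteqP; split=> [v /sumHV[u [w [Hu Vw ->]]]|v [c ->]].
    move: Hu Vw; rewrite HE VE => -[a ->] [b ->].
    exists (fun i => match fintype.split i with inl j => a j | inr j => b j end).
    rewrite join_frame_sum; congr (_ + _); apply: eq_bigr => j _.
      by rewrite (unsplitK (inl _ j)).
    by rewrite (unsplitK (inr _ j)).
  rewrite join_frame_sum; apply: tangentD.
    by apply: Ht; rewrite HE; exists (fun a => c (lshift l a)).
  by apply: Vt; rewrite VE; exists (fun b => c (rshift k b)).
Qed.

Lemma section_smooth D X : section A D X -> smooth_vf A X. Proof. by case. Qed.

Lemma adapted_frame x : exists (X : 'I_k -> vfield) (Y : 'I_l -> vfield), [/\ forall a, section A H (X a), forall b, section A V (Y b),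
    \forall y \near x, is_basis (H y) (X ^~ y) & \forall y \near x,
    is_basis (tangent A y) ((join_frame X Y) ^~ y)].
Proof.
have [X [Xs Xb _]] := subbundle_basis x Hs.
have [Y [Ys Yb _]] := subbundle_basis x Vs.
exists X, Y; split => //; apply: filterS (filterI Xb Yb) => y [].
exact: tangent_basis.
Qed.

Lemma tangent_subbundle : subbundle A (tangent A) (k + l).
Proof.
split=> [x v //|x]; have [X [Y [Xs Ys _ Tb]]] := adapted_frame x.
exists (join_frame X Y); split=> //.
have TX W : smooth_vf A W -> section A (tangent A) W.
  by move=> Ws; split=> // y; exact: vf_tangent.
move=> i; apply: TX; apply: join_frameP => ?; [exact: section_smooth (Xs _)|exact: section_smooth (Ys _)].
Qed.

Let gip : smooth_inner_product A (tangent A) g. Proof. by case: gext. Qed.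
Let gH x u v : H x u -> H x v -> g x u v = ip x u v. Proof. by case: gext => _ + _; exact. Qed.
Let gHV x u w : H x u -> V x w -> g x u w = 0. Proof. by case: gext => _ _; exact. Qed.
Let gVH x u w : H x u -> V x w -> g x w u = 0.
Proof.
move=> Hu Vw; have [_ sym _ _] := gip.
by rewrite sym ?gHV//; [exact: Vt|exact: Ht].
Qed.

Lemma g_smooth X Y : smooth_vf A X -> smooth_vf A Y -> smooth A (fun x => g x (X x) (Y x)).
Proof.
move=> Xs Ys; have [_ _ _ gs] := gip; apply: gs.
  by split => // y; exact: vf_tangent.
by split => // y; exact: vf_tangent.
Qed.

Lemma g_comb x (c c' : R) u u' w : tangent A x u -> tangent A x u' -> tangent A x w ->
  g x (c *: u + c' *: u') w = c * g x u w + c' * g x u' w.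
Proof.
move=> tu tu' tw; rewrite (ip_combl _ tangent_subbundle gip)//; last exact: tangentZ.
by rewrite (ip_Zl _ tangent_subbundle gip).
Qed.

Lemma g_sum2 x r (c c' : 'I_r -> R) (u u' : 'I_r -> tvec) w :
  (forall i, tangent A x (u i)) -> (forall i, tangent A x (u' i)) -> tangent A x w ->
  g x (\sum_i (c i *: u i + c' i *: u' i)) w = \sum_i (c i * g x (u i) w + c' i * g x (u' i) w).
Proof.
move=> tu tu' tw.
have := @ip_suml _ _ _ A (tangent A) _ g x _ (index_enum 'I_r) (fun=> 1)
  (fun i => c i *: u i + c' i *: u' i) w tangent_subbundle gip tw.
under eq_bigr do rewrite scale1r; move=> ->.
  by apply: eq_bigr => i _; rewrite mul1r g_comb.
by move=> i; apply: tangentD; exact: tangentZ.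
Qed.

Section Killing.
Variable K : vfield.
Hypothesis Kk : killing A H V ip K.

Let Ks : smooth_vf A K. Proof. by case: Kk. Qed.
Let KH X : section A H X -> section A H (bracket K X). Proof. by case: Kk => _ + _ _; exact. Qed.
Let KV X : section A V X -> section A V (bracket K X). Proof. by case: Kk => _ _ + _; exact. Qed.

(* Unlike [ip], [g] can be applied to a bracket of horizontal fields. *)
Lemma killing_g W Y : smooth_vf A W -> section A H Y -> forall x,
  K x (fun y => g y (W y) (Y y)) = g x (bracket K W x) (Y x) + g x (W x) (bracket K Y x).
Proof.
move=> Ws YH x; have [Ys HY] := YH; have [KYs HKY] := KH YH.
have [X [U [Xs Us _ Tb]]] := adapted_frame x.
pose Z := join_frame X U.
have Zs i : smooth_vf A (Z i).
  by apply: join_frameP => ?; [exact: section_smooth (Xs _)|exact: section_smooth (Us _)].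
have ZE i : K x (fun y => g y (Z i y) (Y y)) =
    g x (bracket K (Z i) x) (Y x) + g x (Z i x) (bracket K Y x).
  apply: (@join_frameP X U (fun Z => K x (fun y => g y (Z y) (Y y)) =
    g x (bracket K Z x) (Y x) + g x (Z x) (bracket K Y x))) => [a|b].
    have [_ _ _ /(_ _ _ (Xs a) YH x)] := Kk.
    have [KXs HKX] := KH (Xs a); have [_ HX] := Xs a.
    rewrite !gH//; move=> <-; congr (K x); apply/funext => y.
    by rewrite gH.
  have [_ VU] := Us b; have [_ VKU] := KV (Us b).
  rewrite !gVH// addr0 (_ : (fun y => _) = fun=> 0); first exact: (tan_cst hM _ (vf_tangent x Ks)).
  by apply/funext => y; rewrite gVH.
have [d [f [b [[ds fs] bs dx dE]]]] := frame_dual hM Zs Tb.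
pose c j y := \sum_i b i j y * W y (f i).
have cs j : smooth A (c j).
  by apply: smooth_sum => // i _; apply: smooth_mul => //; exact: vf_smooth.
have dW y : d y *: W y = \sum_j c j y *: Z j y by apply: dE; exact: vf_tangent.
have tK := vf_tangent x Ks.
have tY y := vf_tangent y Ys.
have tW y := vf_tangent y Ws.
have tZ j y := vf_tangent y (Zs j).
have TS := tangent_subbundle.
have e1 := bracket_lincomb hM Ks Ws ds cs Zs dW x.
have e2 := congr1 (fun v => g x v (Y x)) e1.
have tKZ i : tangent A x (bracket K (Z i) x).
  by apply: vf_tangent; exact: smooth_vf_bracket.
have tKW : tangent A x (bracket K W x) by apply: vf_tangent; exact: smooth_vf_bracket.
rewrite /= g_comb// g_sum2// in e2.
have gWs := g_smooth Ws Ys.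
have gZs i := g_smooth (Zs i) Ys.
have dg y u : tangent A y u -> d y * g y (W y) u = \sum_j c j y * g y (Z j y) u.
  by move=> tu; rewrite -(ip_Zl _ TS gip)// dW (ip_suml _ _ TS gip).
have e3 : d x * K x (fun y => g y (W y) (Y y)) + g x (W x) (Y x) * K x d =
    \sum_j (c j x * K x (fun y => g y (Z j y) (Y y)) + g x (Z j x) (Y x) * K x (c j)).
  rewrite -(tan_mul tK ds gWs).
  rewrite (_ : (fun y => _) = fun y => \sum_j c j y * g y (Z j y) (Y y)); last first.
    by apply/funext => y; exact: dg.
  rewrite (tan_sum _ _ tK) => [|//|j _]; last exact: smooth_mul.
  by apply: eq_bigr => j _; exact: (tan_mul tK (cs j) (gZs j)).
have e4 := dg x _ (vf_tangent x KYs).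
apply: (mulfI dx); rewrite mulrDr e4.
apply: (@addIr _ (g x (W x) (Y x) * K x d)); rewrite e3.
transitivity (\sum_j (K x (c j) * g x (Z j x) (Y x) + c j x * g x (bracket K (Z j) x) (Y x))
    + \sum_j c j x * g x (Z j x) (bracket K Y x)).
  by rewrite -big_split; apply: eq_bigr => j _ /=; rewrite ZE; ring.
by rewrite -e2; ring.
Qed.

(** Formed with [g] rather than [ip], since [W] will also be a bracket of horizontal fields. *)
Definition killing_pairing W Y y := g y (bracket K W y) (Y y).
Local Notation w := killing_pairing.

Lemma killing_pairing_smooth W Y : smooth_vf A W -> smooth_vf A Y -> smooth A (w W Y).
Proof. by move=> Ws Ys; apply: g_smooth => //; exact: smooth_vf_bracket. Qed.

(** * The ideal of the 1-jet in a local frame *)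

Section LocalFrame.
Variables (x0 : M) (X : 'I_k -> vfield) (U : 'I_l -> vfield).
Hypothesis Xs : forall a, section A H (X a).
Hypothesis Us : forall b, section A V (U b).
Hypothesis Hb : \forall y \near x0, is_basis (H y) (X ^~ y).
Hypothesis Tb : \forall y \near x0, is_basis (tangent A y) ((join_frame X U) ^~ y).
(** Two expansions of the kind supplied by [frame_dual]: [d], [f], [b] expand every tangent vector
    in the full frame, while [e], [f'], [b'] expand a horizontal one, such as [[K, W]] for [W]
    horizontal, in the fields [X a] alone. *)
Variables (d : M -> R) (f : 'I_(k + l) -> M -> R) (b : 'I_(k + l) -> 'I_(k + l) -> M -> R).
Hypothesis ds : smooth A d.
Hypothesis fs : forall i, smooth A (f i).
Hypothesis bs : forall i j, smooth A (b i j).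
Hypothesis dx : d x0 != 0.
Hypothesis dE : forall y u, tangent A y u ->
  d y *: u = \sum_j (\sum_i b i j y * u (f i)) *: join_frame X U j y.
Variables (e : M -> R) (f' : 'I_k -> M -> R) (b' : 'I_k -> 'I_k -> M -> R).
Hypothesis es : smooth A e.
Hypothesis fs' : forall i, smooth A (f' i).
Hypothesis bs' : forall i j, smooth A (b' i j).
Hypothesis ex : e x0 != 0.
Hypothesis eE : forall y u, H y u ->
  e y *: u = \sum_j (\sum_i b' i j y * u (f' i)) *: X j y.

Local Notation Z := (join_frame X U).
Let TS := tangent_subbundle.
Let tK y : tangent A y (K y). Proof. exact: vf_tangent. Qed.
Let Xv a : smooth_vf A (X a). Proof. exact: section_smooth (Xs a). Qed.
Let XH a y : H y (X a y). Proof. by have [_] := Xs a. Qed.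
Let Zs i : smooth_vf A (Z i).
Proof. by apply: join_frameP => ?; [exact: Xv|exact: section_smooth (Us _)]. Qed.

(** Finitely many functions that carry the horizontal 1-jet of [K] near [x0]: the values on the
    [f i] determine [K], and the pairings with the frame determine each [[K, X a]], which is
    horizontal. *)
Definition killing_jet (i : 'I_(k + l) + 'I_k * 'I_k) : M -> R :=
  match i with
  | inl i => fun y => K y (f i)
  | inr (a, c) => w (X a) (X c)
  end.
Local Notation J := (local_ideal A killing_jet x0).

Lemma killing_jet_smooth i : smooth A (killing_jet i).
Proof.
case: i => [i|[a c]] /=; first exact: vf_smooth.
exact: killing_pairing_smooth.
Qed.
Let ss := killing_jet_smooth.

Lemma ideal_app h : smooth A h -> J (fun y => K y h).
Proof.
move=> hs; apply: (local_ideal_div hM ds dx); first exact: vf_smooth.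
rewrite (_ : (fun y => _) = fun y => \sum_j (\sum_i b i j y * K y (f i)) * Z j y h).
  apply: (local_ideal_sum hM) => j; apply: (local_ideal_mulr hM).
    exact: vf_smooth.
  apply: (local_ideal_sum hM) => i; apply: (local_ideal_mul hM) => //.
  exact: (local_ideal_gen hM _ ss (inl i)).
apply/funext => y; have := congr1 (fun u : tvec => u h) (dE (tK y)).
by rewrite fct_sumE.
Qed.

Lemma pairing_secondE a Y y : section A H Y ->
  e y * w (X a) Y y = \sum_c (\sum_i b' i c y * Y y (f' i)) * w (X a) (X c) y.
Proof.
move=> [Ys HY].
have tKX : tangent A y (bracket K (X a) y) by apply: vf_tangent; exact: smooth_vf_bracket.
rewrite -(ip_Zr _ TS gip)//; last exact: vf_tangent.
rewrite (eE (HY y)) (ip_sumr _ _ TS gip)// => c; exact: vf_tangent.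
Qed.

Lemma pairing_vertical c Y y : section A H Y -> w (U c) Y y = 0.
Proof.
move=> [_ HY]; have [_ VKU] := KV (Us c).
by rewrite /w gVH.
Qed.

Lemma pairing_firstE W Y y : smooth_vf A W -> section A H Y ->
  d y * w W Y y =
  \sum_j (K y (fun z => \sum_i b i j z * W z (f i)) * g y (Z j y) (Y y) +
          (\sum_i b i j y * W y (f i)) * w (Z j) Y y) - K y d * g y (W y) (Y y).
Proof.
move=> Ws [Ys HY].
pose c j z := \sum_i b i j z * W z (f i).
have cs j : smooth A (c j).
  by apply: smooth_sum => // i _; apply: smooth_mul => //; exact: vf_smooth.
have dW z : d z *: W z = \sum_j c j z *: Z j z by apply: dE; exact: vf_tangent.
have tKZ i : tangent A y (bracket K (Z i) y).
  by apply: vf_tangent; exact: smooth_vf_bracket.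
have tKW : tangent A y (bracket K W y) by apply: vf_tangent; exact: smooth_vf_bracket.
have tY := vf_tangent y Ys.
have tW := vf_tangent y Ws.
have tZ j := vf_tangent y (Zs j).
have e1 := bracket_lincomb hM Ks Ws ds cs Zs dW y.
have := congr1 (fun v => g y v (Y y)) e1.
rewrite /= g_comb// g_sum2// => e2.
by rewrite -e2 addrC addKr.
Qed.

Lemma ideal_pairing_X a Y : section A H Y -> J (w (X a) Y).
Proof.
move=> YH; have Ys := section_smooth YH.
apply: (local_ideal_div hM es ex); first exact: killing_pairing_smooth.
rewrite (_ : (fun y => _) = fun y => \sum_c (\sum_i b' i c y * Y y (f' i)) * w (X a) (X c) y).
  apply: (local_ideal_sum hM) => c; apply: (local_ideal_mul hM).
    by apply: smooth_sum => // i _; apply: smooth_mul => //; exact: vf_smooth.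
  exact: (local_ideal_gen hM _ ss (inr (a, c))).
by apply/funext => y; exact: pairing_secondE.
Qed.

(** Expand [W] in the full frame. Derivatives of the coefficients along [K] are in the ideal, and
    the vertical frame fields contribute nothing, since [[K, U c]] is vertical and [Y] horizontal.
    The case aimed at is a bracket [W] of horizontal fields. *)
Lemma ideal_pairing W Y : smooth_vf A W -> section A H Y -> J (w W Y).
Proof.
move=> Ws YH; have Ys := section_smooth YH.
have cs j : smooth A (fun z => \sum_i b i j z * W z (f i)).
  by apply: smooth_sum => // i _; apply: smooth_mul => //; exact: vf_smooth.
apply: (local_ideal_div hM ds dx); first exact: killing_pairing_smooth.
rewrite (_ : (fun y => _) = fun y =>
  \sum_j (K y (fun z => \sum_i b i j z * W z (f i)) * g y (Z j y) (Y y) +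
          (\sum_i b i j y * W y (f i)) * w (Z j) Y y) - K y d * g y (W y) (Y y)).
  apply: (local_ideal_sub hM); last first.
    apply: (local_ideal_mulr hM); [exact: g_smooth|exact: ideal_app].
  apply: (local_ideal_sum hM) => j; apply: (local_ideal_add hM).
    by apply: (local_ideal_mulr hM); [exact: g_smooth|exact: ideal_app].
  apply: (local_ideal_mul hM) => //.
  apply: (@join_frameP X U (fun Z => J (w Z Y))) => [a|c]; first exact: ideal_pairing_X.
  congr local_ideal : (local_ideal0 hM killing_jet x0).
  by apply/funext => y; rewrite pairing_vertical.
by apply/funext => y; exact: pairing_firstE.
Qed.

Let gram y : 'M[R]_k := \matrix_(a, c) g y (X a y) (X c y).

Let gram_smooth a c : smooth A (fun y => gram y a c).
Proof. by congr smooth : (g_smooth (Xv a) (Xv c)); apply/funext => y; rewrite mxE. Qed.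

Lemma gram_det : \det (gram x0) != 0.
Proof.
apply/negP => /det0P[v vN0 vg].
have [Xf _] := nbhs_singleton Hb.
have [_ _ pos _] := gip.
move/eqP: vN0; apply; apply/rowP => a; rewrite mxE.
apply: (Xf (fun a => v ord0 a)).
apply: contrapT => /eqP uN0; set u := (X in X != 0) in uN0.
have tX c : tangent A x0 (X c x0) by exact: vf_tangent.
have tu : tangent A x0 u by apply: tangent_sum => c _; exact: tangentZ.
have := pos _ _ tu uN0; rewrite {2}/u (ip_sumr _ _ TS gip)// big1 ?ltxx// => c _.
rewrite /u (ip_suml _ _ TS gip)//.
have := congr1 (fun r : 'rV_k => r ord0 c) vg; rewrite !mxE => eq0.
rewrite (_ : \sum_i _ = 0) ?mulr0// -[RHS]eq0.
by apply: eq_bigr => i _; rewrite mxE.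
Qed.

Let C W j y := \sum_i b' i j y * bracket K W y (f' i).

Let C_smooth W j : smooth_vf A W -> smooth A (C W j).
Proof.
move=> Ws; apply: smooth_sum => // i _; apply: smooth_mul => //.
by apply: vf_smooth => //; exact: smooth_vf_bracket.
Qed.

(** Up to the factor [e], the pairings of [[K, W]] with the frame are its coefficients times the
    Gram matrix. This matrix is invertible at [x0], and its adjugate recovers the coefficients. *)
Lemma ideal_coef W j : section A H W -> J (C W j).
Proof.
move=> WH; have Ws := section_smooth WH; have [_ HKW] := KH WH.
apply: (local_ideal_div hM (smooth_det hM gram_smooth) gram_det); first exact: C_smooth.
rewrite (_ : (fun y => _) = fun y => \sum_c e y * w W (X c) y * (\adj (gram y)) c j).
  apply: (local_ideal_sum hM) => c; apply: (local_ideal_mulr hM).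
    exact: smooth_adj.
  by apply: (local_ideal_mul hM) => //; exact: ideal_pairing.
apply/funext => y.
pose Cv := \row_j C W j y.
have ew c : e y * w W (X c) y = (Cv *m gram y) ord0 c.
  have tKW := Ht (HKW y).
  rewrite -(ip_Zl _ TS gip)//; last exact: vf_tangent.
  rewrite (eE (HKW y)) (ip_suml _ _ TS gip)//; last 2 first.
  - exact: vf_tangent.
  - by move=> i; exact: vf_tangent.
  by rewrite mxE; apply: eq_bigr => i _; rewrite !mxE.
transitivity ((Cv *m gram y *m \adj (gram y)) ord0 j).
  by rewrite -mulmxA mul_mx_adj mul_mx_scalar !mxE.
by rewrite mxE; apply: eq_bigr => c _; rewrite ew.
Qed.

Lemma ideal_bracket_app W h : section A H W -> smooth A h -> J (fun y => bracket K W y h).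
Proof.
move=> WH hs; have Ws := section_smooth WH; have [KWs HKW] := KH WH.
apply: (local_ideal_div hM es ex); first exact: vf_smooth.
rewrite (_ : (fun y => _) = fun y => \sum_j C W j y * X j y h).
  apply: (local_ideal_sum hM) => j; apply: (local_ideal_mulr hM).
    exact: vf_smooth.
  exact: ideal_coef.
apply/funext => y; have := congr1 (fun u : tvec => u h) (eE (HKW y)).
by rewrite fct_sumE.
Qed.

(** Expand [e [K, Y] = sum_j C_j X_j] with [C_j] in the ideal. Both terms contain the derivatives
    [W C_j], about which nothing is known yet; they cancel in the difference, and everything left
    has some [C_j] as a factor. *)
Lemma ideal_bracket_pairing W Y Y' : section A H W -> section A H Y -> section A H Y' ->
  J (fun y => g y (bracket W (bracket K Y) y) (Y' y) - W y (w Y Y')).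
Proof.
move=> WH YH YH'; have Ws := section_smooth WH; have Ys := section_smooth YH.
have Ys' := section_smooth YH'.
have [KYs HKY] := KH YH.
have wYs := killing_pairing_smooth Ys Ys'.
have Cs j := C_smooth j Ys.
have gXs j := g_smooth (Xv j) Ys'.
have WKs := smooth_vf_bracket hM Ws KYs.
have WXs j := smooth_vf_bracket hM Ws (Xv j).
apply: (local_ideal_div hM es ex).
  by apply: smooth_sub => //; [exact: g_smooth|exact: vf_smooth].
rewrite (_ : (fun y => _) = fun y => \sum_j C Y j y *
    (g y (bracket W (X j) y) (Y' y) - W y (fun z => g z (X j z) (Y' z)))).
  apply: (local_ideal_sum hM) => j; apply: (local_ideal_mulr hM).
    by apply: smooth_sub => //; [exact: g_smooth|exact: vf_smooth].
  exact: ideal_coef.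
apply/funext => y.
have tW := vf_tangent y Ws.
have tY' := vf_tangent y Ys'.
have eK z : e z *: bracket K Y z = \sum_j C Y j z *: X j z by exact: eE.
have e1 := bracket_lincomb hM Ws KYs es Cs Xv eK y.
have := congr1 (fun v => g y v (Y' y)) e1.
rewrite /= g_comb//; [|exact: vf_tangent|exact: vf_tangent].
rewrite g_sum2//; [|by move=> i; exact: vf_tangent|by move=> i; exact: vf_tangent].
move=> e2.
have e3 : e y * W y (w Y Y') + w Y Y' y * W y e =
    \sum_j (C Y j y * W y (fun z => g z (X j z) (Y' z)) + g y (X j y) (Y' y) * W y (C Y j)).
  rewrite -(tan_mul tW es wYs).
  rewrite (_ : (fun z => _) = fun z => \sum_j C Y j z * g z (X j z) (Y' z)); last first.
    apply/funext => z; rewrite -(ip_Zl _ TS gip); [|exact: vf_tangent|exact: vf_tangent].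
    rewrite eK (ip_suml _ _ TS gip)//; first exact: vf_tangent.
    by move=> j; exact: vf_tangent.
  rewrite (tan_sum _ _ tW) => [|//|j _]; last exact: smooth_mul.
  by apply: eq_bigr => j _; exact: (tan_mul tW (Cs j) (gXs j)).
transitivity ((W y e * g y (bracket K Y y) (Y' y) + e y * g y (bracket W (bracket K Y) y) (Y' y))
   - (e y * W y (w Y Y') + w Y Y' y * W y e)).
  by rewrite /w; ring.
rewrite e2 e3 -sumrB; apply: eq_bigr => j _; ring.
Qed.

(* [t W Y Y' = W (w Y Y')] is, modulo the ideal, symmetric in [W], [Y] and
   antisymmetric in [Y], [Y'], hence zero. *)
Lemma ideal_derive_pairing W Y Y' : section A H W -> section A H Y -> section A H Y' ->
  J (fun y => W y (w Y Y')).
Proof.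
move: W Y Y'.
have tsym W Y Y' : section A H W -> section A H Y -> section A H Y' ->
    J (fun y => W y (w Y Y') - Y y (w W Y')).
  move=> WH YH YH'; have Ws := section_smooth WH; have Ys := section_smooth YH.
  have Ys' := section_smooth YH'.
  have KWs := smooth_vf_bracket hM Ks Ws.
  have KYs := smooth_vf_bracket hM Ks Ys.
  have WYs := smooth_vf_bracket hM Ws Ys.
  have J1 := ideal_bracket_pairing WH YH YH'.
  have J2 := ideal_bracket_pairing YH WH YH'.
  have J3 := ideal_pairing WYs YH'.
  have := local_ideal_add hM (local_ideal_sub hM J2 J1) J3; congr local_ideal.
  apply/funext => y; rewrite /w (jacobi hM Ks Ws Ys) [bracket (bracket K W) Y]bracketC.
  have t1 : tangent A y (bracket Y (bracket K W) y).
    by apply: vf_tangent; exact: smooth_vf_bracket.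
  have t2 : tangent A y (bracket W (bracket K Y) y).
    by apply: vf_tangent; exact: smooth_vf_bracket.
  have -> : (- bracket Y (bracket K W) + bracket W (bracket K Y)) y =
    (-1) *: bracket Y (bracket K W) y + 1 *: bracket W (bracket K Y) y.
    by rewrite scaleN1r scale1r.
  rewrite g_comb//; last exact: vf_tangent.
  by rewrite -/(w W Y') -/(w Y Y'); ring.
have tanti W Y Y' : section A H W -> section A H Y -> section A H Y' ->
    J (fun y => W y (w Y Y') + W y (w Y' Y)).
  move=> WH YH YH'; have Ws := section_smooth WH; have Ys := section_smooth YH.
  have Ys' := section_smooth YH'.
  have gYs := g_smooth Ys Ys'.
  have J1 := ideal_app (vf_smooth Ws gYs).
  have J2 := ideal_bracket_app WH gYs.
  have := local_ideal_sub hM J1 J2; congr local_ideal.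
  apply/funext => y.
  have -> : bracket K W y (fun z => g z (Y z) (Y' z)) =
    K y (fun z => W z (fun z => g z (Y z) (Y' z))) - W y (fun z => K z (fun z => g z (Y z) (Y' z))).
    by [].
  rewrite opprB addrC subrK -(tan_add (vf_tangent y Ws)); [|exact: killing_pairing_smooth..].
  congr (W y); apply/funext => z; rewrite (killing_g Ys YH') /w; congr (_ + _).
  have [_ sym _ _] := gip; apply: sym; apply: vf_tangent => //.
  exact: smooth_vf_bracket.
move=> W Y Y' WH YH YH'.
have J1 := tsym W Y Y' WH YH YH'.
have J2 := tanti Y W Y' YH WH YH'.
have J3 := tsym Y Y' W YH YH' WH.
have J4 := tanti Y' Y W YH' YH WH.
have J5 := tsym Y' W Y YH' WH YH.
have J6 := tanti W Y' Y WH YH' YH.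
have := local_ideal_mul hM (smooth_cst hM (2^-1))
  (local_ideal_add hM (local_ideal_add hM (local_ideal_sub hM (local_ideal_sub hM
  (local_ideal_add hM J1 J2) J3) J4) J5) J6).
by congr local_ideal; apply/funext => y; field.
Qed.

(** On the generators [K f_i], the identity [W (K f_i) = K (W f_i) - [K, W] f_i] has both terms on
    the right in the ideal. *)
Lemma ideal_derive_section W h : section A H W -> J h -> J (fun y => W y h).
Proof.
move=> WH Jh; have Ws := section_smooth WH.
apply: (local_ideal_derive hM ss Ws) => // -[i|[a c]] /=; last exact: ideal_derive_pairing.
have := local_ideal_sub hM (ideal_app (vf_smooth Ws (fs i))) (ideal_bracket_app WH (fs i)).
congr local_ideal; apply/funext => y; rewrite /bracket /app; ring.
Qed.

Lemma lie_generated_smooth W : lie_generated A H W -> smooth_vf A W.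
Proof. by elim=> [Y /section_smooth//|Y Y' _ Ys _ Ys']; exact: smooth_vf_bracket. Qed.

Lemma ideal_derive_lie W h : lie_generated A H W -> J h -> J (fun y => W y h).
Proof.
move=> LW; elim: LW h => [Y YH h|Y Y' LY IHY LY' IHY' h Jh]; first exact: ideal_derive_section.
by apply: (local_ideal_sub hM); [apply: IHY; exact: IHY'|apply: IHY'; exact: IHY].
Qed.

(** Bracket generation gives the frame vectors as combinations of iterated brackets at [x0] only.
    Kept constant, the coefficients define fields [P i] that agree with the frame at [x0] and
    preserve the ideal. The matrix [q] of the [P i] in the frame is [d x0] times the identity at
    [x0], so its adjugate expresses the frame by the [P i] around that point. *)
Lemma ideal_derive_frame j h : J h -> J (fun y => Z j y h).
Proof.
move=> Jh; have hs := local_ideal_smooth Jh.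
have PH i : exists P : vfield, [/\ smooth_vf A P, P x0 = Z i x0 & J (fun y => P y h)].
  have [m [c [v [vS Zv]]]] := Hgen (vf_tangent x0 (Zs i)).
  have vS' a : exists P : vfield, lie_generated A H P /\ P x0 = v a.
    by have [P ? <-] := vS a; exists P.
  have [L LP] := choice vS'.
  exists (fun y => \sum_a c a *: L a y); split.
  - apply: (smooth_vf_lincomb hM) => a; first exact: smooth_cst.
    by apply: lie_generated_smooth; have [] := LP a.
  - by rewrite Zv; apply: eq_bigr => a _; have [_ ->] := LP a.
  - rewrite (_ : (fun y => _) = fun y => \sum_a c a * L a y h).
      apply: (local_ideal_sum hM) => a; apply: (local_ideal_mul hM); first exact: smooth_cst.
      by apply: ideal_derive_lie => //; have [] := LP a.
    by apply/funext => y; rewrite fct_sumE.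
have [P PP] := choice PH.
have Ps i : smooth_vf A (P i) by have [] := PP i.
pose q y : 'M[R]_(k + l) := \matrix_(i, m) \sum_a b a m y * P i y (f a).
have qs i m : smooth A (fun y => q y i m).
  have : smooth A (fun y => \sum_a b a m y * P i y (f a)).
    by apply: smooth_sum => // a _; apply: smooth_mul => //; exact: vf_smooth.
  by congr smooth; apply/funext => y; rewrite mxE.
have qx : q x0 = (d x0)%:M.
  apply/matrixP => i m; rewrite !mxE.
  have [Zf _] := nbhs_singleton Tb.
  have [_ Pi _] := PP i.
  apply: (lin_indep_inj (c := fun m => \sum_a b a m x0 * P i x0 (f a))
    (c' := fun m => d x0 *+ (i == m)) Zf).
  rewrite -(dE (vf_tangent x0 (Ps i))) Pi (bigD1 i)//= eqxx mulr1n big1 ?addr0// => a /negPf.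
  by rewrite eq_sym => ->; rewrite mulr0n scale0r.
have detq : \det (q x0) != 0 by rewrite qx det_scalar expf_neq0.
apply: (local_ideal_div hM (smooth_det hM qs) detq); first exact: vf_smooth.
rewrite (_ : (fun y => _) = fun y => \sum_i (\adj (q y)) j i * (d y * P i y h)).
  apply: (local_ideal_sum hM) => i; apply: (local_ideal_mul hM); first exact: smooth_adj.
  by apply: (local_ideal_mul hM) => //; have [] := PP i.
apply/funext => y.
pose Zc := \col_m Z m y h.
have dP i : d y * P i y h = (q y *m Zc) i ord0.
  have := congr1 (fun u : tvec => u h) (dE (vf_tangent y (Ps i))).
  rewrite fct_sumE mxE => E; rewrite -[LHS]/((d y *: P i y) h) E.
  by apply: eq_bigr => m _; rewrite !mxE.
transitivity ((\adj (q y) *m (q y *m Zc)) j ord0).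
  by rewrite mulmxA mul_adj_mx mul_scalar_mx !mxE.
by rewrite mxE; apply: eq_bigr => i _; rewrite dP.
Qed.

Hypothesis jet0 : forall i, killing_jet i x0 = 0.

(** [S] is the bound delivered by [local_ideal_bound]; the sum of squares [Q] is its smooth
    substitute, to which Gronwall's inequality applies. *)
Let S y := \sum_i `|killing_jet i y|.
Let Q y := \sum_i killing_jet i y * killing_jet i y.

Let Q_smooth : smooth A Q.
Proof. by apply: smooth_sum => // i _; exact: smooth_mul. Qed.

Let S_ge0 y : 0 <= S y. Proof. exact: sumr_ge0. Qed.

Let Q_ge0 y : 0 <= Q y. Proof. by apply: sumr_ge0 => i _; rewrite -expr2 sqr_ge0. Qed.

Let SQ y : S y * S y <= #|{: 'I_(k + l) + 'I_k * 'I_k}|%:R * Q y.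
Proof.
rewrite /S mulr_suml.
have -> : #|{: 'I_(k + l) + 'I_k * 'I_k}|%:R * Q y = \sum_i \sum_j
    (killing_jet i y * killing_jet i y + killing_jet j y * killing_jet j y) / 2.
  have e1 : \sum_i \sum_(j : 'I_(k + l) + 'I_k * 'I_k) killing_jet i y * killing_jet i y =
      #|{: 'I_(k + l) + 'I_k * 'I_k}|%:R * Q y.
    by rewrite /Q mulr_sumr; apply: eq_bigr => i _; rewrite sumr_const mulr_natl.
  transitivity (\sum_i (\sum_(j : 'I_(k + l) + 'I_k * 'I_k) killing_jet i y * killing_jet i y +
      \sum_j killing_jet j y * killing_jet j y) / 2).
    rewrite -mulr_suml big_split /= e1 exchange_big /= e1; by field.
  by apply: eq_bigr => i _; rewrite -mulr_suml big_split.
apply: ler_sum => i _; rewrite mulr_sumr; apply: ler_sum => j _.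
rewrite -!expr2 -(real_normK (num_real (killing_jet i y))).
rewrite -(real_normK (num_real (killing_jet j y))).
rewrite -subr_ge0.
rewrite (_ : _ - _ = (`|killing_jet i y| - `|killing_jet j y|) ^+ 2 / 2); last by field.
by rewrite divr_ge0// sqr_ge0.
Qed.

(** The frame derivatives of [Q] are bounded by a multiple of [S^2], hence of [Q]. A direction in a
    chart is a combination of the frame with locally bounded coefficients, so [Q] read in the chart
    satisfies the hypothesis of [gronwall_rV]. *)
Lemma killing_jet_near0 : \forall y \near x0, forall i, killing_jet i y = 0.
Proof.
have [B B0 nB] : exists2 B : R, 0 <= B & \forall y \near x0,
    forall ji : 'I_(k + l) * ('I_(k + l) + 'I_k * 'I_k),
      `|Z ji.1 y (killing_jet ji.2)| <= B * S y.
  apply: fin_near_bound => // -[j i] /=; apply: (local_ideal_bound hM).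
  apply: ideal_derive_frame; exact: (local_ideal_gen hM).
have cd : {for x0, continuous d} by exact: (smooth_continuous hM ds).
have [E E0 nE] : exists2 E : R, 0 <= E & \forall y \near x0,
    forall ij : 'I_(k + l) * 'I_(k + l), `|b ij.1 ij.2 y / d y| <= E * 1.
  apply: fin_near_bound => // -[i j] /=; apply: near_bound_continuous.
  apply: continuousM; first exact: (smooth_continuous hM (bs i j)).
  exact: continuousV.
have nd : \forall y \near x0, d y != 0.
  by apply: (cd [set t : R | t != 0]); apply: open_nbhs_nbhs; split => //; exact: open_neq.
have [c Ac cx] := chart_cover hM x0; set a := coord c x0.
pose D i m := 'D_(delta_mx ord0 m) (fun z => f i (coord_inv c z)).
have fc i : smooth_on (coord c @` cdom c) (fun z => f i (coord_inv c z)) by exact: fs.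
have ca : (coord c @` cdom c) a by exists x0.
have oc : open (coord c @` cdom c) by exact: (chart_image_open hM Ac).
have [G G0 nG] : exists2 G : R, 0 <= G & \forall z \near a,
    forall im : 'I_(k + l) * 'I_n, `|D im.1 im.2 z| <= G * 1.
  apply: fin_near_bound => // -[i m] /=; apply: near_bound_continuous.
  apply: differentiable_continuous.
  exact: (smooth_on_differentiable (smooth_on_derive (delta_mx ord0 m) (fc i))).
have cinv : {for a, continuous (coord_inv c)} by exact: (chart_inv_continuous hM Ac cx).
have pull (P : M -> Prop) : (\forall y \near x0, P y) -> \forall z \near a, P (coord_inv c z).
  by move=> nP; apply: cinv; rewrite (chartK hM).
have /nbhs_ballP[r /= r0 rb] : \forall z \near a, [/\ (coord c @` cdom c) z,
    forall im : 'I_(k + l) * 'I_n, `|D im.1 im.2 z| <= G * 1,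
    forall ji : 'I_(k + l) * ('I_(k + l) + 'I_k * 'I_k),
      `|Z ji.1 (coord_inv c z) (killing_jet ji.2)| <= B * S (coord_inv c z),
    forall ij : 'I_(k + l) * 'I_(k + l),
      `|b ij.1 ij.2 (coord_inv c z) / d (coord_inv c z)| <= E * 1 &
    d (coord_inv c z) != 0].
  have n1 : nbhs a (coord c @` cdom c) by exact: open_nbhs_nbhs.
  apply: filterS (filterI n1 (filterI nG (filterI (pull _ nB) (filterI (pull _ nE) (pull _ nd))))).
  by move=> z [? [? [? [? ?]]]].
pose N : R := #|{: 'I_(k + l) + 'I_k * 'I_k}|%:R.
pose kl : R := (k + l)%:R.
have F0 : Q (coord_inv c a) = 0.
  by rewrite (chartK hM)// /Q big1// => i _; rewrite jet0 mulr0.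
(* In the constant, each [kl] counts a sum over [k + l] indices, [E] bounds [b / d], [n G |v'|]
   bounds the derivatives of the [f i] along [v'], and [(B + B) N Q] bounds those of [Q] along the
   frame. *)
have QB z (v' : 'rV[R]_n) : ball a r z -> 'D_v' (fun z => Q (coord_inv c z)) z <=
    (kl * (kl * (E * (n%:R * G))) * ((B + B) * N)) * `|v'| * Q (coord_inv c z).
  move=> /rb[[y cy <-]]; rewrite (chartK hM)// => DG sB bE dy.
  set z' := coord c y in DG *.
  have tu := tangent_chart_dir hM v' Ac cy; set u := chart_dir _ _ _ _ in tu.
  rewrite -(chart_dirE c y v' Q_smooth) -/u.
  have uE : u Q = \sum_j (\sum_i b i j y / d y * u (f i)) * Z j y Q.
    apply: (mulfI dy); have := congr1 (fun u : tvec => u Q) (dE tu).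
    rewrite fct_sumE => E1; rewrite -[LHS]/((d y *: u) Q) E1 mulr_sumr.
    apply: eq_bigr => j _; rewrite mulrA; congr (_ * _).
    rewrite mulr_sumr; apply: eq_bigr => i _.
    by rewrite !mulrA [d y * _]mulrC mulfK.
  have uf i : `|u (f i)| <= n%:R * G * `|v'|.
    rewrite /u chart_dirE// (derive_coord v' (smooth_chart_differentiable Ac cy (fs i))).
    rewrite (le_trans (ler_norm_sum _ _ _))//.
    rewrite (@le_trans _ _ (\sum_(m < n) G * `|v'|))//.
      apply: ler_sum => m _; rewrite normrM mulrC; apply: ler_pM => //.
        by have := DG (i, m); rewrite mulr1.
      exact: rV_coord_le.
    by rewrite sumr_const card_ord -[(G * `|v'|) *+ n]mulr_natl mulrA.
  have ZQ j : `|Z j y Q| <= (B + B) * N * Q y.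
    rewrite (tan_sum _ _ (vf_tangent y (Zs j))) => [|//|i _]; last exact: smooth_mul.
    rewrite (le_trans (ler_norm_sum _ _ _))//.
    rewrite (@le_trans _ _ (\sum_i (B + B) * S y * `|killing_jet i y|))//.
      apply: ler_sum => i _.
      rewrite (tan_mul (vf_tangent y (Zs j)) (ss i) (ss i)) -mulrDr normrM mulrC.
      rewrite ler_wpM2r// (le_trans (ler_normD _ _))// mulrDl.
      by apply: lerD; exact: (sB (j, i)).
    by rewrite -mulr_sumr -!mulrA ler_wpM2l ?addr_ge0//; exact: SQ.
  rewrite (le_trans (ler_norm _))// uE (le_trans (ler_norm_sum _ _ _))//.
  rewrite (@le_trans _ _ (\sum_(j < k + l) (kl * (E * (n%:R * G * `|v'|))) * ((B + B) * N * Q y)))//.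
    apply: ler_sum => j _; rewrite normrM; apply: ler_pM => //.
    rewrite (le_trans (ler_norm_sum _ _ _))//.
    rewrite (@le_trans _ _ (\sum_(i < k + l) E * (n%:R * G * `|v'|)))//.
      apply: ler_sum => i _; rewrite normrM; apply: ler_pM => //.
      by have := bE (i, j); rewrite mulr1.
    by rewrite sumr_const card_ord -[(E * _) *+ _]mulr_natl.
  by rewrite sumr_const card_ord -[(_ * _) *+ _]mulr_natl -/kl le_eqVlt; apply/orP; left; apply/eqP; ring.
have Q0 : forall z, ball a r z -> Q (coord_inv c z) = 0.
  apply: (gronwall_rV _ _ F0 QB) => //.
  by apply: smooth_on_sub (Q_smooth Ac) => z /rb[].
have nb : nbhs a (ball a r) by exact: nbhsx_ballx.
apply: filterS (chart_nbhs hM Ac cx nb) => y [cy /= yb] i.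
have := Q0 _ yb; rewrite (chartK hM)// => /eqP.
rewrite psumr_eq0 => [/allP/(_ i)|j _]; last by rewrite -expr2 sqr_ge0.
by rewrite mem_index_enum mulf_eq0 orbb => /(_ isT)/eqP.
Qed.

Lemma killing_vanish_near : \forall y \near x0, K y = 0 /\
  forall W Y, section A H W -> section A H Y -> w W Y y = 0.
Proof.
have cd : {for x0, continuous d} by exact: (smooth_continuous hM ds).
have ce : {for x0, continuous e} by exact: (smooth_continuous hM es).
have nd : \forall y \near x0, d y != 0.
  by apply: (cd [set t : R | t != 0]); apply: open_nbhs_nbhs; split => //; exact: open_neq.
have ne : \forall y \near x0, e y != 0.
  by apply: (ce [set t : R | t != 0]); apply: open_nbhs_nbhs; split => //; exact: open_neq.
apply: filterS3 killing_jet_near0 nd ne => y sy dy ey.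
have K0 : K y = 0.
  rewrite -[K y](scalerK dy) (dE (tK y)) big1 ?scaler0// => j _.
  rewrite big1 ?scale0r// => i _.
  by have := sy (inl i); rewrite /= => ->; rewrite mulr0.
split=> // W Y WH YH; apply: (mulfI dy).
have E0 h : (0 : tvec) h = 0 by [].
rewrite (pairing_firstE _ (section_smooth WH) YH) K0 !E0 mul0r subr0 mulr0 big1// => j _.
rewrite E0 mul0r add0r.
rewrite (_ : w (Z j) Y y = 0) ?mulr0//.
apply: (@join_frameP X U (fun Z => w Z Y y = 0)) => [a|c]; last exact: pairing_vertical.
apply: (mulfI ey); rewrite pairing_secondE// mulr0 big1// => c _.
by have := sy (inr (a, c)); rewrite /= => ->; rewrite mulr0.
Qed.


End LocalFrame.

Theorem killing_rigidity p : connected [set: M] -> K p = 0 ->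
  (forall W, section A H W -> bracket K W p = 0) -> K = 0.
Proof.
move=> conn Kp KWp.
(* Testing against all horizontal sections, rather than a frame, makes the set independent of the
   base point. The conditions are zeros of continuous functions, so the set is closed. *)
pose B : set M := [set y | K y = 0 /\
  forall W Y, section A H W -> section A H Y -> w W Y y = 0].
have Bp : B p.
  split=> // W Y WH YH; rewrite /w KWp//.
  have := @ip_Zl _ _ _ A (tangent A) _ g p 0 0 (Y p) tangent_subbundle gip (tangent0 A p).
  by rewrite scale0r mul0r; apply; exact: (vf_tangent p (section_smooth YH)).
have oB : open B.
  rewrite openE => x [Kx wx].
  have [X [U [Xs Us Hb Tb]]] := adapted_frame x.
  have Xv a : smooth_vf A (X a) by exact: section_smooth (Xs a).
  have Zs i : smooth_vf A (join_frame X U i).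
    by apply: join_frameP => ?; [exact: Xv|exact: section_smooth (Us _)].
  have [d [f [b [[ds fs] bs dx dE]]]] := frame_dual hM Zs Tb.
  have [e [f' [b' [[es fs'] bs' ex eE]]]] := frame_dual hM Xv Hb.
  apply: (killing_vanish_near Xs Us Hb Tb ds fs bs dx dE es fs' bs' ex eE).
  move=> [i|[a c]] /=; last exact: wx.
  by rewrite Kx.
have cB : closed B.
  have zero_closed h x : smooth A h -> closure B x -> (forall y, B y -> h y = 0) -> h x = 0.
    move=> hs Bx h0; apply: contrapT => /eqP hx.
    have hc : {for x, continuous h} by exact: (smooth_continuous hM hs).
    have nh : nbhs x [set y | h y != 0].
      by apply: (hc [set t : R | t != 0]); apply: open_nbhs_nbhs; split => //; exact: open_neq.
    have [y [By /= hy]] := Bx _ nh.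
    by move: hy; rewrite (h0 y By) eqxx.
  move=> x Bx; split.
    apply: (tangent_ext (vf_tangent x Ks) (tangent0 A x)) => h hs.
    apply: (zero_closed (fun y => K y h)) => //; first exact: vf_smooth.
    by move=> y [-> _].
  move=> W Y WH YH; apply: (zero_closed (w W Y)) => //.
    exact: (killing_pairing_smooth (section_smooth WH) (section_smooth YH)).
  by move=> y [_ wy]; exact: wy.
have BT : B = setT.
  apply: conn; first by exists p.
  - by exists B => //; rewrite setTI.
  - by exists B => //; rewrite setTI.
apply/funext => x.
by have [] : B x by rewrite BT.
Qed.

End Killing.
End KillingRigidity.

(** * The isotropy representation and torsion *)

Lemma sum_block (V : nmodType) m (p_ : 'I_m -> nat) (F : 'I_(\sum_i p_ i) -> V) (i : 'I_m) :
  (forall s, tagnat.sig1 s != i -> F s = 0) ->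
  \sum_s F s = \sum_(a < p_ i) F (tagnat.Rank i a).
Proof.
move=> F0; rewrite (reindex _ tagnat.rank_bij_on) /=.
transitivity (\sum_(i : 'I_m) \sum_(a < p_ i) F (tagnat.Rank i a)).
  rewrite (sig_big_dep (fun _ => true) (fun _ _ => true) (fun i (a : 'I_(p_ i)) => F (tagnat.Rank i a))) /=.
  by apply: eq_bigr => s _; rewrite tagnat.rankE.
rewrite (bigD1 i)//= [X in _ + X]big1 ?addr0// => j ji.
by rewrite big1// => a _; rewrite F0// tagnat.Rank1K.
Qed.

(** The third hypothesis says that [B] commutes with the diagonal matrix of the [lam i]. These being
    distinct for distinct blocks, the off-diagonal blocks of [B] vanish, and commutation with [T]
    can be read block by block. *)
Lemma skew_block_commutantP (R : realType) (W : lmodType R) m (p_ : 'I_m -> nat)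
    (lam : 'I_m -> R) (T : 'M[W]_(\sum_i p_ i)) (B : 'M[R]_(\sum_i p_ i)) :
  injective lam -> (forall a b, B a b + B b a = 0) ->
  (forall a b, B a b * (lam (tagnat.sig1 a) - lam (tagnat.sig1 b)) = 0) ->
  mulmx_sv B T = mulmx_vs T B -> skew_block_commutant T B.
Proof.
move=> lam_inj skew diag comm.
have B0 a b : tagnat.sig1 a != tagnat.sig1 b -> B a b = 0.
  move=> ab; apply/eqP; have /eqP := diag a b; rewrite mulf_eq0 subr_eq0 => /orP[//|/eqP].
  by move=> /lam_inj/eqP; rewrite (negPf ab).
exists (fun i => submxblock B i i); split.
- apply/mxblockP => i j; rewrite /mxdiag mxblockK; case: eqVneq => [<-|ij].
    by rewrite conform_mx_id.
  by apply/matrixP => a b; rewrite !mxE B0// !tagnat.Rank1K.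
- move=> i; apply/matrixP => a b; rewrite !mxE.
  by apply/eqP; rewrite -addr_eq0 skew.
- move=> i j; apply/matrixP => a b; rewrite !mxE.
  have /matrixP/(_ (tagnat.Rank i a) (tagnat.Rank j b)) := comm.
  rewrite !mxE (sum_block (i := i)) => [|s si]; last first.
    by rewrite B0 ?scale0r// tagnat.Rank1K eq_sym.
  rewrite (sum_block (i := j)) => [E|s sj]; last first.
    by rewrite B0 ?scale0r// tagnat.Rank1K.
  transitivity (\sum_(c < p_ i) B (tagnat.Rank i a) (tagnat.Rank i c) *: T (tagnat.Rank i c) (tagnat.Rank j b)).
    by apply: eq_bigr => c _; rewrite !mxE.
  by rewrite E; apply: eq_bigr => c _; rewrite !mxE.
Qed.

Section Isotropy.
Context {R : realType} {M : topologicalType} {n : nat} (A : set (chart R M n)).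
Hypothesis hM : smooth_manifold A.
Local Notation tvec := ((M -> R) -> R).
Local Notation vfield := (M -> (M -> R) -> R).
Local Notation distribution := (M -> set ((M -> R) -> R)).
Local Notation form := (M -> ((M -> R) -> R) -> ((M -> R) -> R) -> R).
Implicit Types (x y : M) (u v : tvec) (f h : M -> R) (X Y Z W K : vfield).

(** Infinitesimal conditions satisfied by the elements of [K_bullet]. They are linear in [K], so
    they pass to linear combinations without any flow having to be produced. *)
Definition isotropy (H V : distribution) (ip : form) (p : M) K : Prop :=
  [/\ killing A H V ip K, K p = 0 &
      forall T, smooth_vf A T -> V1 A H V p (T p) -> bracket K T p = 0].

(** For the conditions at [p]: [f (phi t p)] and the value of [T p] on [f] composed with [phi t] are
    constant in [t], and their derivatives at zero are [K_p f] and [T_p (K f) = - [K, T]_p f]. *)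
Lemma K_bullet_isotropy (H V : distribution) (ip : form) (p : M) k l K :
  subbundle A H k -> subbundle A V l -> smooth_inner_product A H ip ->
  K_bullet A H V ip p K -> isotropy H V ip p K.
Proof.
move=> Hs Vs Hip [Ks [phi [Gphi KE]]].
have [phiG phi0 _ _] := Gphi.
have phim t : smooth_map A (phi t) by have [[[+ _] _ _ _] _ _] := phiG t.
have phiH t y u : H y u -> H (phi t y) (pushforward (phi t) u).
  by move=> Hu; have [[_ HE _ _] _ _] := phiG t; rewrite -HE; exists u.
have phiV t y u : V y u -> V (phi t y) (pushforward (phi t) u).
  by move=> Vu; have [[_ _ _ VE] _ _] := phiG t; rewrite -VE; exists u.
have isom t y u v : H y u -> H y v ->
    ip (phi t y) (pushforward (phi t) u) (pushforward (phi t) v) = ip y u v.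
  by have [[_ _ + _] _ _] := phiG t; exact.
have phip t : phi t p = p by have [_ + _] := phiG t.
have Kp : K p = 0.
  apply: (tangent_ext (vf_tangent p Ks) (tangent0 A p)) => f fs.
  apply: (is_derive_const (h := fun t => f (phi t p)) (a := f p)).
    by move=> t; rewrite phip.
  exact: (flow_point_derive hM Gphi KE p fs).
split=> //.
- split=> // [X XH|X XV|X Y XH YH x].
  + exact: (flow_preserves hM Gphi phim KE Ks Hs phiH XH).
  + exact: (flow_preserves hM Gphi phim KE Ks Vs phiV XV).
  + exact: (flow_metric hM Gphi phim KE Ks Hs Hip phiH isom XH YH).
- move=> T Ts V1T.
  apply: (tangent_ext (vf_tangent p (smooth_vf_bracket hM Ks Ts)) (tangent0 A p)) => f fs.
  have E0 h : (0 : tvec) h = 0 by [].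
  rewrite /bracket Kp !E0 sub0r.
  rewrite (_ : T p (app K f) = 0) ?oppr0//.
  apply: (is_derive_const (h := fun t => T p (fun y => f (phi t y))) (a := T p f)).
    by move=> t; have [_ _ /(_ _ V1T) E] := phiG t; rewrite -[RHS](congr1 (fun v : tvec => v f) E).
  exact: (flow_derive hM Gphi phim KE (vf_smooth Ks fs) (vf_tangent p Ts) fs).
Qed.

Lemma bracket_sumr k X (c : 'I_k -> R) (Y : 'I_k -> vfield) x :
  smooth_vf A X -> (forall i, smooth_vf A (Y i)) ->
  bracket X (fun y => \sum_i c i *: Y i y) x = \sum_i c i *: bracket X (Y i) x.
Proof.
move=> Xs Ys.
have cs i : smooth A (fun=> c i) by exact: smooth_cst.
have Ss := smooth_vf_lincomb hM (index_enum 'I_k) cs Ys.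
have s1 := smooth_cst hM 1.
have := bracket_lincomb hM Xs Ss s1 cs Ys (fun y => scale1r _) x.
rewrite (tan_cst hM _ (vf_tangent x Xs)) scale0r add0r scale1r => ->.
by apply: eq_bigr => i _; rewrite (tan_cst hM _ (vf_tangent x Xs)) scale0r add0r.
Qed.

Lemma bracket_suml k X (c : 'I_k -> R) (Y : 'I_k -> vfield) x :
  smooth_vf A X -> (forall i, smooth_vf A (Y i)) ->
  bracket (fun y => \sum_i c i *: Y i y) X x = \sum_i c i *: bracket (Y i) X x.
Proof.
move=> Xs Ys; rewrite bracketC -[LHS]/(- (bracket X _ x)) bracket_sumr// -sumrN.
by apply: eq_bigr => i _; rewrite -scalerN [in RHS]bracketC.
Qed.

Lemma section_sum D r k (c : 'I_k -> R) (Y : 'I_k -> vfield) : subbundle A D r ->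
  (forall i, section A D (Y i)) -> section A D (fun y => \sum_i c i *: Y i y).
Proof.
move=> Ds YD; split.
  apply: smooth_vf_lincomb => // i; first exact: smooth_cst.
  by have [] := YD i.
move=> x; apply: (subbundle_sum _ Ds) => i; apply: (subbundleZ _ Ds).
by have [_] := YD i.
Qed.

Lemma isotropy_sum (H V : distribution) (ip : form) (p : M) r l k (c : 'I_k -> R)
    (K : 'I_k -> vfield) : subbundle A H r -> subbundle A V l ->
  smooth_inner_product A H ip -> (forall i, isotropy H V ip p (K i)) ->
  isotropy H V ip p (fun y => \sum_i c i *: K i y).
Proof.
move=> Hs Vs Hip Ki.
have Ks i : smooth_vf A (K i) by have [[]] := Ki i.
have Ss : smooth_vf A (fun y => \sum_i c i *: K i y).
  by apply: smooth_vf_lincomb => // i; exact: smooth_cst.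
have BE X : smooth_vf A X -> bracket (fun y => \sum_i c i *: K i y) X =
    (fun y => \sum_i c i *: bracket (K i) X y).
  by move=> Xs; apply/funext => y; exact: bracket_suml.
split.
- split=> // [X XH|X XV|X Y XH YH x].
  + rewrite BE; last by case: XH.
    by apply: (section_sum _ Hs) => i; have [[_ KH _ _] _ _] := Ki i; exact: KH.
  + rewrite BE; last by case: XV.
    by apply: (section_sum _ Vs) => i; have [[_ _ KV _] _ _] := Ki i; exact: KV.
  + have [Xs HX] := XH; have [Ys HY] := YH.
    rewrite !BE// (ip_suml _ _ Hs Hip)//; last first.
      by move=> i; have [[_ KH _ _] _ _] := Ki i; have [_] := KH _ XH.
    rewrite (ip_sumr _ _ Hs Hip)//; last first.
      by move=> i; have [[_ KH _ _] _ _] := Ki i; have [_] := KH _ YH.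
    rewrite -big_split fct_sumE; apply: eq_bigr => i _ /=.
    have [[_ _ _ /(_ _ _ XH YH x) E] _ _] := Ki i.
    by rewrite -[LHS]/(c i * _) E mulrDr.
- by rewrite big1// => i _; have [_ -> _] := Ki i; rewrite scaler0.
- move=> T Ts V1T; rewrite BE// big1// => i _.
  by have [_ _ ->] := Ki i; rewrite // scaler0.
Qed.

Lemma section_extend D r x u : subbundle A D r -> D x u ->
  exists2 X, section A D X & X x = u.
Proof.
move=> Ds; have [X [Xs _ [_ ->]]] := subbundle_basis x Ds => -[c ->].
by exists (fun y => \sum_i c i *: X i y) => //; exact: (section_sum _ Ds).
Qed.

End Isotropy.

(** * Tensoriality of the torsion *)

Section Torsion.
Context {R : realType} {M : topologicalType} {n : nat} (A : set (chart R M n)).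
Hypothesis hM : smooth_manifold A.
Local Notation tvec := ((M -> R) -> R).
Local Notation vfield := (M -> (M -> R) -> R).
Local Notation distribution := (M -> set ((M -> R) -> R)).
Local Notation form := (M -> ((M -> R) -> R) -> ((M -> R) -> R) -> R).
Implicit Types (x y : M) (u v : tvec) (f h : M -> R) (X Y Z W K : vfield).

Lemma bracket_scaler f X Y : smooth A f -> smooth_vf A X -> smooth_vf A Y ->
  bracket Y (scale_vf f X) = scale_vf (app Y f) X + scale_vf f (bracket Y X).
Proof.
move=> fs Xs Ys; apply/funext => x.
have s1 := smooth_cst hM 1.
have := bracket_lincomb hM (r := [:: tt]) (c := fun=> f) (Z := fun=> X)
  Ys (smooth_vf_scale hM fs Xs) s1 (fun=> fs) (fun=> Xs) _ x.
rewrite !big_seq1 (tan_cst hM _ (vf_tangent x Ys)) scale0r add0r scale1r; apply.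
by move=> y; rewrite big_seq1 scale1r.
Qed.

Variable nab : vfield -> vfield -> vfield.
Hypothesis conn : is_connection A nab.

Let nabs X Y : smooth_vf A X -> smooth_vf A Y -> smooth_vf A (nab X Y).
Proof. exact: (nab_smooth conn). Qed.

Lemma torsion_smooth X Y : smooth_vf A X -> smooth_vf A Y -> smooth_vf A (torsion nab X Y).
Proof.
move=> Xs Ys; apply: (smooth_vf_sub hM); first by apply: (smooth_vf_sub hM); exact: nabs.
exact: smooth_vf_bracket.
Qed.

Lemma torsionC X Y : torsion nab X Y = - torsion nab Y X.
Proof. by rewrite /torsion [bracket X Y]bracketC opprK !opprB addrC. Qed.

(** The term [(Y f) X] from the Leibniz rule of [nab Y] cancels against the one produced by the
    bracket. *)
Lemma torsion_linl f X X' Y : smooth A f -> smooth_vf A X -> smooth_vf A X' ->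
  smooth_vf A Y ->
  torsion nab (scale_vf f X + X') Y = scale_vf f (torsion nab X Y) + torsion nab X' Y.
Proof.
move=> fs Xs Xs' Ys; have fXs := smooth_vf_scale hM fs Xs.
have fXXs := smooth_vf_add hM fXs Xs'.
rewrite /torsion (nab_linl conn)// (nab_addr conn)// (nab_leibniz conn)//.
rewrite bracketC (bracket_addr hM Ys fXs Xs') (bracket_scaler fs Xs Ys).
rewrite [bracket X Y]bracketC [bracket X' Y]bracketC.
apply/funext => x; apply/funext => h.
have E (Y1 Y2 : vfield) : (Y1 + Y2) x h = Y1 x h + Y2 x h by [].
have EN (Y1 : vfield) : (- Y1) x h = - Y1 x h by [].
have ES k (Y1 : vfield) : scale_vf k Y1 x h = k x * Y1 x h by [].
by rewrite !(E, EN, ES); ring.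
Qed.

Lemma torsion0l Y : smooth_vf A Y -> torsion nab 0 Y = 0.
Proof.
move=> Ys; have z := smooth_vf0 hM.
have := torsion_linl (smooth_cst hM 1) z z Ys.
have S1 X : scale_vf (fun=> 1) X = X by apply/funext => x; rewrite /scale_vf scale1r.
by rewrite !S1 addr0 => /eqP; rewrite -subr_eq0 opprD addNKr oppr_eq0 => /eqP.
Qed.

Lemma torsion_suml I (r : seq I) (c : I -> M -> R) (Z : I -> vfield) Y x :
  (forall i, smooth A (c i)) -> (forall i, smooth_vf A (Z i)) -> smooth_vf A Y ->
  torsion nab (fun y => \sum_(i <- r) c i y *: Z i y) Y x =
  \sum_(i <- r) c i x *: torsion nab (Z i) Y x.
Proof.
move=> cs Zs Ys; elim: r => [|i r IH].
  rewrite big_nil (_ : (fun y => _) = 0); first by rewrite torsion0l.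
  by apply/funext => y; rewrite big_nil.
rewrite big_cons -IH (_ : (fun y => _) =
  scale_vf (c i) (Z i) + (fun y => \sum_(j <- r) c j y *: Z j y)); last first.
  by apply/funext => y; rewrite big_cons.
by rewrite torsion_linl//; exact: (smooth_vf_lincomb hM).
Qed.

Lemma torsionZl d X Y x : smooth A d -> smooth_vf A X -> smooth_vf A Y ->
  torsion nab (scale_vf d X) Y x = d x *: torsion nab X Y x.
Proof.
move=> ds Xs Ys.
have := torsion_linl ds Xs (smooth_vf0 hM) Ys.
by rewrite addr0 torsion0l// addr0 => ->.
Qed.

Variable r : nat.
Hypothesis TS : subbundle A (tangent A) r.

(** Multiply by [d] and expand [W] in a frame with globally smooth coefficients. These vanish at [x]
    together with [W], and linearity over functions concludes. *)
Lemma torsion_eq0 W Y x : smooth_vf A W -> smooth_vf A Y -> W x = 0 ->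
  torsion nab W Y x = 0.
Proof.
move=> Ws Ys W0.
have [Z [Zs Zb _]] := subbundle_basis x TS.
have Zv i : smooth_vf A (Z i) by have [] := Zs i.
have [d [f [b [[ds fs] bs dx dE]]]] := frame_dual hM Zv Zb.
pose c j y := \sum_i b i j y * W y (f i).
have cs j : smooth A (c j).
  by apply: (smooth_sum hM) => i _; apply: (smooth_mul hM) => //; exact: vf_smooth.
apply: (scalerI dx); rewrite scaler0 -torsionZl//.
rewrite (_ : scale_vf d W = fun y => \sum_j c j y *: Z j y); last first.
  by apply/funext => y; apply: dE; exact: vf_tangent.
rewrite torsion_suml// big1// => j _.
rewrite /c big1 ?scale0r// => i _.
by rewrite W0 -[0 (f i)]/(0 : R) mulr0.
Qed.

Lemma torsion_local X X' Y Y' x : smooth_vf A X -> smooth_vf A X' ->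
  smooth_vf A Y -> smooth_vf A Y' -> X x = X' x -> Y x = Y' x ->
  torsion nab X Y x = torsion nab X' Y' x.
Proof.
have left (X1 X2 Y1 : vfield) : smooth_vf A X1 -> smooth_vf A X2 -> smooth_vf A Y1 ->
    X1 x = X2 x -> torsion nab X1 Y1 x = torsion nab X2 Y1 x.
  move=> X1s X2s Y1s X12.
  have E := torsion_linl (smooth_cst hM (-1)) X2s X1s Y1s.
  have S1 (W : vfield) : scale_vf (fun=> -1) W = - W.
    by apply/funext => y; rewrite /scale_vf scaleN1r.
  have Ds := smooth_vf_sub hM X1s X2s.
  have T0 : torsion nab (X1 - X2) Y1 x = 0.
    by apply: torsion_eq0 => //; rewrite -[LHS]/(X1 x - X2 x) X12 subrr.
  have EE : X1 - X2 = scale_vf (fun=> -1) X2 + X1 by rewrite S1 addrC.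
  rewrite EE E S1 in T0.
  by apply/eqP; rewrite -subr_eq0 addrC; apply/eqP.
move=> Xs Xs' Ys Ys' XX' YY'; rewrite (left X X' Y)// torsionC.
by rewrite -[LHS]/(- torsion nab Y X' x) (left Y Y' X')// [in RHS]torsionC.
Qed.

Lemma torsion_atE X Y x : smooth_vf A X -> smooth_vf A Y ->
  torsion_at A nab x (X x) (Y x) = torsion nab X Y x.
Proof.
move=> Xs Ys.
have ext Z : smooth_vf A Z -> smooth_vf A (Defs.extend A x (Z x)) /\ Defs.extend A x (Z x) x = Z x.
  by move=> Zs; apply: (@xgetPex _ 0 [set W : vfield | smooth_vf A W /\ W x = Z x]); exists Z.
have [Xs' XE] := ext X Xs; have [Ys' YE] := ext Y Ys.
exact: torsion_local.
Qed.

End Torsion.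

(** * Invariance of the torsion under isotropy fields *)

Section IsotropyTorsion.
Context {R : realType} {M : topologicalType} {n : nat} (A : set (chart R M n)).
Hypothesis hM : smooth_manifold A.
Local Notation tvec := ((M -> R) -> R).
Local Notation vfield := (M -> (M -> R) -> R).
Local Notation distribution := (M -> set ((M -> R) -> R)).
Local Notation form := (M -> ((M -> R) -> R) -> ((M -> R) -> R) -> R).
Implicit Types (x y : M) (u v : tvec) (f h : M -> R) (X Y Z W : vfield).

Variables (H V : distribution) (ip g : form) (k l : nat).
Hypothesis Hs : subbundle A H k.
Hypothesis Vs : subbundle A V l.
Hypothesis sumHV : forall x v, tangent A x v -> exists u w, [/\ H x u, V x w & v = u + w].
Hypothesis capHV : forall x v, H x v -> V x v -> v = 0.
Hypothesis gext : extending_metric A H V ip g.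
Variable nab : vfield -> vfield -> vfield.
Hypothesis can : canonical_connection A H V g nab.
Variables (p : M) (K : vfield).
Hypothesis Kiso : isotropy A H V ip p K.

Let conn : is_connection A nab := canonical_is_connection can.
Let TS := tangent_subbundle Hs Vs sumHV capHV.
Let gip : smooth_inner_product A (tangent A) g. Proof. by case: gext. Qed.
Let gHV x u w : H x u -> V x w -> g x u w = 0. Proof. by case: gext => _ _; exact. Qed.
Let Ht x u : H x u -> tangent A x u. Proof. by have [sub _] := Hs; exact: sub. Qed.
Let Vt x u : V x u -> tangent A x u. Proof. by have [sub _] := Vs; exact: sub. Qed.
Let gsym x u v : tangent A x u -> tangent A x v -> g x u v = g x v u.
Proof. by have [_ sym _ _] := gip; exact: sym. Qed.
Let Kk : killing A H V ip K. Proof. by case: Kiso. Qed.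
Let Kp : K p = 0. Proof. by case: Kiso. Qed.
Let KT T : smooth_vf A T -> V1 A H V p (T p) -> bracket K T p = 0.
Proof. by case: Kiso => _ _; exact. Qed.
Let Ks : smooth_vf A K. Proof. by case: Kk. Qed.
Let KH X : section A H X -> section A H (bracket K X).
Proof. by case: Kk => _ KH' _ _; exact: KH'. Qed.
Let KV X : section A V X -> section A V (bracket K X).
Proof. by case: Kk => _ _ KV' _; exact: KV'. Qed.

Let gB x u v w : tangent A x u -> tangent A x v -> tangent A x w ->
  g x (u - v) w = g x u w - g x v w.
Proof.
move=> tu tv tw; have := g_comb Hs Vs sumHV capHV gext 1 (-1) tu tv tw.
by rewrite scale1r scaleN1r mul1r mulN1r.
Qed.

Let gD x u v w : tangent A x u -> tangent A x v -> tangent A x w ->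
  g x (u + v) w = g x u w + g x v w.
Proof.
move=> tu tv tw; have := g_comb Hs Vs sumHV capHV gext 1 1 tu tv tw.
by rewrite !scale1r !mul1r.
Qed.

Lemma horizontal_torsion_section X Y : section A H X -> section A H Y ->
  section A V (torsion nab X Y).
Proof.
move=> XH YH; split; last by move=> x; exact: (torsion_HH can).
by apply: (torsion_smooth hM conn); [case: XH|case: YH].
Qed.

(** The two covariant derivatives are horizontal, so the torsion is a horizontal vector minus a
    bracket of horizontal fields. This is what allows the isotropy condition on [V^1_p] to be
    applied to it. *)
Lemma horizontal_torsion_V1 X Y : section A H X -> section A H Y ->
  V1 A H V p (torsion nab X Y p).
Proof.
move=> XH YH; split; last exact: (torsion_HH can).
have [Xs HX] := XH; have [Ys HY] := YH.
have [_ N1] := canonical_parallelH can Xs YH.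
have [_ N2] := canonical_parallelH can Ys XH.
exists 2%N, (fun i => if i == ord0 then 1 else -1),
  (fun i => if i == ord0 then nab X Y p - nab Y X p else bracket X Y p).
split.
- move=> i; case: ifP => _; first by left; exact: (subbundleB Hs).
  by right; exists X, Y.
- by rewrite big_ord_recl big_ord1 /= scale1r scaleN1r.
Qed.

(** Write [Tor(X, Y) = N - [X, Y]] with [N] horizontal. Since [Tor(X, Y)_p] is in [V^1_p],
    [[K, Tor(X, Y)]] vanishes at [p], and by the Jacobi identity the brackets occurring in the
    asserted sum add up to [[K, N]_p], which is horizontal. The sum is then horizontal as well as
    vertical, hence zero. *)
Lemma isotropy_torsion X Y : section A H X -> section A H Y ->
  torsion nab (bracket K X) Y p + torsion nab X (bracket K Y) p = 0.
Proof.
move=> XH YH; have [Xs HX] := XH; have [Ys HY] := YH.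
have X'H := KH XH; have Y'H := KH YH.
have [X's _] := X'H; have [Y's _] := Y'H.
have TV := horizontal_torsion_section XH YH.
have [_ VT1] := horizontal_torsion_section X'H YH.
have [_ VT2] := horizontal_torsion_section XH Y'H.
have N1 := canonical_parallelH can Xs YH; have N2 := canonical_parallelH can Ys XH.
have N3 := canonical_parallelH can X's YH; have N4 := canonical_parallelH can Ys X'H.
have N5 := canonical_parallelH can Xs Y'H; have N6 := canonical_parallelH can Y's XH.
pose N := nab X Y - nab Y X.
have NH : section A H N.
  move: N1 N2 => [N1s HN1] [N2s HN2]; split; first exact: (smooth_vf_sub hM).
  by move=> x; exact: (subbundleB Hs).
have [_ HKN] := KH NH.
have [_ VKT] := KV TV.
have KT0 := KT (section_smooth TV) (horizontal_torsion_V1 XH YH).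
have E : bracket K (torsion nab X Y) =
    bracket K N - (bracket (bracket K X) Y + bracket X (bracket K Y)).
  have [Ns _] := NH.
  have XYs := smooth_vf_bracket hM Xs Ys.
  rewrite -(jacobi hM Ks Xs Ys) /torsion -/N.
  have DNs := smooth_vf_sub hM Ns XYs.
  by have := bracket_addr hM Ks DNs XYs; rewrite subrK => ->; rewrite addrK.
move/(congr1 (fun Z : vfield => Z p)): E; rewrite KT0.
rewrite -[RHS]/(bracket K N p - (bracket (bracket K X) Y p + bracket X (bracket K Y) p)) => E.
have T1 : torsion nab (bracket K X) Y p = nab (bracket K X) Y p - nab Y (bracket K X) p
   - bracket (bracket K X) Y p by [].
have T2 : torsion nab X (bracket K Y) p = nab X (bracket K Y) p - nab (bracket K Y) X p
   - bracket X (bracket K Y) p by [].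
apply: (@capHV p); last exact: (subbundleD Vs).
rewrite (_ : _ + _ = (nab (bracket K X) Y p - nab Y (bracket K X) p) +
  (nab X (bracket K Y) p - nab (bracket K Y) X p) - bracket K N p); last first.
  have -> : bracket K N p = bracket (bracket K X) Y p + bracket X (bracket K Y) p.
    by apply/eqP; rewrite -subr_eq0 -E.
  rewrite T1 T2; move: (bracket (bracket K X) Y p) (bracket X (bracket K Y) p) => b1 b2.
  by rewrite opprD [LHS]addrACA.
have [_ h3] := N3; have [_ h4] := N4; have [_ h5] := N5; have [_ h6] := N6.
apply: (subbundleB Hs) => //; apply: (subbundleD Hs); exact: (subbundleB Hs).
Qed.

(* [2 g(Tor(U, X), Y) = U g(X, Y) - g([U, X], Y) - g(X, [U, Y])] for [U] vertical
   and [X], [Y] horizontal; the right-hand side is natural under the flow of [K]. *)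
Lemma vertical_torsion_metric U X Y x : section A V U -> section A H X -> section A H Y ->
  g x (torsion nab U X x) (Y x) + g x (torsion nab U X x) (Y x) =
  U x (fun y => g y (X y) (Y y)) - g x (bracket U X x) (Y x) - g x (bracket U Y x) (X x).
Proof.
move=> UV XH YH; have [Us VU] := UV; have [Xs HX] := XH; have [Ys HY] := YH.
have half W W' : section A H W -> section A H W' ->
    g x (torsion nab U W x) (W' x) = g x (nab U W x) (W' x) - g x (bracket U W x) (W' x).
  move=> WH WH'; have [Ws HW] := WH; have [Ws' HW'] := WH'.
  have [nVs nV] := canonical_parallelV can Ws UV.
  have [nHs nH] := canonical_parallelH can Us WH.
  have Bs := smooth_vf_bracket hM Us Ws.
  have z : g x (nab W U x) (W' x) = 0.
    by rewrite gsym ?gHV//; [exact: Vt|exact: Ht].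
  have t1 := vf_tangent x nHs; have t2 := vf_tangent x nVs.
  have t3 := vf_tangent x Bs; have tW' := vf_tangent x Ws'.
  rewrite -[torsion nab U W x]/(nab U W x - nab W U x - bracket U W x).
  by rewrite (gB (tangentB t1 t2) t3 tW') (gB t1 t2 tW') z subr0.
rewrite {2}(torsion_symH can XH YH UV x) (half _ _ XH YH) (half _ _ YH XH).
rewrite (canonical_metric can Us Xs Ys x).
have [nHs nH] := canonical_parallelH can Us YH.
rewrite [g x (X x) (nab U Y x)]gsym; [ring|exact: vf_tangent|exact: vf_tangent].
Qed.

Lemma double_add_eq0 (a b : R) : 0 = 0 + 0 + (a + a) + (b + b) -> a + b = 0.
Proof. lra. Qed.

(** Apply [K], which is zero at [p], to the right-hand side [tau] of [vertical_torsion_metric]. It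
    obeys a Leibniz rule in [U], [X], [Y] ([Ktau]), and the term with [[K, U]] drops out because
    [[K, U]_p = 0] and the torsion is tensorial. As [X |-> [K, X]_p] is skew, the result says that
    it commutes with [T^0_U]. *)
Lemma isotropy_T0 U X Y : section A V U -> V1 A H V p (U p) ->
  section A H X -> section A H Y ->
  g p (torsion nab U (bracket K X) p) (Y p) +
  g p (torsion nab U X p) (bracket K Y p) = 0.
Proof.
move=> UV V1U XH YH.
have [Us VU] := UV; have [Xs HX] := XH; have [Ys HY] := YH.
have U'V := KV UV; have X'H := KH XH; have Y'H := KH YH.
have [U's _] := U'V; have [X's _] := X'H; have [Y's _] := Y'H.
have tK := vf_tangent p Ks.
pose tau := fun (U X Y : vfield) x =>
  U x (fun y => g y (X y) (Y y)) - g x (bracket U X x) (Y x) - g x (bracket U Y x) (X x).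
have gs W W' : smooth_vf A W -> smooth_vf A W' -> smooth A (fun y => g y (W y) (W' y)).
  exact: (g_smooth gext).
have Kg W W' : smooth_vf A W -> section A H W' -> forall x,
    K x (fun y => g y (W y) (W' y)) =
    g x (bracket K W x) (W' x) + g x (W x) (bracket K W' x).
  exact: (killing_g hM Hs Vs sumHV capHV gext Kk).
have UXs := smooth_vf_bracket hM Us Xs; have UYs := smooth_vf_bracket hM Us Ys.
have U0 : bracket K U p = 0 by exact: KT.
have Ktau : K p (tau U X Y) = tau (bracket K U) X Y p + tau U (bracket K X) Y p +
    tau U X (bracket K Y) p.
  rewrite /tau.
  have s1 := vf_smooth Us (gs _ _ Xs Ys).
  have s2 := gs _ _ UXs Ys; have s3 := gs _ _ UYs Xs.
  rewrite (tan_sub hM tK (smooth_sub hM s1 s2) s3) (tan_sub hM tK s1 s2).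
  rewrite (Kg _ _ UXs YH) (Kg _ _ UYs XH) (jacobi hM Ks Us Xs) (jacobi hM Ks Us Ys).
  have gDf W W' Z : smooth_vf A W -> smooth_vf A W' -> smooth_vf A Z ->
      g p ((W + W') p) (Z p) = g p (W p) (Z p) + g p (W' p) (Z p).
    by move=> Ws Ws' Zs; apply: gD; exact: vf_tangent.
  have b1 := smooth_vf_bracket hM U's Xs; have b2 := smooth_vf_bracket hM Us X's.
  have b3 := smooth_vf_bracket hM U's Ys; have b4 := smooth_vf_bracket hM Us Y's.
  rewrite (gDf _ _ _ b1 b2 Ys) (gDf _ _ _ b3 b4 Xs).
  have -> : K p (fun y => U y (fun z => g z (X z) (Y z))) =
    bracket K U p (fun y => g y (X y) (Y y)) + U p (fun y => K y (fun z => g z (X z) (Y z))).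
    by rewrite /bracket /app subrK.
  rewrite (_ : (fun y => K y (fun z => g z (X z) (Y z))) =
    fun y => g y (bracket K X y) (Y y) + g y (X y) (bracket K Y y)); last first.
    by apply/funext => y; exact: Kg.
  rewrite (tan_add (vf_tangent p Us)); [|exact: gs|exact: gs].
  ring.
have tauE W X1 Y1 : section A V W -> section A H X1 -> section A H Y1 ->
    tau W X1 Y1 p = g p (torsion nab W X1 p) (Y1 p) + g p (torsion nab W X1 p) (Y1 p).
  by move=> WV X1H Y1H; rewrite vertical_torsion_metric.
have T0 : torsion nab (bracket K U) X p = 0 by exact: (torsion_eq0 hM conn TS).
have g0 u : tangent A p u -> g p 0 u = 0.
  move=> tu; have := ip_Zl 0 TS gip (tangent0 A p) tu.
  by rewrite scale0r mul0r.
have := Ktau; rewrite Kp !tauE// T0 !g0; last exact: vf_tangent.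
rewrite -[LHS]/(0 : R) => E.
exact: double_add_eq0 E.
Qed.

End IsotropyTorsion.

(** * The matrix of an isotropy field *)

Section IsotropyMatrix.
Context {R : realType} {M : topologicalType} {n : nat} (A : set (chart R M n)).
Hypothesis hM : smooth_manifold A.
Local Notation tvec := ((M -> R) -> R).
Local Notation vfield := (M -> (M -> R) -> R).
Local Notation distribution := (M -> set ((M -> R) -> R)).
Local Notation form := (M -> ((M -> R) -> R) -> ((M -> R) -> R) -> R).
Implicit Types (x y : M) (u v : tvec) (f h : M -> R) (X Y Z W K : vfield).

Variables (H V : distribution) (ip g : form) (k l : nat).
Hypothesis Hs : subbundle A H k.
Hypothesis Vs : subbundle A V l.
Hypothesis sumHV : forall x v, tangent A x v -> exists u w, [/\ H x u, V x w & v = u + w].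
Hypothesis capHV : forall x v, H x v -> V x v -> v = 0.
Hypothesis Hip : smooth_inner_product A H ip.
Hypothesis gext : extending_metric A H V ip g.
Variable nab : vfield -> vfield -> vfield.
Hypothesis can : canonical_connection A H V g nab.
Variable p : M.

Lemma projH_eq u v : H p u -> V p (v - u) -> projH H V p v = u.
Proof.
move=> Hu Vu.
have [Hq Vq] : [set u | H p u /\ V p (v - u)] (projH H V p v).
  by apply: (@xgetPex _ 0 [set u | H p u /\ V p (v - u)]); exists u.
apply/eqP; rewrite -subr_eq0; apply/eqP; apply: (@capHV p); first exact: (subbundleB Hs).
have -> : projH H V p v - u = (v - u) - (v - projH H V p v).
  by rewrite opprB addrCA addrAC subrr add0r addrC.
exact: (subbundleB Vs).
Qed.

Lemma g_projH u v : H p u -> tangent A p v -> g p v u = ip p (projH H V p v) u.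
Proof.
move=> Hu tv; have [u1 [w [Hu1 Vw E]]] := sumHV tv.
have -> : projH H V p v = u1 by apply: projH_eq => //; rewrite E addrAC subrr add0r.
have [gip gH gHV] := gext; have [_ sym _ _] := gip.
have Ht := Hs.1 p; have Vt := Vs.1 p.
have := g_comb Hs Vs sumHV capHV gext 1 1 (Ht _ Hu1) (Vt _ Vw) (Ht _ Hu).
rewrite !scale1r !mul1r -E => ->.
by rewrite gH// [g p w u]sym ?gHV ?addr0//; [exact: Vt|exact: Ht].
Qed.

Variables (N : nat) (e : 'I_N -> tvec) (E : 'I_N -> vfield).
Hypothesis eb : is_basis (H p) e.
Hypothesis eo : forall a b, ip p (e a) (e b) = (a == b)%:R.
Hypothesis EH : forall a, section A H (E a).
Hypothesis Ep : forall a, E a p = e a.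

Let He a : H p (e a). Proof. by rewrite -Ep; have [_] := EH a. Qed.
Let Es a : smooth_vf A (E a). Proof. by have [] := EH a. Qed.
Let TS := tangent_subbundle Hs Vs sumHV capHV.

(** Column [c] holds the coordinates of [[K, E c]_p]; when [K] comes from a flow fixing [p], this is
    minus the derivative at time zero of the linearised flow applied to [e c]. *)
Definition isotropy_mx K : 'M[R]_N := \matrix_(a, c) ip p (bracket K (E c) p) (e a).

Lemma orthonormal_expand u : H p u -> u = \sum_a ip p u (e a) *: e a.
Proof.
move=> Hu; have [_ HE] := eb; have := Hu; rewrite HE => -[c uE].
rewrite {1}uE; apply: eq_bigr => a _; congr (_ *: _).
rewrite uE (ip_suml _ _ Hs Hip)// (bigD1 a)//= eo eqxx mulr1 big1 ?addr0// => b /negPf ba.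
by rewrite eo ba mulr0.
Qed.

Section OneField.
Variable K : vfield.
Hypothesis Kiso : isotropy A H V ip p K.

Let Kk : killing A H V ip K. Proof. by case: Kiso. Qed.
Let Kp : K p = 0. Proof. by case: Kiso. Qed.
Let KHE a : H p (bracket K (E a) p).
Proof. by have [_ KH _ _] := Kk; have [_] := KH _ (EH a). Qed.
Let KEs a : smooth_vf A (bracket K (E a)).
Proof. by have [_ KH _ _] := Kk; have [] := KH _ (EH a). Qed.

Lemma isotropy_mxE c : bracket K (E c) p = \sum_a isotropy_mx K a c *: e a.
Proof. by rewrite {1}[bracket _ _ _]orthonormal_expand//; apply: eq_bigr => a _; rewrite mxE. Qed.

Lemma isotropy_mx_skew a b : isotropy_mx K a b + isotropy_mx K b a = 0.
Proof.
rewrite !mxE; have [_ _ _ /(_ _ _ (EH b) (EH a) p)] := Kk.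
rewrite Kp !Ep -[LHS]/(0 : R) => ->; congr (_ + _).
by have [_ sym _ _] := Hip; rewrite sym.
Qed.

Lemma torsion_isotropy_mx a Y : smooth_vf A Y ->
  torsion nab (bracket K (E a)) Y p =
  \sum_c isotropy_mx K c a *: torsion nab (E c) Y p.
Proof.
move=> Ys.
have conn := canonical_is_connection can.
have cs (c : 'I_N) : smooth A (fun=> isotropy_mx K c a) by exact: smooth_cst.
rewrite -(torsion_suml hM conn (index_enum 'I_N) p cs Es Ys).
apply: (torsion_local hM conn TS) => //; first exact: smooth_vf_lincomb.
by rewrite isotropy_mxE; apply: eq_bigr => c _; rewrite Ep.
Qed.

(** On the basis, [isotropy_torsion] reads [B^T T + T B = 0]; skewness of [B] turns this into
    [B T = T B]. *)
Lemma isotropy_mx_torsion :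
  mulmx_sv (isotropy_mx K) (torsion_matrix A nab p e) =
  mulmx_vs (torsion_matrix A nab p e) (isotropy_mx K).
Proof.
have conn := canonical_is_connection can.
have TE a b : torsion_at A nab p (e a) (e b) = torsion nab (E a) (E b) p.
  by rewrite -!Ep; exact: (torsion_atE hM conn TS).
have skew a b : isotropy_mx K a b = - isotropy_mx K b a.
  by apply/eqP; rewrite -addr_eq0 isotropy_mx_skew.
apply/matrixP => a b; rewrite [LHS]mxE [RHS]mxE.
have := isotropy_torsion hM Hs Vs capHV can Kiso (EH a) (EH b).
rewrite [torsion nab (E a) _]torsionC -[(- _) p]/(- torsion nab (bracket K (E b)) (E a) p).
rewrite !torsion_isotropy_mx// => /eqP; rewrite subr_eq0 => /eqP eq1.
transitivity (- (\sum_c isotropy_mx K c a *: torsion nab (E c) (E b) p)).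
  rewrite -sumrN; apply: eq_bigr => c _.
  by rewrite [torsion_matrix _ _ _ _ _ _]mxE TE skew scaleNr.
rewrite eq1 -sumrN; apply: eq_bigr => c _.
by rewrite [torsion_matrix _ _ _ _ _ _]mxE TE torsionC scalerN opprK.
Qed.

(** In the eigenbasis, [isotropy_T0] reads [mu a * B a b + mu b * B b a = 0]; skewness of [B] turns
    this into commutation with the diagonal matrix of eigenvalues. *)
Lemma isotropy_mx_eigen U (mu : 'I_N -> R) : V1 A H V p U ->
  (forall a, T0 A H V nab p U (e a) = mu a *: e a) ->
  forall a b, isotropy_mx K a b * (mu a - mu b) = 0.
Proof.
move=> U1 Ue a b; have [_ VU] := U1.
have conn := canonical_is_connection can.
have [U' U'V U'p] := section_extend hM Vs VU.
have U's := section_smooth U'V.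
have gTe c d : g p (torsion nab U' (E c) p) (e d) = mu c * (c == d)%:R.
  have tT : tangent A p (torsion nab U' (E c) p).
    exact: (vf_tangent p (torsion_smooth hM conn U's (Es c))).
  rewrite g_projH// -(torsion_atE hM conn TS p U's (Es c)) U'p Ep -/(T0 A H V nab p U (e c)).
  by rewrite Ue (ip_Zl _ Hs Hip)// eo.
have U'1 : V1 A H V p (U' p) by rewrite U'p.
have := isotropy_T0 hM Hs Vs sumHV capHV gext can Kiso U'V U'1 (EH b) (EH a).
have [gip _ _] := gext; have Ht := Hs.1 p.
have tT c : tangent A p (torsion nab U' (E c) p).
  exact: (vf_tangent p (torsion_smooth hM conn U's (Es c))).
have -> : torsion nab U' (bracket K (E b)) p =
    \sum_c isotropy_mx K c b *: torsion nab U' (E c) p.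
  rewrite torsionC -[LHS]/(- torsion nab (bracket K (E b)) U' p) torsion_isotropy_mx// -sumrN.
  by apply: eq_bigr => c _; rewrite -scalerN [in RHS]torsionC.
rewrite (isotropy_mxE a) (ip_suml _ _ TS gip)//; last by apply: Ht; rewrite Ep.
rewrite (ip_sumr _ _ TS gip)//; last by move=> c; exact: Ht.
rewrite !Ep (bigD1 a)//= gTe eqxx mulr1 big1 => [|c /negPf ca]; last first.
  by rewrite gTe ca !mulr0.
rewrite addr0 (bigD1 b)//= gTe eqxx mulr1 big1 => [|c /negPf cb]; last first.
  by rewrite gTe eq_sym cb !mulr0.
rewrite addr0 => eq1; rewrite -[RHS]eq1 mulrBr; congr (_ + _).
by apply/eqP; rewrite eq_sym -addr_eq0 -mulrDl isotropy_mx_skew mul0r.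
Qed.

(** As [K p = 0], [[K, W]_p f = - W_p (K f)] depends on [W] only through [W p], so it is determined
    by the basis fields [E a]. *)
Lemma isotropy_mx_eq0 : isotropy_mx K = 0 ->
  forall W, section A H W -> bracket K W p = 0.
Proof.
move=> B0 W [Ws HW].
have KW X f : bracket K X p f = - X p (app K f) by rewrite /bracket Kp sub0r.
apply/funext => f.
have [_ HE] := eb; have := HW p; rewrite HE => -[c Wc].
rewrite KW Wc fct_sumE -sumrN -[RHS]/(0 : R) big1// => a _.
have : bracket K (E a) p f = 0.
  by rewrite isotropy_mxE B0 big1// => b _; rewrite mxE scale0r.
rewrite KW Ep => /eqP; rewrite oppr_eq0 => /eqP Ea.
by rewrite -[(_ *: _) _]/(c a * e a (app K f)) Ea mulr0 oppr0.
Qed.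

End OneField.

End IsotropyMatrix.

Theorem theorem4p15 (R : realType) (M : topologicalType) (n : nat)
    (A : set (chart R M n)) (hM : smooth_manifold A)
    (hconn : connected [set: M])
    (H V : M -> set ((M -> R) -> R))
    (ip : M -> ((M -> R) -> R) -> ((M -> R) -> R) -> R)
    (hsRC : sRC_structure A H V ip)
    (hcomplete : sR_complete A H ip)
    (g : M -> ((M -> R) -> R) -> ((M -> R) -> R) -> R)
    (hg : extending_metric A H V ip g)
    (nab : (M -> (M -> R) -> R) -> (M -> (M -> R) -> R) -> (M -> (M -> R) -> R))
    (hnab : canonical_connection A H V g nab)
    (p : M) (U : (M -> R) -> R) (hU : V1 A H V p U)
    (m : nat) (lam : 'I_m -> R) (p_ : 'I_m -> nat)
    (e : 'I_(\sum_i p_ i) -> (M -> R) -> R)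
    (he : adapted_basis A H V ip nab p U lam e) :
  (dimension (K_bullet A H V ip p)
     <= dimension (skew_block_commutant (torsion_matrix A nab p e)))%E.
Proof.
have Hip := horizontal_metric hsRC.
have [k Hs] := horizontal_subbundle hsRC.
have [l Vs] := vertical_subbundle hsRC.
have sumHV := complement_sum hsRC.
have capHV := complement_cap hsRC.
have [[lam_inj _] eb eo eT] := he.
have He a : H p (e a).
  have [_ ->] := eb; exists (fun b => (b == a)%:R).
  rewrite (bigD1 a)//= eqxx scale1r big1 ?addr0// => b /negPf ->.
  by rewrite scale0r.
have Eex a : exists E, section A H E /\ E p = e a.
  by have [E EH Ep] := section_extend hM Hs (He a); exists E.
have [E EP] := choice Eex.
have EH a : section A H (E a) by have [] := EP a.
have Ep a : E a p = e a by have [] := EP a.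
have Te a : T0 A H V nab p U (e a) = lam (tagnat.sig1 a) *: e a.
  by rewrite -[a]tagnat.sig2K tagnat.Rank1K eT.
(* Dimensions are suprema of sizes of independent families, so it is enough to send each such family
   to an independent one of the same size. *)
apply: le_ereal_sup => _ [q [K [KS Kfree]] <-].
exists q => //; exists (fun i => isotropy_mx ip p e E (K i)).
have Kiso i : isotropy A H V ip p (K i) by exact: (K_bullet_isotropy hM Hs Vs Hip (KS i)).
split=> [i|c c0].
  apply: (skew_block_commutantP (lam := lam)) => //.
  - exact: (isotropy_mx_skew Hip EH Ep (Kiso i)).
  - exact: (isotropy_mx_eigen hM Hs Vs sumHV capHV Hip hg hnab eb eo EH Ep (Kiso i) hU Te).
  - exact: (isotropy_mx_torsion hM Hs Vs sumHV capHV Hip hnab eb eo EH Ep (Kiso i)).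
apply: Kfree.
(* A relation between the matrices says that the matrix of [L] is zero. Rigidity applies to [L] as
   an isotropy field, so no flow of the combination is required. *)
pose L : M -> (M -> R) -> R := fun y => \sum_i c i *: K i y.
have Liso : isotropy A H V ip p L by exact: (isotropy_sum hM c Hs Vs Hip Kiso).
have -> : \sum_i c i *: K i = L by apply/funext => y; rewrite fct_sumE.
have Es a : smooth_vf A (E a) by have [] := EH a.
have Ks i : smooth_vf A (K i) by have [[]] := Kiso i.
have LB : isotropy_mx ip p e E L = 0.
  rewrite -[RHS]c0; apply/matrixP => a b; rewrite summxE mxE (bracket_suml hM)//.
  rewrite (ip_suml _ _ Hs Hip)//; last first.
    by move=> i; have [[_ KH _ _] _ _] := Kiso i; have [_] := KH _ (EH b).
  by apply: eq_bigr => i _; rewrite !mxE.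
have [Lk Lp _] := Liso.
apply: (killing_rigidity hM Hs Vs sumHV capHV hg (horizontal_generating hsRC) Lk hconn Lp).
exact: (isotropy_mx_eq0 Hs Hip eb eo EH Ep Liso LB).
Qed.
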